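(* Consider the linear regression setting and the hierarchical Bayesian model with hyper-pMOM priors and a complexity prior (with constants $c_1,c_2$) on the model space described in the context. Assume: (1) There exist $\epsilon_n<1$ such that $0<\epsilon_n\le\lambda_k^m\le\lambda_k^M\le\epsilon_n^{-1}$ for every nonempty model $\mathbf k$, where $\epsilon_n^{-1}=O((\log n)^{1/8})$. (2) $\pi(\mathbf k)=0$ for all models with $|\mathbf k|>q_n$, where $q_n=O(n^{\xi})$ and $\xi<1$ (and $|\mathbf t|\le q_n$). (3) There are constants $a_1,a_2$ not depending on $n$ such that, for every $n\ge1$, all eigenvalues of $A_p$ lie strictly between $a_1$ and $a_2$, where $0<a_1<a_2<\infty$. (4) There exists a constant $0<\kappa<1$ such that $\log p=O(n^{\kappa})$. (5) $c_2>1$. Then $$\pi(\mathbf t\mid\mathbf y_n)\to1\quad\text{in probability as }n\to\infty .$$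
   Context: **Data.** The number of coefficients $p=p_n$ increases with the sample size $n$. $X_n$ is an $n\times p$ design matrix. The data are truly generated by $\mathbf y_n=X_n\boldsymbol\beta_0+\boldsymbol\epsilon_n$, where the entries of $\boldsymbol\epsilon_n$ are i.i.d. $N(0,\sigma_0^2)$ and $\boldsymbol\beta_0\in\mathbb R^{p_n}$. The nonzero entries of $\boldsymbol\beta_0$ are exactly those with index in $\mathbf t\subseteq\{1,\dots,p_n\}$. The set $\mathbf t$, the vector $\boldsymbol\beta_{0,t}$ of nonzero entries, and $\sigma_0^2>0$ do not vary with $n$. Convergence in probability is with respect to this true law of $\mathbf y_n$. **Models.** A model is a subset $\mathbf k=\{k_1,\dots,k_m\}\subseteq\{1,\dots,p\}$, the set of indices of nonzero coefficients. Its cardinality is also denoted $k=|\mathbf k|$, and $t=|\mathbf t|$. $X_k$ is the submatrix of $X_n$ formed by the columns in $\mathbf k$; $\boldsymbol\beta_k=(\beta_{k_1},\dots,\beta_{k_k})^T$; $A_k$ is the $k\times k$ principal submatrix of the symmetric $p\times p$ matrix $A_p$ indexed by $\mathbf k$. **Hierarchical model.** Fix a positive integer $r$ and constants $\alpha_1,\alpha_2,c_1,c_2>0$. Set - $\mathbf y_n\mid\boldsymbol\beta_k,\sigma^2,\mathbf k\sim N(X_k\boldsymbol\beta_k,\sigma^2I_n)$; - $\pi(\boldsymbol\beta_k\mid\tau,\sigma^2,\mathbf k)=d_k(2\pi)^{-k/2}(\tau\sigma^2)^{-rk-k/2}|A_k|^{1/2}\exp\{-\boldsymbol\beta_k^TA_k\boldsymbol\beta_k/(2\tau\sigma^2)\}\prod_{i=1}^k\beta_{k_i}^{2r}$,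 where $d_k$ is the normalizing constant (independent of $\tau,\sigma^2$); - complexity prior: $\pi(\mathbf k)\propto c_1^{-k}p^{-c_2k}$, $k=|\mathbf k|$, over the models with $|\mathbf k|\le q_n$ (and $\pi(\mathbf k)=0$ for the other models); - $\pi(\tau)=\frac{(n/2)^{1/2}}{\Gamma(1/2)}\tau^{-3/2}e^{-n/(2\tau)}$, $\tau>0$; - $\pi(\sigma^2)=\frac{\alpha_2^{\alpha_1}}{\Gamma(\alpha_1)}(\sigma^2)^{-(\alpha_1+1)}e^{-\alpha_2/\sigma^2}$, $\sigma^2>0$. The marginal density is $m_{\mathbf k}(\mathbf y_n)=\int_0^\infty\int_0^\infty\int_{\mathbb R^k}\pi(\mathbf y_n\mid\boldsymbol\beta_k,\sigma^2,\mathbf k)\,\pi(\boldsymbol\beta_k\mid\tau,\sigma^2,\mathbf k)\,\pi(\tau)\,\pi(\sigma^2)\,d\boldsymbol\beta_k\,d\sigma^2\,d\tau$, and the posterior probability of model $\mathbf k$ is $\pi(\mathbf k\mid\mathbf y_n)=\pi(\mathbf k)m_{\mathbf k}(\mathbf y_n)/\sum_{\mathbf j}\pi(\mathbf j)m_{\mathbf j}(\mathbf y_n)$. **Eigenvalues.** $\nu_j(A)$ is the $j$-th largest nonzero eigenvalue of a symmetric matrix $A$; $\lambda_k^m=\min_{1\le j\le\min(n,k)}\nu_j(X_k^TX_k/n)$ and $\lambda_k^M=\max_{1\le j\le\min(n,k)}\nu_j(X_k^TX_k/n)$. *)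

(* Defs.v *)
From HB Require Import structures.
From mathcomp Require Import all_boot all_order all_algebra finmap.
From mathcomp Require Import all_classical all_reals all_analysis.
Import Order.TTheory GRing.Theory Num.Theory numFieldNormedType.Exports.

Set Implicit Arguments.
Unset Strict Implicit.
Unset Printing Implicit Defensive.

Local Open Scope classical_set_scope.
Local Open Scope ring_scope.

(* Eigenvalues with multiplicity, in decreasing order.  The defining set is
   nonempty when A is symmetric; the value is [::] if the characteristic
   polynomial of A does not split over R. *)
Definition eigenvalues (R : realType) (m : nat) (A : 'M[R]_m) : seq R :=
  sort (fun a b : R => b <= a)
    (xget [::] [set s : seq R | char_poly A = \prod_(a <- s) ('X - a%:P)]).

(* j-th largest nonzero eigenvalue, j >= 1, counted with multiplicity.  It is 0
   if A has fewer than j nonzero eigenvalues, so a positive lower bound on it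
   asserts in particular that it exists. *)
Definition nu (R : realType) (m : nat) (A : 'M[R]_m) (j : nat) : R :=
  nth 0 [seq a <- eigenvalues A | a != 0] j.-1.

Definition submodel_mx (R : realType) (n p : nat) (X : 'M[R]_(n, p))
    (k : {set 'I_p}) : 'M[R]_(n, #|k|) :=
  colsub (fun i : 'I_#|k| => enum_val i) X.

Definition principal_mx (R : realType) (p : nat) (A : 'M[R]_p)
    (k : {set 'I_p}) : 'M[R]_#|k| :=
  mxsub (fun i : 'I_#|k| => enum_val i) (fun i : 'I_#|k| => enum_val i) A.

Definition gram (R : realType) (n p : nat) (X : 'M[R]_(n, p))
    (k : {set 'I_p}) : 'M[R]_#|k| :=
  n%:R^-1 *: ((submodel_mx X k)^T *m submodel_mx X k).

Definition lambda_min (R : realType) (n p : nat) (X : 'M[R]_(n, p))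
    (k : {set 'I_p}) : R :=
  \big[Num.min/nu (gram X k) 1]_(1 <= j < (minn n #|k|).+1) nu (gram X k) j.

Definition lambda_max (R : realType) (n p : nat) (X : 'M[R]_(n, p))
    (k : {set 'I_p}) : R :=
  \big[Num.max/nu (gram X k) 1]_(1 <= j < (minn n #|k|).+1) nu (gram X k) j.

(* Lebesgue integral over R^k, written as an iterated integral; it is only used
   for nonnegative measurable functions, where Tonelli's theorem applies. *)
Fixpoint integral_Rn (R : realType) (k : nat) :
    (k.-tuple R -> \bar R) -> \bar R :=
  match k with
  | 0 => fun f => f [tuple]
  | k'.+1 => fun f => (\int[lebesgue_measure]_x
      integral_Rn (fun b : k'.-tuple R => f [tuple of (x : R) :: b]))%E
  end.

Definition col_of_tuple (R : realType) (k : nat) (b : k.-tuple R) : 'cV[R]_k :=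
  \col_i tnth b i.

(* In the densities below, v stands for the variance sigma^2. *)

Definition likelihood (R : realType) (n k : nat) (Xk : 'M[R]_(n, k))
    (y : 'cV[R]_n) (b : 'cV[R]_k) (v : R) : R :=
  (2 * pi * v) `^ (- (n%:R / 2)) *
  expR (- (\sum_(i < n) ((y - Xk *m b) i 0) ^+ 2) / (2 * v)).

Definition pmom_kernel (R : realType) (r k : nat) (Ak : 'M[R]_k) (tau v : R)
    (b : 'cV[R]_k) : R :=
  (2 * pi) `^ (- (k%:R / 2)) * (tau * v) `^ (- (r * k)%:R - k%:R / 2) *
  Num.sqrt (\det Ak) * expR (- ((b^T *m Ak *m b) 0 0) / (2 * (tau * v))) *
  \prod_(i < k) (b i 0) ^+ (2 * r).

(* The normalizing constant d_k.  The substitution b = sqrt (tau * v) * u shows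
   that its value is the same for all tau, v > 0. *)
Definition pmom_const (R : realType) (r k : nat) (Ak : 'M[R]_k) (tau v : R) : R :=
  (fine (integral_Rn (fun b : k.-tuple R =>
     (pmom_kernel r Ak tau v (col_of_tuple b))%:E)))^-1.

Definition pmom_pdf (R : realType) (r k : nat) (Ak : 'M[R]_k) (tau v : R)
    (b : 'cV[R]_k) : R :=
  pmom_const r Ak tau v * pmom_kernel r Ak tau v b.

Definition Gamma (R : realType) (a : R) : R :=
  \int[lebesgue_measure]_(x in `]0, +oo[) (x `^ (a - 1) * expR (- x)).

Definition inv_gamma_pdf (R : realType) (a b x : R) : R :=
  b `^ a / Gamma a * x `^ (- (a + 1)) * expR (- b / x).

(* The prior on tau is inverse-gamma with parameters 1/2 and n/2. *)
Definition marginal (R : realType) (r : nat) (alpha1 alpha2 : R) (n p : nat)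
    (X : 'M[R]_(n, p)) (A : 'M[R]_p) (k : {set 'I_p}) (y : 'cV[R]_n) : \bar R :=
  (\int[lebesgue_measure]_(tau in `]0%R, +oo[)
   \int[lebesgue_measure]_(v in `]0%R, +oo[)
     integral_Rn (fun b : #|k|.-tuple R =>
       (likelihood (submodel_mx X k) y (col_of_tuple b) v *
        pmom_pdf r (principal_mx A k) tau v (col_of_tuple b) *
        inv_gamma_pdf (1 / 2) (n%:R / 2) tau *
        inv_gamma_pdf alpha1 alpha2 v)%:E))%E.

Definition complexity_weight (R : realType) (c1 c2 q : R) (p : nat)
    (k : {set 'I_p}) : R :=
  if #|k|%:R <= q then c1 ^- #|k| * p%:R `^ (- (c2 * #|k|%:R)) else 0.

Definition model_prior (R : realType) (c1 c2 q : R) (p : nat)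
    (k : {set 'I_p}) : R :=
  complexity_weight c1 c2 q k /
  \sum_(j : {set 'I_p}) complexity_weight c1 c2 q j.

Definition posterior (R : realType) (r : nat) (alpha1 alpha2 c1 c2 q : R)
    (n p : nat) (X : 'M[R]_(n, p)) (A : 'M[R]_p) (k : {set 'I_p})
    (y : 'cV[R]_n) : R :=
  model_prior c1 c2 q k * fine (marginal r alpha1 alpha2 X A k y) /
  \sum_(j : {set 'I_p})
    model_prior c1 c2 q j * fine (marginal r alpha1 alpha2 X A j y).

(* Indices are 0-based: the coordinates of R^p are 0, ..., p - 1. *)
Definition model_of (p : nat) (t : {fset nat}) : {set 'I_p} :=
  finset (fun i : 'I_p => (i : nat) \in t).

Definition mutually_independent (R : realType) (d : measure_display)
    (T : measurableType d) (P : probability T R) (I : finType)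
    (Z : I -> {RV P >-> R}) : Prop :=
  forall (J : {set I}) (B : I -> set R), (forall i, measurable (B i)) ->
    P (\bigcap_(i in [set` J]) (Z i @^-1` B i)) =
    (\prod_(i in J) P (Z i @^-1` B i))%E.

Definition cvg_in_probability (R : realType) (d : measure_display)
    (T : measurableType d) (P : probability T R) (Y : nat -> T -> R) (c : R) :
    Prop :=
  forall e : R, 0 < e ->
    P [set w | e <= `|Y n w - c|] @[n --> \oo] --> 0%E.

(* Main.v *)
Require Import Defs.
From HB Require Import structures.
From mathcomp Require Import all_boot all_order all_algebra finmap.
From mathcomp Require Import all_classical all_reals all_analysis.
From mathcomp Require Import measurable_realfun complex ring lra.
Import Order.TTheory GRing.Theory Num.Theory numFieldNormedType.Exports.

Set Implicit Arguments.
Unset Strict Implicit.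
Unset Printing Implicit Defensive.

Local Open Scope classical_set_scope.
Local Open Scope ring_scope.

(** Gaussian moments in the coefficients and inverse-gamma integrals in the two
    scales bound the evidence of a model k above by
    (C eps_n^-(2r+1) / sqrt n)^|k| (RSS_k / 2 + alpha2)^-(n/2 + alpha1), up to
    powers of |k| / n, and that of t below by the analogous expression in which
    RSS_t / 2 + alpha2 is replaced by |eps|^2 / 2 + C'.  Both bounds hold when
    |eps|^2 has order n and the least squares estimate under t is close to the
    truth, which fails with vanishing probability.

    The posterior odds of k against t are therefore a deterministic coefficient
    times a negative power of the ratio of RSS_k / 2 + alpha2 to
    |eps|^2 / 2 + C'.  Raised to a power 1 - 4 delta slightly below 1, this
    random factor has an expectation of order (C / eps_n)^|k|, and even
    exp(-c eps_n n) times that if k misses an index of t: exp(- a RSS_k / 2) is a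
    Gaussian integral over b of exp(- a |y - X_k b|^2 / 2), whence a Chernoff
    bound for RSS_k <= x |eps|^2.

    Since c_2 (1 - 4 delta) >= 1, the prior odds contribute p^-|k \ t|, which
    compensates the number of models.  For k containing t properly what remains is
    a power of 1 / eps_n, i.e. of log n, over n^(1/4); for the other models the
    exponential factor wins.  Markov's inequality concludes. *)

(** * Iterated integrals *)

(** The power [1 - 4 * de] answers an obstacle. For a fixed model the probability that [rss] drops
    below [x |eps|^2] decays like [x ^ ((n - k) / 2)], while the odds contain the residual quotient
    to the power [-(n / 2 + alpha1 + r k)]; a tail of that order controls no such moment, so
    Markov's inequality cannot be applied to the odds themselves. The exponent [r k] cannot be
    avoided: the prior moments at the least squares estimate bring in [|y|^2 / rss], which has no
    deterministic bound. As the tail exponent proved is [(1 - de) (n - k) / 2] and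
    [alpha1 + (r + 1) k <= de n] eventually, the factor [1 - 4 * de] restores integrability with a
    margin. The prior odds are lowered by the same power, which [c2 > 1] permits, and subadditivity
    of [x ^ g] for [g <= 1] carries the power into the sum over models.

    The good noise concerns [eps] and [t] only: every other model enters through a moment, so no
    union bound over models is taken. Powers of [n] of order [|t|] from the evidence of [t] are
    harmless against an exponential but must cancel exactly when [k] contains [t]; hence two sets of
    coefficient bounds. *)

Section integrals.
Context d (T : measurableType d) (R : realType) (mu : {measure set T -> \bar R}).
Local Open Scope ereal_scope.

(** The integral of a nonnegative function is a supremum over the simple functions below it, hence
    monotone without any measurability. This spares measurability proofs for the inner integrals of
    the evidence. *)
Lemma ge0_le_integral_gen (D : set T) (f g : T -> \bar R) :
  (forall x, D x -> 0 <= f x) -> (forall x, D x -> f x <= g x) ->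
  \int[mu]_(x in D) f x <= \int[mu]_(x in D) g x.
Proof.
move=> f0 fg.
rewrite [leLHS]ge0_integralE// [leRHS]ge0_integralE; last first.
  by move=> x Dx; exact: le_trans (f0 _ Dx) (fg _ Dx).
apply: ge_ereal_sup => _ /= [h hf <-]; apply: ereal_sup_ubound.
exists h => // x; apply: le_trans (hf x) _.
rewrite /patch; case: ifPn => // /[!inE]; exact: fg.
Qed.

Lemma integral_le_cst (D : set T) (f g : T -> \bar R) (m : R) (c : R) :
  measurable D -> (0 <= c)%R -> measurable_fun D g ->
  (forall x, D x -> 0 <= g x) ->
  (forall x, D x -> 0 <= f x) -> (forall x, D x -> f x <= c%:E * g x) ->
  \int[mu]_(x in D) g x <= m%:E ->
  \int[mu]_(x in D) f x <= (c * m)%:E.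
Proof.
move=> mD c0 mg g0 f0 fg gm.
apply: (le_trans (ge0_le_integral_gen f0 fg)).
by rewrite ge0_integralZl_EFin// EFinM lee_wpmul2l.
Qed.

End integrals.

(** [1 / u = u / u ^ 2] reduces inversion to a real power of a nonnegative base; the identity
    survives at [u = 0], where the inverse is 0 by convention. *)
Lemma measurable_funV d (T : measurableType d) (R : realType) (D : set T) (f : T -> R) :
  measurable_fun D f -> measurable_fun D (fun x => (f x)^-1).
Proof.
move=> mf.
have -> : (fun x => (f x)^-1) = (fun x => ((f x) ^+ 2) `^ (-1) * f x).
  apply/funext => x; rewrite powR_inv1 ?sqr_ge0//.
  have [->|f0] := eqVneq (f x) 0; first by rewrite invr0 mulr0.
  by rewrite expr2 invfM -mulrA mulVf// mulr1.
apply: measurable_funM => //.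
have m2 : measurable_fun D (fun x => f x ^+ 2) by exact: measurable_funX.
exact: (measurableT_comp (f := (@powR R)^~ (-1)) (measurable_powR _) m2).
Qed.

Section integral_Rn.
Context (R : realType).
Local Open Scope ereal_scope.

Lemma integral_Rn_ge0 k (f : k.-tuple R -> \bar R) :
  (forall b, 0 <= f b) -> 0 <= integral_Rn f.
Proof.
elim: k f => [|k IH] f f0 /=; first exact: f0.
by apply: integral_ge0 => x _; apply: IH => b; exact: f0.
Qed.

Lemma le_integral_Rn k (f g : k.-tuple R -> \bar R) :
  (forall b, 0 <= f b) -> (forall b, f b <= g b) ->
  integral_Rn f <= integral_Rn g.
Proof.
elim: k f g => [|k IH] f g f0 fg /=; first exact: fg.
apply: ge0_le_integral_gen => x _; last by apply: IH => b; [exact: f0|exact: fg].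
by apply: integral_Rn_ge0 => b; exact: f0.
Qed.

Lemma eq_integral_Rn k (f g : k.-tuple R -> \bar R) :
  f =1 g -> integral_Rn f = integral_Rn g.
Proof. by move=> /funext ->. Qed.

(** The induction generalizes over the parameter space: the outermost coordinate moves into it, and
    Tonelli's theorem on [U * R] then integrates it out. *)
Lemma measurable_integral_Rn d (U : measurableType d) k
    (f : U * k.-tuple R -> \bar R) :
  measurable_fun setT f -> (forall z, 0 <= f z) ->
  measurable_fun setT (fun u => integral_Rn (fun b => f (u, b))).
Proof.
elim: k d U f => [|k IH] d U f mf f0 /=.
  by apply: (measurableT_comp mf); exact: measurable_fun_pair.
pose g (z : (U * R) * k.-tuple R) := f (z.1.1, [tuple of z.1.2 :: z.2]).
have mg : measurable_fun setT g.
  apply: (measurableT_comp mf); apply: measurable_fun_pair => /=.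
    exact: measurableT_comp.
  by apply: measurable_cons => //; exact: measurableT_comp.
pose G (z : U * R) := integral_Rn (fun b => g (z, b)).
have mG : measurable_fun setT G by apply: IH => // z; exact: f0.
have G0 z : 0 <= G z by apply: integral_Rn_ge0 => b; exact: f0.
exact: (measurable_fun_fubini_tonelli_F (m2 := @lebesgue_measure R) G mG G0).
Qed.

(** This interchange is what the Chernoff bound needs: expectation over the noise against
    integration over the coefficients. Tonelli's theorem swaps one coordinate, and the induction
    swaps the others with that coordinate fixed. *)
Lemma integral_Rn_tonelli d (U : measurableType d)
    (mu : {sigma_finite_measure set U -> \bar R}) k
    (f : U * k.-tuple R -> \bar R) :
  measurable_fun setT f -> (forall z, 0 <= f z) ->
  \int[mu]_u integral_Rn (fun b => f (u, b)) =
  integral_Rn (fun b => \int[mu]_u f (u, b)).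
Proof.
elim: k f => [|k IH] f mf f0 //=.
pose g (z : (U * R) * k.-tuple R) := f (z.1.1, [tuple of z.1.2 :: z.2]).
have mg : measurable_fun setT g.
  apply: (measurableT_comp mf); apply: measurable_fun_pair => /=.
    exact: measurableT_comp.
  by apply: measurable_cons => //; exact: measurableT_comp.
pose G (z : U * R) := integral_Rn (fun b => g (z, b)).
have mG : measurable_fun setT G.
  by apply: measurable_integral_Rn => // z; exact: f0.
have G0 z : 0 <= G z by apply: integral_Rn_ge0 => b; exact: f0.
rewrite (fubini_tonelli (m1 := mu) (m2 := @lebesgue_measure R) G mG G0).
apply: eq_integral => x _.
apply: (IH (fun z => f (z.1, [tuple of x :: z.2]))) => [|z]; last exact: f0.
apply: (measurableT_comp mf); apply: measurable_fun_pair => //=.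
exact: measurable_cons.
Qed.

(** The constant [c] takes part in the induction: with the first coordinate fixed, its factor is
    absorbed into [c]. *)
Lemma integral_Rn_prod k (c : R) (f : 'I_k -> R -> R) (m : 'I_k -> R) :
  (0 <= c)%R ->
  (forall i x, (0 <= f i x)%R) -> (forall i, measurable_fun setT (f i)) ->
  (forall i, \int[lebesgue_measure]_x (f i x)%:E = (m i)%:E) ->
  integral_Rn (fun b : k.-tuple R => (c * \prod_(i < k) f i (tnth b i))%:E) =
  (c * \prod_(i < k) m i)%:E.
Proof.
elim: k c f m => [|k IH] c f m c0 f0 mf hm /=; first by rewrite !big_ord0.
transitivity (\int[lebesgue_measure]_x
   ((c * \prod_(i < k) m (lift ord0 i))%:E * (f ord0 x)%:E)).
  apply: eq_integral => x _.
  rewrite -EFinM -mulrA [X in (c * X)%R]mulrC mulrA.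
  rewrite -(IH (c * f ord0 x)%R (fun i => f (lift ord0 i)))//; last first.
    by rewrite mulr_ge0.
  apply: eq_integral_Rn => b; rewrite big_ord_recl/= mulrA; congr (_ * _)%:E.
  by apply: eq_bigr => i _; rewrite tnthS.
have c'0 : (0 <= c * \prod_(i < k) m (lift ord0 i))%R.
  apply: mulr_ge0 => //; apply: prodr_ge0 => i _.
  by rewrite -lee_fin -hm; apply: integral_ge0 => x _; rewrite lee_fin.
rewrite ge0_integralZl_EFin//; last 2 first.
  by move=> x _; rewrite lee_fin.
  by apply/measurable_EFinP; exact: mf.
by rewrite hm -EFinM big_ord_recl [in RHS](mulrC (m ord0)) mulrA.
Qed.

Lemma integral_Rn_le_prod k (g : k.-tuple R -> \bar R) (c M : R) (f : 'I_k -> R -> R) :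
  (0 <= c)%R ->
  (forall i x, (0 <= f i x)%R) -> (forall i, measurable_fun setT (f i)) ->
  (forall i, \int[lebesgue_measure]_x (f i x)%:E <= M%:E) ->
  (forall b, 0 <= g b) ->
  (forall b, g b <= (c * \prod_(i < k) f i (tnth b i))%:E) ->
  integral_Rn g <= (c * M ^+ k)%:E.
Proof.
move=> c0 f0 mf hM g0 gf; apply: (le_trans (le_integral_Rn g0 gf)).
have hI i : \int[lebesgue_measure]_x (f i x)%:E \is a fin_num.
  rewrite ge0_fin_numE; last by apply: integral_ge0 => x _; rewrite lee_fin.
  exact: le_lt_trans (hM i) (ltry _).
rewrite (@integral_Rn_prod _ _ _
  (fun i => fine (\int[lebesgue_measure]_x (f i x)%:E)))//; last first.
  by move=> i; rewrite fineK.
rewrite lee_fin ler_wpM2l// -[X in (M ^+ X)%R]card_ord -prodr_const.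
apply: ler_prod => i _; apply/andP; split.
  by apply: fine_ge0; apply: integral_ge0 => x _; rewrite lee_fin.
by rewrite -lee_fin fineK.
Qed.

Lemma integral_Rn_ge_prod k (g : k.-tuple R -> \bar R) (c M : R)
    (f : 'I_k -> R -> R) :
  (0 <= c)%R -> (0 <= M)%R ->
  (forall i x, (0 <= f i x)%R) -> (forall i, measurable_fun setT (f i)) ->
  (forall i, M%:E <= \int[lebesgue_measure]_x (f i x)%:E) ->
  (forall i, \int[lebesgue_measure]_x (f i x)%:E < +oo) ->
  (forall b, (c * \prod_(i < k) f i (tnth b i))%:E <= g b) ->
  (c * M ^+ k)%:E <= integral_Rn g.
Proof.
move=> c0 M0 f0 mf hM hI gf.
have hI' i : \int[lebesgue_measure]_x (f i x)%:E \is a fin_num.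
  by rewrite ge0_fin_numE//; apply: integral_ge0 => x _; rewrite lee_fin.
apply: le_trans (le_integral_Rn _ gf); last first.
  by move=> b; rewrite lee_fin mulr_ge0// prodr_ge0.
rewrite (@integral_Rn_prod _ _ _
  (fun i => fine (\int[lebesgue_measure]_x (f i x)%:E)))//; last first.
  by move=> i; rewrite fineK.
rewrite lee_fin ler_wpM2l// -[X in (M ^+ X)%R]card_ord -prodr_const.
apply: ler_prod => i _; rewrite M0/=.
by rewrite -lee_fin fineK.
Qed.

End integral_Rn.

(** * Gaussian moments *)

Section gaussian.
Context (R : realType).
Notation mu := (@lebesgue_measure R).

Lemma measurable_gauss (a m : R) :
  measurable_fun setT (fun x : R => expR (- (a * (x - m) ^+ 2))).
Proof.
apply: measurableT_comp => //; apply: measurableT_comp => //.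
apply: measurable_funM => //; apply: measurable_funX.
exact: measurable_funB.
Qed.

(** The normal density with mean [m] and variance [(2 * a)^-1] has total mass 1. *)
Lemma integral_gauss (a m : R) : 0 < a ->
  (\int[mu]_x (expR (- (a * (x - m) ^+ 2)))%:E = (Num.sqrt (pi / a))%:E)%E.
Proof.
move=> a0; pose s := Num.sqrt ((2 * a)^-1).
have s2 : s ^+ 2 = (2 * a)^-1 by rewrite sqr_sqrtr// invr_ge0 mulr_ge0// ltW.
have s0 : s != 0 by rewrite gt_eqF// sqrtr_gt0 invr_gt0 mulr_gt0.
have p0 : 0 < normal_peak s by exact: normal_peak_gt0.
have := integral_normal_pdf m s.
under eq_integral do rewrite normal_pdfE// EFinM.
rewrite ge0_integralZl_EFin//; last 3 first.
  by move=> x _; rewrite lee_fin normal_fun_ge0.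
  by apply/measurable_EFinP; exact: measurable_normal_fun.
  exact: ltW.
have -> : (\int[mu]_x (normal_fun m s x)%:E =
    \int[mu]_x (expR (- (a * (x - m) ^+ 2)))%:E)%E.
  apply: eq_integral => x _; rewrite /normal_fun; congr (expR _)%:E.
  by rewrite s2; field; rewrite gt_eqF.
set I := (X in (_ * X)%E) => h.
have I0 : (0 <= I)%E by apply: integral_ge0 => x _; rewrite lee_fin expR_ge0.
have If : I \is a fin_num.
  move: I0 h; case: I => //= _; rewrite gt0_muley ?lte_fin//.
have {}h : normal_peak s * fine I = 1 by apply: EFin_inj; rewrite EFinM fineK.
rewrite -[LHS](fineK If); apply: (congr1 EFin).
have -> : Num.sqrt (pi / a) = (normal_peak s)^-1.
  by rewrite /normal_peak invrK; congr Num.sqrt; rewrite s2; field; rewrite gt_eqF.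
by apply: (mulfI (lt0r_neq0 p0)); rewrite h divff// gt_eqF.
Qed.

(** With [u = y / (2 r)], raise [u <= 1 + u <= exp u] to the power [r]. *)
Lemma expr_le_expR (r : nat) (y : R) : 0 <= y -> y ^+ r <= (2 * r%:R) ^+ r * expR (y / 2).
Proof.
move=> y0; case: r => [|r]; first by rewrite !expr0 mul1r -expR0 ler_expR divr_ge0.
have r0 : 0 < 2 * r.+1%:R :> R by rewrite mulr_gt0// ltr0n.
have -> : expR (y / 2) = expR (y / (2 * r.+1%:R)) ^+ r.+1.
  rewrite -expRM_natl; congr expR; move: (r.+1%:R) r0 => q q0.
  by field; move: q0; rewrite pmulr_rgt0// => /lt0r_neq0.
rewrite -exprMn; apply: lerXn2r; rewrite ?nnegrE//.
rewrite -ler_pdivrMl// mulrC; apply: le_trans (expR_ge1Dx _) .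
by rewrite lerDr.
Qed.

(** The first three factors come from the pointwise bound [gauss_moment_pt]; the last one comes from
    the mass of a Gaussian of halved precision. *)
Definition moment_const (r : nat) : R :=
  2 ^+ r * (2 * r%:R) ^+ r * expR (1 / 2) * Num.sqrt (2 * pi).

Lemma moment_const_gt0 r : 0 < moment_const r.
Proof.
rewrite /moment_const !mulr_gt0 ?expR_gt0 ?sqrtr_gt0 ?mulr_gt0 ?pi_gt0//.
case: r => // r; by rewrite exprn_gt0// mulr_gt0// ltr0n.
Qed.

(** With [u = x - m], [x ^ 2 <= 2 (m ^ 2 + u ^ 2) <= 2 (m ^ 2 + 1 / a) (1 + a u ^ 2)], and half of
    the Gaussian exponent pays for the power [r] of [1 + a u ^ 2]. *)
Lemma gauss_moment_pt (r : nat) (a m x : R) : 0 < a ->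
  expR (- (a * (x - m) ^+ 2)) * x ^+ (2 * r) <=
  2 ^+ r * (2 * r%:R) ^+ r * expR (1 / 2) * (m ^+ 2 + a^-1) ^+ r *
  expR (- (a / 2 * (x - m) ^+ 2)).
Proof.
move=> a0.
set u := x - m.
have x2 : x ^+ 2 <= 2 * ((m ^+ 2 + a^-1) * (1 + a * u ^+ 2)).
  have -> : (m ^+ 2 + a^-1) * (1 + a * u ^+ 2) =
      m ^+ 2 + a^-1 + a * m ^+ 2 * u ^+ 2 + u ^+ 2.
    by field; rewrite gt_eqF.
  have -> : x ^+ 2 = (u + m) ^+ 2 by rewrite /u subrK.
  have ai : 0 <= a^-1 by rewrite invr_ge0 ltW.
  have am : 0 <= a * m ^+ 2 * u ^+ 2.
    by apply: mulr_ge0; [apply: mulr_ge0|]; rewrite ?sqr_ge0// ltW.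
  have := sqr_ge0 (u - m); clearbody u; rewrite sqrrB sqrrD => um.
  move: (a * m ^+ 2 * u ^+ 2) am (a^-1) ai => w w0 ia ia0; lra.
have q0 : 0 <= 1 + a * u ^+ 2 by rewrite addr_ge0// mulr_ge0 ?sqr_ge0// ltW.
have p0 : 0 <= m ^+ 2 + a^-1 by rewrite addr_ge0// ?sqr_ge0// invr_ge0 ltW.
have h1 : x ^+ (2 * r) <= 2 ^+ r * (m ^+ 2 + a^-1) ^+ r *
   ((2 * r%:R) ^+ r * expR ((1 + a * u ^+ 2) / 2)).
  rewrite exprM; apply: (@le_trans _ _ ((2 * ((m ^+ 2 + a^-1) * (1 + a * u ^+ 2))) ^+ r)).
    by apply: lerXn2r; rewrite ?nnegrE ?sqr_ge0// !mulr_ge0.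
  rewrite exprMn (exprMn _ (m ^+ 2 + a^-1)) mulrA ler_wpM2l//.
      by rewrite mulr_ge0// exprn_ge0.
  exact: expr_le_expR.
apply: (@le_trans _ _ (expR (- (a * u ^+ 2)) * (2 ^+ r * (m ^+ 2 + a^-1) ^+ r *
   ((2 * r%:R) ^+ r * expR ((1 + a * u ^+ 2) / 2))))).
  by rewrite ler_wpM2l ?expR_ge0.
have -> : expR (- (a / 2 * u ^+ 2)) = expR (- (a * u ^+ 2)) * expR (a * u ^+ 2 / 2).
  by rewrite -expRD; congr expR; field.
have -> : expR ((1 + a * u ^+ 2) / 2) = expR (1 / 2) * expR (a * u ^+ 2 / 2).
  by rewrite -expRD mulrDl.
by rewrite le_eqVlt; apply/orP; left; apply/eqP; ring.
Qed.

Lemma gauss_moment_ub (r : nat) (a m : R) : 0 < a ->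
  (\int[mu]_x (expR (- (a * (x - m) ^+ 2)) * x ^+ (2 * r))%:E <=
   (moment_const r * (m ^+ 2 + a^-1) ^+ r / Num.sqrt a)%:E)%E.
Proof.
move=> a0.
have c0 : 0 <= 2 ^+ r * (2 * r%:R) ^+ r * expR (1 / 2) * (m ^+ 2 + a^-1) ^+ r.
  rewrite !mulr_ge0 ?expR_ge0 ?exprn_ge0// ?mulr_ge0//.
  by rewrite addr_ge0// ?sqr_ge0// invr_ge0 ltW.
have -> : moment_const r * (m ^+ 2 + a^-1) ^+ r / Num.sqrt a =
   2 ^+ r * (2 * r%:R) ^+ r * expR (1 / 2) * (m ^+ 2 + a^-1) ^+ r *
   Num.sqrt (pi / (a / 2)).
  have -> : pi / (a / 2) = (2 * pi) * a^-1 :> R by field; rewrite gt_eqF.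
  rewrite sqrtrM; last by rewrite mulr_ge0// pi_ge0.
  by rewrite sqrtrV ?ltW// /moment_const; ring.
apply: (@integral_le_cst _ _ R mu setT _
  (fun x : R => (expR (- (a / 2 * (x - m) ^+ 2)))%:E) _ _ measurableT c0) => //.
- by apply/measurable_EFinP; exact: measurable_gauss.
- by move=> x _; rewrite lee_fin mulr_ge0 ?expR_ge0// exprM exprn_ge0// sqr_ge0.
- by move=> x _; rewrite -EFinM lee_fin; exact: gauss_moment_pt.
- by rewrite integral_gauss ?divr_gt0.
Qed.

(* Only the mass of an interval of length a^(-1/2) is kept; it starts at m and
   points away from 0. *)
Lemma gauss_moment_lb (r : nat) (a b m : R) : 0 < a -> 0 <= b ->
  ((m ^+ (2 * r) / Num.sqrt a *
    expR (- 1 - b * (2 * m ^+ 2 + 2 / a)))%:E <=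
   \int[mu]_x (expR (- (a * (x - m) ^+ 2) - b * x ^+ 2) * x ^+ (2 * r))%:E)%E.
Proof.
move=> a0 b0; pose l : R := (Num.sqrt a)^-1.
have l0 : 0 < l by rewrite invr_gt0 sqrtr_gt0.
have l2 : l ^+ 2 = a^-1 by rewrite exprVn sqr_sqrtr// ltW.
pose s := if 0 <= m then m else m - l.
pose c := m ^+ (2 * r) * expR (- 1 - b * (2 * m ^+ 2 + 2 / a)).
have c0 : 0 <= c by rewrite mulr_ge0 ?expR_ge0// exprM exprn_ge0// sqr_ge0.
rewrite -/l; have -> : m ^+ (2 * r) * l * expR (- 1 - b * (2 * m ^+ 2 + 2 / a)) = c * l.
  by rewrite /c; ring.
have -> : ((c * l)%:E = \int[mu]_(x in `[s, (s + l)%R]) (cst c%:E x))%E.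
  rewrite integral_cst//= lebesgue_measure_itv/= lte_fin ltrDl l0.
  by rewrite -EFinB addrAC subrr add0r.
rewrite integral_mkcond; apply: ge0_le_integral_gen => x _.
  by rewrite patchE; case: ifP => // _; rewrite lee_fin.
rewrite patchE; case: ifPn => [|_]; last first.
  by rewrite lee_fin mulr_ge0 ?expR_ge0// exprM exprn_ge0// sqr_ge0.
rewrite inE/= in_itv/= lee_fin => /andP[]; move: (x : R) => {}x sx xs.
rewrite /c mulrC.
have xm2 : (x - m) ^+ 2 <= l ^+ 2.
  have h1 : 0 <= l - (x - m) by move: sx xs; rewrite /s; case: ifP => _; lra.
  have h2 : 0 <= l + (x - m) by move: sx xs; rewrite /s; case: ifP => _; lra.
  have := mulr_ge0 h1 h2; nra.
have mx2 : m ^+ 2 <= x ^+ 2.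
  move: sx xs; rewrite /s; case: ifPn => [m0|]; last rewrite -ltNge => m0; nra.
have x2 : x ^+ 2 <= 2 * m ^+ 2 + 2 / a.
  rewrite -l2; move: xm2; have := sqr_ge0 (x - m - m).
  have -> : x ^+ 2 = (x - m + m) ^+ 2 by rewrite subrK.
  move: (x - m) => u; rewrite sqrrB sqrrD; lra.
apply: ler_pM; [exact: expR_ge0|by rewrite exprM exprn_ge0// sqr_ge0| |].
- rewrite ler_expR; apply: lerB; last by rewrite ler_wpM2l.
  by rewrite lerN2; apply: (le_trans (ler_wpM2l (ltW a0) xm2)); rewrite l2 divff ?gt_eqF.
- by rewrite !exprM; apply: lerXn2r; rewrite ?nnegrE ?sqr_ge0.
Qed.

(** Only the interval from [l] to [2 l] with [l = a ^ (-1/2)] is kept: there [a x ^ 2 <= 4] and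
    [x ^ 2 >= 1 / a]. *)
Lemma gauss_moment_lb0 (r : nat) (a : R) : 0 < a ->
  ((expR (- 4) * (a^-1) ^+ r / Num.sqrt a)%:E <=
   \int[mu]_x (expR (- (a * x ^+ 2)) * x ^+ (2 * r))%:E)%E.
Proof.
move=> a0; pose l : R := (Num.sqrt a)^-1.
have l0 : 0 < l by rewrite invr_gt0 sqrtr_gt0.
have l2 : l ^+ 2 = a^-1 by rewrite exprVn sqr_sqrtr// ltW.
pose c : R := expR (- 4) * (a^-1) ^+ r; rewrite -/l -/c.
have c0 : 0 <= c by rewrite mulr_ge0 ?expR_ge0// exprn_ge0// invr_ge0 ltW.
have -> : ((c * l)%:E = \int[mu]_(x in `[l, (l + l)%R]) (cst c%:E x))%E.
  rewrite integral_cst//= lebesgue_measure_itv/= lte_fin ltrDl l0.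
  by rewrite -EFinB addrAC subrr add0r.
rewrite integral_mkcond; apply: ge0_le_integral_gen => x _.
  by rewrite patchE; case: ifP => // _; rewrite lee_fin.
rewrite patchE; case: ifPn => [|_]; last first.
  by rewrite lee_fin mulr_ge0 ?expR_ge0// exprM exprn_ge0// sqr_ge0.
rewrite inE/= in_itv/= lee_fin => /andP[]; move: (x : R) => {}x sx xs.
rewrite /c.
have xl : l ^+ 2 <= x ^+ 2 by nra.
have xu : x ^+ 2 <= 4 * l ^+ 2 by nra.
apply: ler_pM; [exact: expR_ge0|by rewrite exprn_ge0// invr_ge0 ltW| |].
- rewrite ler_expR lerN2; apply: (le_trans (ler_wpM2l (ltW a0) xu)).
  by rewrite l2 mulrCA divff ?gt_eqF// mulr1.
- by rewrite exprM -l2; apply: lerXn2r; rewrite ?nnegrE ?sqr_ge0.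
Qed.

End gaussian.

(** * Inverse-gamma integrals *)

Section power_integrals.
Context (R : realType).
Notation mu := (@lebesgue_measure R).
Implicit Types (a b c x N B : R).

Lemma continuous_powR_gt0 (s x : R) : 0 < x -> {for x, continuous (fun y => y `^ s)}.
Proof.
move=> x0; apply: differentiable_continuous; apply/derivable1_diffP.
by apply: derivable_powR; rewrite in_itv/= andbT.
Qed.

Lemma cvg_powRN_pinfty (b : R) : 0 < b -> x `^ (- b) @[x --> +oo] --> 0.
Proof.
move=> b0; apply/cvgrPdist_le => e e0; near=> x.
have x1 : e `^ (- b^-1) <= x by near: x; apply: nbhs_pinfty_ge; rewrite num_real.
have h0 : 0 < e `^ (- b^-1) by rewrite powR_gt0.
have x0 : 0 < x by exact: lt_le_trans x1.
rewrite sub0r normrN ger0_norm ?powR_ge0//.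
rewrite powRN -[leRHS]invrK lef_pV2 ?posrE ?invr_gt0 ?powR_gt0//.
have -> : e^-1 = (e `^ (- b^-1)) `^ b.
  by rewrite -powRrM mulNr mulVf ?gt_eqF// powR_inv1// ltW.
by apply: ge0_ler_powR => //; rewrite ?nnegrE ltW.
Unshelve. all: by end_near. Qed.

Lemma integral_powR_tail (c s : R) : 0 < c -> 1 < s ->
  (\int[mu]_(x in `[c, +oo[) (x `^ (- s))%:E = (c `^ (1 - s) / (s - 1))%:E)%E.
Proof.
move=> c0 s1; pose F x : R := - (x `^ (1 - s) / (s - 1)).
have s0 : s - 1 != 0 by rewrite subr_eq0 gt_eqF.
have dF x : 0 < x -> is_derive x 1 F (x `^ (- s)).
  move=> x0; have h := @is_derive1_powR R (1 - s) x x0.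
  have -> : x `^ (- s) = (- (s - 1)^-1) *: ((1 - s) * x `^ (1 - s - 1)) :> R.
    by rewrite /GRing.scale/= (_ : 1 - s - 1 = - s); [field|ring].
  have -> : F = (fun x => (- (s - 1)^-1) *: (x `^ (1 - s) : R)) :> (R -> R).
    by apply/funext => y; rewrite /F /GRing.scale/= mulNr mulrC.
  exact: is_deriveZ.
rewrite (@ge0_continuous_FTC2y _ (fun x => x `^ (- s)) F c 0).
- by rewrite /F EFinN oppeK add0e.
- by move=> x _; exact: powR_ge0.
- apply: continuous_in_subspaceT => x; rewrite inE/= in_itv/= andbT => cx.
  by apply: continuous_powR_gt0; exact: lt_le_trans cx.
- rewrite (_ : 0 = - (0 / (s - 1))); last by rewrite mul0r oppr0.
  apply: cvgN; apply: cvgMl.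
  by rewrite -(opprB s 1); apply: cvg_powRN_pinfty; rewrite subr_gt0.
- by move=> x cx; have [] := dF x (lt_trans c0 cx).
- apply: cvg_at_right_filter; apply: differentiable_continuous.
  by apply/derivable1_diffP; have [] := dF c c0.
- move=> x; rewrite in_itv/= andbT => cx; rewrite derive1E.
  by have [_ ->] := dF x (lt_trans c0 cx).
Qed.

Lemma measurable_powR_fun (s : R) (D : set R) : measurable_fun D (fun x : R => x `^ s).
Proof. by apply: measurable_funTS; exact: measurable_powR. Qed.

(** For [a < 1] the integrand is unbounded near 0, so the fundamental theorem of calculus is used on
    intervals away from 0 and monotone convergence does the rest. *)
Lemma integral_powR_01 (a : R) : 0 < a ->
  (\int[mu]_(x in `]0%R, 1%R]) (x `^ (a - 1))%:E <= (a^-1)%:E)%E.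
Proof.
move=> a0; pose F x : R := x `^ a / a.
have dF x : 0 < x -> is_derive x 1 F (x `^ (a - 1)).
  move=> x0; have h := @is_derive1_powR R a x x0.
  have -> : x `^ (a - 1) = a^-1 *: (a * x `^ (a - 1)) :> R.
    by rewrite /GRing.scale/= mulrA mulVf ?mul1r// gt_eqF.
  have -> : F = (fun x => a^-1 *: (x `^ a : R)) :> (R -> R).
    by apply/funext => y; rewrite /F /GRing.scale/= mulrC.
  exact: is_deriveZ.
(* The shift by 2 keeps the left endpoint strictly below 1. *)
pose G (i : nat) : set R := `[i.+2%:R^-1, 1%R]%classic.
have GE : `]0%R, 1%R]%classic = \bigcup_i G i.
  apply/seteqP; split => [x/=|x [i _]]; rewrite /G/= !in_itv/= => /andP[x0 x1].
    have [i hi] : exists i, i.+2%:R^-1 <= x.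
      exists (Num.truncn x^-1); rewrite -[leRHS]invrK lef_pV2 ?posrE ?invr_gt0//.
      apply: ltW; apply: (lt_le_trans (truncnS_gt _)); by rewrite ler_nat.
    by exists i => //=; rewrite in_itv/= hi.
  by rewrite x1 andbT (lt_le_trans _ x0)// invr_gt0 ltr0n.
rewrite GE.
have h : (\int[mu]_(x in G i) (x `^ (a - 1))%:E @[i --> \oo] -->
    \int[mu]_(x in \bigcup_i G i) (x `^ (a - 1))%:E)%E.
  apply: ge0_nondecreasing_set_cvg_integral => //.
  - apply/nondecreasing_seqP => i; rewrite subsetEset /G => x/=.
    rewrite !in_itv/= => /andP[h ->]; rewrite andbT; apply: le_trans h.
    by rewrite lef_pV2 ?posrE ?ltr0n// ler_nat.
  - by move=> i; exact: measurable_itv.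
  - by move=> i; apply: measurableT_comp => //; exact: measurable_powR_fun.
  - by move=> i x _; rewrite lee_fin powR_ge0.
rewrite -(cvg_lim _ h)//; apply: lime_le; first by apply/cvg_ex; eexists; exact: h.
apply: nearW => i; rewrite /G.
have i0 : (0 : R) < i.+2%:R^-1 by rewrite invr_gt0 ltr0n.
have i1 : i.+2%:R^-1 < 1 :> R by rewrite invf_lt1 ?ltr0n// ltr1n.
rewrite (@continuous_FTC2 _ (fun x => x `^ (a - 1)) F)//.
- by rewrite -EFinB lee_fin /F powR1 mul1r lerBlDr lerDl divr_ge0 ?powR_ge0// ltW.
- apply: continuous_in_subspaceT => x; rewrite inE/= in_itv/= => /andP[cx _].
  by apply: continuous_powR_gt0; exact: lt_le_trans cx.
- split.
  + by move=> x; rewrite in_itv/= => /andP[cx _]; have [] := dF x (lt_trans i0 cx).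
  + apply: cvg_at_right_filter; apply: differentiable_continuous.
    by apply/derivable1_diffP; have [] := dF _ i0.
  + apply: cvg_at_left_filter; apply: differentiable_continuous.
    by apply/derivable1_diffP; have [] := dF 1 ltr01.
- move=> x; rewrite in_itv/= => /andP[cx _]; rewrite derive1E.
  by have [_ ->] := dF x (lt_trans i0 cx).
Qed.

Lemma integral_0oo_lty (f : R -> R) (a s A B : R) :
  measurable_fun setT f -> (forall x, 0 < x -> 0 <= f x) ->
  0 < a -> 1 < s -> 0 <= A -> 0 <= B ->
  (forall x, 0 < x <= 1 -> f x <= A * x `^ (a - 1)) ->
  (forall x, 1 <= x -> f x <= B * x `^ (- s)) ->
  (\int[mu]_(x in `]0%R, +oo[) (f x)%:E < +oo)%E.
Proof.
move=> mf f0 a0 s1 A0 B0 hA hB.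
have -> : `]0%R, +oo[%classic = `]0%R, 1%R] `|` `]1%R, +oo[ :> set R.
  apply/seteqP; split => x /=; rewrite !in_itv/= ?andbT.
    by move=> x0; case: (leP x 1) => _; [left; rewrite x0|right].
  by case=> [/andP[]//|/(lt_trans ltr01)].
rewrite ge0_integral_setU//=; last 3 first.
- by apply/measurable_EFinP; exact: measurable_funTS.
- move=> x; rewrite !in_itv/= andbT lee_fin => -[/andP[/f0]//|/(lt_trans ltr01)]; exact: f0.
- apply/disj_setPS => x /= []; rewrite !in_itv/= andbT => /andP[_ x1] /(le_lt_trans x1).
  by rewrite ltxx.
apply: lte_add_pinfty.
- apply: (@le_lt_trans _ _ (A * a^-1)%:E); last exact: ltry.
  apply: (@integral_le_cst _ _ R mu _ _ (fun x : R => (x `^ (a - 1))%:E)) => //.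
  + by apply: measurableT_comp => //; exact: measurable_powR_fun.
  + by move=> x _; rewrite lee_fin powR_ge0.
  + by move=> x; rewrite /= in_itv/= => /andP[x0 _]; rewrite lee_fin f0.
  + exact: integral_powR_01.
- apply: (@le_lt_trans _ _ (B * (1 `^ (1 - s) / (s - 1)))%:E); last exact: ltry.
  apply: (@integral_le_cst _ _ R mu _ _ (fun x : R => (x `^ (- s))%:E)) => //.
  + by apply: measurableT_comp => //; exact: measurable_powR_fun.
  + by move=> x _; rewrite lee_fin powR_ge0.
  + move=> x; rewrite /= in_itv/= andbT => x0; rewrite lee_fin f0//.
    exact: lt_trans x0.
  + by move=> x; rewrite /= in_itv/= andbT => x0; rewrite -EFinM lee_fin hB// ltW.
  + rewrite -(integral_powR_tail ltr01 s1); apply: ge0_subset_integral => //=.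
    by apply: measurableT_comp => //; exact: measurable_powR_fun.
    by move=> x _; rewrite lee_fin powR_ge0.
    by move=> x; rewrite /= !in_itv/= !andbT => /ltW.
Qed.

Lemma integral_0oo_gt0 (f : R -> R) (c : R) : 0 < c ->
  (forall x, 0 < x -> 0 <= f x) ->
  (forall x, 1 <= x <= 2 -> c <= f x) ->
  (c%:E <= \int[mu]_(x in `]0%R, +oo[) (f x)%:E)%E.
Proof.
move=> c0 f0 fc.
have -> : (c%:E = \int[mu]_(x in `[1%R, 2%R]) (cst c%:E x))%E.
  rewrite integral_cst//= lebesgue_measure_itv/= lte_fin ltr1n -EFinB.
  by rewrite (_ : 2 - 1 = 1) ?mule1//; ring.
rewrite integral_mkcond [leRHS]integral_mkcond; apply: ge0_le_integral_gen => x _.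
  by rewrite patchE; case: ifP => // _; rewrite lee_fin ltW.
rewrite !patchE; case: ifPn => [|_].
  rewrite inE/= in_itv/= => /andP[x1 x2]; rewrite ifT; last first.
    by rewrite inE/= in_itv/= andbT (lt_le_trans ltr01).
  by rewrite lee_fin fc// x1.
by case: ifPn => //; rewrite inE/= in_itv/= andbT => x0; rewrite lee_fin f0.
Qed.

End power_integrals.

Section inverse_gamma_integral.
Context (R : realType).
Notation mu := (@lebesgue_measure R).
Implicit Types (a b c x N B : R).

Let pushf (phi : measurableTypeR R -> measurableTypeR R)
    (mphi : measurable_fun setT phi) : {measure set (measurableTypeR R) -> \bar R} :=
  measure_function_pushforward__canonical__measure_function_Measure mu mphi.

(** By uniqueness of Lebesgue measure it is enough to compare the two sides on half-open
    intervals. *)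
Lemma lebesgue_measure_scale (B : R) (A : set R) : 0 < B -> measurable A ->
  (mu A = B%:E * mu ((fun x : R => (B * x)%R) @^-1` A))%E.
Proof.
move=> B0; pose phi (x : measurableTypeR R) : measurableTypeR R := B * x.
have mphi : measurable_fun setT phi by exact: mulrl_measurable.
pose nu := mscale (NngNum (ltW B0)) (pushf mphi).
move=> mA; rewrite (@lebesgue_measure_unique R nu)// => X /ocitvP[->|[[x y]/= xy ->]].
  by rewrite !measure0.
rewrite /nu /mscale/= /pushforward/=.
have -> : phi @^-1` `]x, y]%classic = `]x / B, y / B]%classic.
  apply/seteqP; split => z/=; rewrite /phi !in_itv/=;
  by rewrite ltr_pdivrMr// ler_pdivlMr// mulrC.
rewrite !lebesgue_measure_itv/= !lte_fin ltr_pM2r ?invr_gt0//; case: ifP => _.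
  rewrite -!EFinB -EFinM; congr EFin; field; by rewrite gt_eqF.
by rewrite mule0.
Qed.

Lemma ge0_integral_scale (B : R) (f : R -> \bar R) : 0 < B ->
  measurable_fun setT f -> (forall x, 0 <= f x)%E ->
  (\int[mu]_(x in `]0%R, +oo[) f x =
   B%:E * \int[mu]_(x in `]0%R, +oo[) f (B * x)%R)%E.
Proof.
move=> B0 mf f0.
pose phi (x : measurableTypeR R) : measurableTypeR R := B * x.
have mphi : measurable_fun setT phi by exact: mulrl_measurable.
pose nu := mscale (NngNum (ltW B0)) (pushf mphi).
transitivity (\int[nu]_(x in `]0%R, +oo[) f x)%E.
  apply: eq_measure_integral => A mA _.
  exact: lebesgue_measure_scale.
rewrite ge0_integral_mscale//; last exact: measurable_funTS.
congr (_ * _)%E.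
rewrite (ge0_integral_pushforward mphi)//; last exact: measurable_funTS.
congr (integral _ _ _); apply/seteqP; split => x/=; rewrite !in_itv/= !andbT.
  by rewrite /phi pmulr_rgt0.
by rewrite /phi => x0; rewrite mulr_gt0.
Qed.

(** The inverse-gamma density with shape [N] and scale [B], without its normalizing constant. *)
Definition igamma_fun (N B x : R) : R := x `^ (- (N + 1)) * expR (- B / x).

Lemma igamma_fun_ge0 N B x : 0 <= igamma_fun N B x.
Proof. by rewrite mulr_ge0 ?powR_ge0 ?expR_ge0. Qed.

Lemma measurable_igamma_fun N B : measurable_fun setT (igamma_fun N B).
Proof.
apply: measurable_funM; first exact: measurable_powR_fun.
apply: measurableT_comp => //; apply: measurable_funM => //.
exact: measurable_funV.
Qed.

Definition igamma (N B : R) : \bar R :=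
  (\int[mu]_(x in `]0%R, +oo[) (igamma_fun N B x)%:E)%E.

Lemma igamma_ge0 N B : (0 <= igamma N B)%E.
Proof. by apply: integral_ge0 => x _; rewrite lee_fin igamma_fun_ge0. Qed.

Lemma igamma_scale N B : 0 < B -> (igamma N B = (B `^ (- N))%:E * igamma N 1)%E.
Proof.
move=> B0; rewrite /igamma (ge0_integral_scale B0); last 2 first.
- by apply/measurable_EFinP; exact: measurable_igamma_fun.
- by move=> x; rewrite lee_fin igamma_fun_ge0.
have -> : (\int[mu]_(x in `]0%R, +oo[) (igamma_fun N B (B * x))%:E =
   \int[mu]_(x in `]0%R, +oo[) ((B `^ (- (N + 1)))%:E * (igamma_fun N 1 x)%:E))%E.
  apply: eq_integral => x; rewrite inE/= in_itv/= andbT => x0.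
  rewrite -EFinM; congr EFin; rewrite /igamma_fun powRM ?ltW// -mulrA; congr (_ * (_ * expR _)).
  by field; rewrite !gt_eqF.
rewrite ge0_integralZl_EFin//; last 3 first.
- by move=> x _; rewrite lee_fin igamma_fun_ge0.
- by apply: measurable_funTS; apply/measurable_EFinP; exact: measurable_igamma_fun.
- exact: powR_ge0.
rewrite muleA -EFinM; congr (_%:E * _)%E.
rewrite opprD powRD; last by apply/implyP => _; exact: lt0r_neq0.
by rewrite powR_inv1 ?ltW// mulrCA divff ?mulr1// gt_eqF.
Qed.

Lemma igamma1_lty N : 0 < N -> (igamma N 1 < +oo)%E.
Proof.
(* An integer above [N + 1], so that [expr_le_expR] at [1 / x] controls the power of [x] near 0. *)
move=> N0; pose r := (Num.truncn (N + 1)).+1.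
apply: (@integral_0oo_lty R (igamma_fun N 1) 1 (N + 1) ((2 * r%:R) ^+ r) 1) => //.
- exact: measurable_igamma_fun.
- by move=> x _; exact: igamma_fun_ge0.
- by rewrite ltrDr.
- move=> x /andP[x0 x1]; rewrite subrr powRr0 mulr1 /igamma_fun mulN1r.
  have y1 : 1 <= x^-1 by rewrite invf_ge1.
  have -> : x `^ (- (N + 1)) = x^-1 `^ (N + 1).
    by rewrite -powR_inv1 ?ltW// -powRrM mulN1r.
  apply: (@le_trans _ _ (x^-1 ^+ r * expR (- x^-1))).
    rewrite ler_wpM2r ?expR_ge0// -powR_mulrn ?invr_ge0 ?(ltW x0)//.
    by apply: ler_powR => //; apply: ltW; exact: truncnS_gt.
  have h := @expr_le_expR R r x^-1.
  apply: (@le_trans _ _ ((2 * r%:R) ^+ r * expR (x^-1 / 2) * expR (- x^-1))).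
    by rewrite ler_wpM2r ?expR_ge0// h// invr_ge0 ltW.
  rewrite -mulrA -expRD ler_piMr ?exprn_ge0// ?mulr_ge0//.
  rewrite -[leRHS]expR0 ler_expR; lra.
- move=> x x1; rewrite mul1r /igamma_fun ler_piMr ?powR_ge0//.
  by rewrite -[leRHS]expR0 ler_expR mulN1r oppr_le0 invr_ge0 (le_trans ler01).
Qed.

(** For [N > 0] this is the Gamma function at [N], after the substitution of [1 / x] for [x]. *)
Definition igamma1 N : R := fine (igamma N 1).

Lemma igamma1K N : 0 < N -> igamma N 1 = (igamma1 N)%:E.
Proof. by move=> N0; rewrite fineK// ge0_fin_numE ?igamma_ge0// igamma1_lty. Qed.

Lemma igammaE N B : 0 < N -> 0 < B -> igamma N B = (B `^ (- N) * igamma1 N)%:E.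
Proof. by move=> N0 B0; rewrite igamma_scale// igamma1K. Qed.

Lemma igamma1_gt0 N : 0 < N -> 0 < igamma1 N.
Proof.
move=> N0; apply: (@lt_le_trans _ _ (2 `^ (- (N + 1)) * expR (- 1))).
  by rewrite mulr_gt0 ?powR_gt0 ?expR_gt0.
rewrite -lee_fin -igamma1K//; apply: integral_0oo_gt0.
- by rewrite mulr_gt0 ?powR_gt0 ?expR_gt0.
- by move=> x _; exact: igamma_fun_ge0.
- move=> x /andP[x1 x2]; have x0 : 0 < x by exact: lt_le_trans x1.
  apply: ler_pM; rewrite ?powR_ge0 ?expR_ge0//.
    rewrite !powRN lef_pV2 ?posrE ?powR_gt0//.
    by apply: ge0_ler_powR; rewrite ?nnegrE ?(ltW x0)// addr_ge0// ltW.
  by rewrite ler_expR mulN1r lerN2 invf_le1.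
Qed.

(* Integrate e^(-1/x) (1 - h/x) <= e^(-(1+h)/x) with h = 1/N against x^(-N-1). *)
Lemma igamma1_succ N : 1 <= N -> N / 3 * igamma1 N <= igamma1 (N + 1).
Proof.
move=> N1; have N0 : 0 < N by exact: lt_le_trans N1.
have h0 : 0 < 1 + N^-1 by rewrite addr_gt0// invr_gt0.
have N10 : 0 < N + 1 by rewrite addr_gt0.
have : igamma1 N <= (1 + N^-1) `^ (- N) * igamma1 N + N^-1 * igamma1 (N + 1).
  rewrite -lee_fin EFinD -igammaE// EFinM -!igamma1K// /igamma.
  rewrite -ge0_integralZl_EFin//; last 3 first.
  - by move=> x _; rewrite lee_fin igamma_fun_ge0.
  - by apply: measurable_funTS; apply/measurable_EFinP; exact: measurable_igamma_fun.
  - by rewrite invr_ge0 ltW.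
  rewrite -ge0_integralD//; last 4 first.
  - by move=> x _; rewrite lee_fin igamma_fun_ge0.
  - by apply: measurable_funTS; apply/measurable_EFinP; exact: measurable_igamma_fun.
  - by move=> x _; rewrite mule_ge0// lee_fin ?invr_ge0 ?(ltW N0)// igamma_fun_ge0.
  - apply: measurable_funTS; apply/measurable_EFinP/measurable_funM => //.
    exact: measurable_igamma_fun.
  apply: ge0_le_integral_gen => x; rewrite /= in_itv/= andbT => x0.
    by rewrite lee_fin igamma_fun_ge0.
  rewrite -EFinM -EFinD lee_fin /igamma_fun.
  have -> : x `^ (- (N + 1 + 1)) = x `^ (- (N + 1)) * x^-1.
    rewrite [X in _ `^ X]opprD powRD ?powR_inv1 ?ltW//.
    by apply/implyP => _; exact: lt0r_neq0.
  have -> : - (1 + N^-1) / x = - 1 / x + - (N^-1 / x) by rewrite -mulNr -mulrDl opprD.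
  rewrite expRD.
  have h1 : 1 - N^-1 / x <= expR (- (N^-1 / x)) by exact: expR_ge1Dx.
  move: (expR (- 1 / x)) (expR_ge0 (- 1 / x)) (x `^ (- (N + 1))) (powR_ge0 x (- (N + 1))) => e e0 y y0.
  have := ler_wpM2l (mulr_ge0 y0 e0) h1; lra.
(* [ln (1 + 1 / N) >= 1 / (N + 1)] and [N / (N + 1) >= 1 / 2] give
   [(1 + 1 / N) ^ N >= exp (1 / 2) >= 3 / 2]. The remaining third of [igamma1 N] is the source of
   the 3 in the conclusion. *)
have h2 : (1 + N^-1) `^ (- N) <= 2 / 3.
  have : expR (1 / 2) <= (1 + N^-1) `^ N.
    rewrite /powR gt_eqF// ler_expR.
    have : ln (1 + N^-1)^-1 <= - (N + 1)^-1.
      have -> : (1 + N^-1)^-1 = 1 + (- (N + 1)^-1).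
        by field; rewrite !gt_eqF.
      by apply: le_ln1Dx; rewrite ltrNl opprK invf_lt1// ltrDr.
    rewrite lnV ?posrE// lerN2 => h.
    apply: (le_trans _ (ler_wpM2l (ltW N0) h)).
    by rewrite ler_pdivlMr// mul1r ler_pdivrMl//; lra.
  have e1 : 1 + 1 / 2 <= expR (1 / 2) :> R by exact: expR_ge1Dx.
  move=> /(le_trans e1) e2; rewrite powRN.
  have -> : 2 / 3 = (1 + 1 / 2)^-1 :> R by field.
  by rewrite lef_pV2 ?posrE ?powR_gt0.
have g0 := igamma1_gt0 N0.
move=> h3; have h4 := ler_wpM2r (ltW g0) h2.
have h5 : igamma1 N / 3 <= N^-1 * igamma1 (N + 1) by lra.
by move: h5; rewrite ler_pdivlMl// mulrA mulrAC.
Qed.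

Lemma igamma1_addn N (a : nat) : 1 <= N -> (N / 3) ^+ a * igamma1 N <= igamma1 (N + a%:R).
Proof.
move=> N1; elim: a => [|a IH]; first by rewrite expr0 mul1r addr0.
have -> : N + a.+1%:R = N + a%:R + 1 by rewrite -addrA natr1.
rewrite exprS -mulrA.
have N0 : 0 < N by exact: lt_le_trans N1.
apply: le_trans (igamma1_succ _); last by rewrite (le_trans N1)// lerDl.
apply: ler_pM => //; first by rewrite divr_ge0// ltW.
- by rewrite mulr_ge0 ?exprn_ge0 ?divr_ge0 ?ltW// igamma1_gt0.
- by rewrite ler_pM2r ?invr_gt0// lerDl.
Qed.

(** Half of the exponent bounds [x ^ (- a) * exp (- 1 / (2 x))] by its maximum [(2 a / e) ^ a]; the
    other half leaves [igamma (1 / 2) (1 / 2)], which is [sqrt 2] times [igamma1 (1 / 2)]. It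
    controls the integral over [tau], where [a] is a multiple of the model size. *)
Lemma igamma1_half a : 0 <= a ->
  igamma1 (a + 1 / 2) <= (2 * a) `^ a * (Num.sqrt 2 * igamma1 (1 / 2)).
Proof.
move=> a0; have h0 : 0 < 1 / 2 :> R by rewrite divr_gt0.
have ah0 : 0 < a + 1 / 2 by rewrite ltr_wpDl.
have -> : Num.sqrt 2 = (1 / 2) `^ (- (1 / 2)) :> R.
  have -> : (1 / 2) `^ (- (1 / 2)) = ((1 / 2) `^ (-1)) `^ 2^-1 :> R.
    by rewrite -powRrM; congr (_ `^ _); field.
  by rewrite powR_inv1 ?divr_ge0// div1r invrK powR12_sqrt.
rewrite -lee_fin -igamma1K//; apply: (@integral_le_cst _ _ R mu _ _
   (fun x : R => (igamma_fun (1 / 2) (1 / 2) x)%:E)) => //.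
- exact: powR_ge0.
- by apply: measurable_funTS; apply/measurable_EFinP; exact: measurable_igamma_fun.
- by move=> x _; rewrite lee_fin igamma_fun_ge0.
- by move=> x _; rewrite lee_fin igamma_fun_ge0.
- move=> x; rewrite /= in_itv/= andbT => x0; rewrite -EFinM lee_fin /igamma_fun.
  have -> : x `^ (- (a + 1 / 2 + 1)) = x `^ (- (1 / 2 + 1)) * x `^ (- a).
    rewrite -powRD; first by congr (_ `^ _); ring.
    by apply/implyP => _; exact: lt0r_neq0.
  have -> : - 1 / x = - (1 / 2) / x + - (1 / 2) / x by field; rewrite gt_eqF.
  rewrite expRD mulrACA [leRHS]mulrC ler_wpM2l ?mulr_ge0 ?powR_ge0 ?expR_ge0//.
  have [->|a1] := eqVneq a 0.
    rewrite oppr0 !powRr0 [leLHS]mul1r -[leRHS]expR0 ler_expR mulNr oppr_le0 divr_ge0//.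
    exact: ltW.
  have {}a0 : 0 < a by rewrite lt0r a1.
  have a2 : 0 < 2 * a by rewrite mulr_gt0.
  rewrite /powR !gt_eqF// -expRD ler_expR.
  have y0 : 0 < (2 * a * x)^-1 by rewrite invr_gt0 mulr_gt0.
  have h : - (ln (2 * a) + ln x) <= (2 * a * x)^-1 - 1.
    rewrite -lnM ?posrE// -lnV ?posrE ?mulr_gt0//.
    rewrite -{1}[(2 * a * x)^-1](addrNK 1) addrC.
    by apply: le_ln1Dx; rewrite ltrBrDr addNr.
  have := ler_wpM2l (ltW a0) h.
  have -> : a * ((2 * a * x)^-1 - 1) = 1 / 2 / x - a by field; rewrite !gt_eqF.
  by rewrite mulNr; lra.
- by rewrite -igammaE.
Qed.

End inverse_gamma_integral.

(** The real-valued integral sends infinity to 0, so positivity requires finiteness besides a lower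
    bound. *)
Lemma Gamma_gt0 (R : realType) (a : R) : 0 < a -> 0 < Gamma a.
Proof.
move=> a0; rewrite /Gamma /Rintegral.
set f := fun x : R => x `^ (a - 1) * expR (- x).
have f0 x : 0 <= f x by rewrite mulr_ge0 ?powR_ge0 ?expR_ge0.
have mf : measurable_fun setT f.
  apply: measurable_funM; first exact: measurable_powR_fun.
  by apply: measurableT_comp => //; exact: measurableT_comp.
set I := (X in fine X).
have hpos : ((2 `^ (- `|a - 1|) * expR (- 2))%:E <= I)%E.
  apply: integral_0oo_gt0 => [|x _|x /andP[x1 x2]]; first by rewrite mulr_gt0 ?powR_gt0 ?expR_gt0.
    exact: f0.
  apply: ler_pM; rewrite ?powR_ge0 ?expR_ge0//; last by rewrite ler_expR lerN2.
  have x0 : 0 < x by exact: lt_le_trans x1.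
  apply: (@le_trans _ _ (x `^ (- `|a - 1|))).
    rewrite !powRN lef_pV2 ?posrE ?powR_gt0//.
    by apply: ge0_ler_powR; rewrite ?nnegrE ?(ltW x0).
  by apply: ler_powR => //; rewrite lerNl -normrN ler_norm.
have hfin : (I < +oo)%E.
  pose r := (Num.truncn (a + 1)).+1.
  apply: (@integral_0oo_lty R f a 2 1 ((2 * r%:R) ^+ r)) => //.
  - by rewrite ltr1n.
  - move=> x /andP[x0 x1]; rewrite mul1r /f ler_piMr ?powR_ge0//.
    by rewrite -expR0 ler_expR oppr_le0 ltW.
  - move=> x x1; have x0 : 0 < x by exact: lt_le_trans x1.
    have -> : f x = x `^ (a + 1) * expR (- x) * x `^ (- 2).
      rewrite /f [in RHS]mulrAC -powRD; last by apply/implyP => _; exact: lt0r_neq0.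
      by congr (_ `^ _ * _); ring.
    rewrite ler_wpM2r ?powR_ge0//.
    apply: (@le_trans _ _ (x ^+ r * expR (- x))).
      rewrite ler_wpM2r ?expR_ge0// -powR_mulrn ?(ltW x0)//.
      by apply: ler_powR => //; apply: ltW; exact: truncnS_gt.
    have h := @expr_le_expR R r x (ltW x0).
    apply: (@le_trans _ _ ((2 * r%:R) ^+ r * expR (x / 2) * expR (- x))).
      by rewrite ler_wpM2r ?expR_ge0.
    rewrite -mulrA -expRD ler_piMr ?exprn_ge0// ?mulr_ge0//.
    rewrite -[leRHS]expR0 ler_expR; lra.
apply: fine_gt0; rewrite hfin andbT; apply: lt_le_trans hpos.
by rewrite lte_fin mulr_gt0 ?powR_gt0 ?expR_gt0.
Qed.

(** * Quadratic forms and least squares *)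

Section spectral.
Context (R : realType).

Lemma char_poly_conj (F : fieldType) m (P D : 'M[F]_m) : P \in unitmx ->
  char_poly (invmx P *m D *m P) = char_poly D.
Proof.
move=> uP; rewrite /char_poly.
have -> : char_poly_mx (invmx P *m D *m P) =
    map_mx polyC (invmx P) *m char_poly_mx D *m map_mx polyC P.
  rewrite /char_poly_mx mulmxBr mulmxBl -!map_mxM; congr (_ - _).
  by rewrite scalar_mxC -mulmxA -map_mxM mulVmx// map_mx1 mulmx1.
rewrite !det_mulmx mulrAC mulrC -det_mulmx -map_mxM mulVmx// map_mx1 det1.
by rewrite mulr1.
Qed.

(** The matrix is diagonalized by a unitary matrix as a complex Hermitian one. The weights [w i] are
    squared moduli of the coordinates of [x] in that eigenbasis: the coordinates may be complex, the
    weights are real. *)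
Lemma symmetric_spectral m (A : 'M[R]_m) : A^T = A ->
  exists d : 'I_m -> R, char_poly A = \prod_(i < m) ('X - (d i)%:P) /\
    forall x : 'cV[R]_m, exists w : 'I_m -> R,
      [/\ forall i, 0 <= w i, \sum_i w i = \sum_i (x i 0) ^+ 2 &
          (x^T *m A *m x) 0 0 = \sum_i d i * w i].
Proof.
move=> symA; pose toC : {rmorphism R -> R[i]} := real_complex R.
pose AC := map_mx toC A.
have realAC : AC \is a mxOver Num.real.
  by apply/mxOverP => i j; rewrite mxE; apply/complex_realP; eexists.
have hermAC : AC \is hermsymmx.
  apply: realsym_hermsym => //; apply/is_hermitianmxP.
  by rewrite expr0 scale1r; apply/matrixP => i j; rewrite !mxE -[in LHS]symA mxE.
have /orthomx_spectralP := hermitian_normalmx hermAC.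
set P := spectralmx AC; set sp := spectral_diag AC => ACE.
have uP : P \is unitarymx by exact: spectral_unitarymx.
have iP : P \in unitmx by exact: spectral_unit.
have spr : sp \is a mxOver Num.real by exact: hermitian_spectral_diag_real.
pose d i := complex.Re (sp 0 i).
have dE i : sp 0 i = toC (d i).
  by have /mxOverP /(_ 0 i) := spr => /RRe_real <-.
exists d; split.
  apply: (map_poly_inj toC).
  rewrite map_char_poly -/AC ACE char_poly_conj// char_poly_trig; last first.
    exact: diag_mx_is_trig.
  rewrite rmorph_prod; apply: eq_bigr => i _.
  by rewrite mxE eqxx mulr1n dE rmorphB/= map_polyX map_polyC.
move=> x; pose xC := map_mx toC x; pose z := P *m xC.
pose w i := complex.Re (z i 0 * (z i 0)^*%C).
have wE i : z i 0 * (z i 0)^*%C = toC (w i).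
  have /RRe_real : z i 0 * (z i 0)^*%C \is Num.real by rewrite ger0_real// mulcJ_ge0.
  exact: esym.
have zz : (map_mx Num.conj z)^T = xC^T *m invmx P.
  rewrite invmx_unitary// /z map_mxM trmx_mul -map_trmx; congr (_ *m _).
  by congr (_^T); apply/matrixP => i j; rewrite !mxE; exact: conjc_real.
exists w; split.
- by move=> i; rewrite -ler0c -/(toC (w i)) -wE mulcJ_ge0.
- apply: (@complexI R); rewrite -!/(toC _) !rmorph_sum/=.
  have : (xC^T *m xC) 0 0 = ((map_mx Num.conj z)^T *m z) 0 0.
    by rewrite zz /z mulmxA mulmxKV.
  rewrite !mxE => h; transitivity (\sum_j (map_mx Num.conj z)^T 0 j * z j 0).
    by apply: eq_bigr => i _; rewrite -wE !mxE mulrC.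
  by rewrite -h; apply: eq_bigr => i _; rewrite !mxE rmorphXn expr2.
- apply: (@complexI R); rewrite -!/(toC _) !rmorph_sum/=.
  have -> : toC ((x^T *m A *m x) 0 0) = (xC^T *m AC *m xC) 0 0.
    by rewrite /xC /AC map_trmx -!map_mxM [in RHS]mxE.
  rewrite ACE -!mulmxA (mulmxA xC^T) -zz -/z mxE.
  apply: eq_bigr => i _; rewrite rmorphM -wE -dE mul_diag_mx !mxE.
  by rewrite mulrCA; congr (_ * _); rewrite mulrC.
Qed.

End spectral.

Section quadratic_forms.
Context (R : realType).

Definition sqn n (u : 'cV[R]_n) : R := \sum_i (u i 0) ^+ 2.

Lemma sqn_ge0 n (u : 'cV[R]_n) : 0 <= sqn u.
Proof. by apply: sumr_ge0 => i _; exact: sqr_ge0. Qed.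

Lemma sqn_eq0 n (u : 'cV[R]_n) : (sqn u == 0) = (u == 0).
Proof.
apply/idP/eqP => [|->]; last by rewrite /sqn big1// => i _; rewrite mxE expr0n.
rewrite psumr_eq0 => [/allP u0|i _]; last exact: sqr_ge0.
apply/colP => i; rewrite mxE.
by have := u0 i (mem_index_enum i); rewrite sqrf_eq0 => /eqP.
Qed.

Lemma sqn_gt0 n (u : 'cV[R]_n) : (0 < sqn u) = (u != 0).
Proof. by rewrite lt0r sqn_eq0 sqn_ge0 andbT. Qed.

Lemma sqn_coord n (u : 'cV[R]_n) i : (u i 0) ^+ 2 <= sqn u.
Proof.
by rewrite /sqn (bigD1 i)//= lerDl; apply: sumr_ge0 => j _; exact: sqr_ge0.
Qed.

Lemma sqnE n (u : 'cV[R]_n) : sqn u = (u^T *m u) 0 0.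
Proof. by rewrite mxE; apply: eq_bigr => i _; rewrite mxE expr2. Qed.

Lemma sqnN n (u : 'cV[R]_n) : sqn (- u) = sqn u.
Proof. by apply: eq_bigr => i _; rewrite mxE sqrrN. Qed.

Lemma sqnB_dot n (u v : 'cV[R]_n) :
  sqn (u - v) = sqn u - 2 * (v^T *m u) 0 0 + sqn v.
Proof.
rewrite /sqn mxE mulr_sumr -sumrB -big_split/=.
by apply: eq_bigr => i _; rewrite !mxE; ring.
Qed.

Lemma sqnD_le n (u v : 'cV[R]_n) : sqn (u + v) <= 2 * sqn u + 2 * sqn v.
Proof.
rewrite /sqn !mulr_sumr -big_split/=; apply: ler_sum => i _; rewrite mxE.
by have := sqr_ge0 (u i 0 - v i 0); rewrite sqrrB sqrrD; lra.
Qed.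

Lemma eigenvalue_quadratic m (A : 'M[R]_m) (a : R) : A^T = A -> eigenvalue A a ->
  exists2 x : 'cV[R]_m, x != 0 & (x^T *m A *m x) 0 0 = a * sqn x.
Proof.
move=> sA /eigenvalueP[v vA v0]; exists v^T.
  by rewrite -(inj_eq trmx_inj) trmxK trmx0.
by rewrite trmxK vA -scalemxAl mxE sqnE trmxK.
Qed.

Lemma symmetric_quadratic_bounds m (A : 'M[R]_m) (lo hi : R) : A^T = A ->
  (forall a, eigenvalue A a -> lo <= a <= hi) ->
  forall x : 'cV[R]_m, lo * sqn x <= (x^T *m A *m x) 0 0 <= hi * sqn x.
Proof.
move=> sA hA x; have [d [cA /(_ x)[w [w0 sw ->]]]] := symmetric_spectral sA.
have hd i : lo <= d i <= hi.
  apply: hA; rewrite eigenvalue_root_char cA /root horner_prod.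
  by apply/eqP; rewrite (bigD1 i)//= hornerXsubC subrr mul0r.
rewrite /sqn -sw !mulr_sumr; apply/andP; split; apply: ler_sum => i _;
by rewrite ler_wpM2r//; have /andP[] := hd i.
Qed.

Lemma posdef_det_gt0 m (A : 'M[R]_m) (lo : R) : A^T = A -> 0 < lo ->
  (forall x : 'cV[R]_m, lo * sqn x <= (x^T *m A *m x) 0 0) -> 0 < \det A.
Proof.
move=> sA lo0 hA; have [d [cA _]] := symmetric_spectral sA.
have hd i : 0 < d i.
  have /(eigenvalue_quadratic sA)[x x0 xA] : eigenvalue A (d i).
    rewrite eigenvalue_root_char cA /root horner_prod.
    by apply/eqP; rewrite (bigD1 i)//= hornerXsubC subrr mul0r.
  have := hA x; rewrite xA ler_pM2r ?sqn_gt0//; exact: lt_le_trans.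
have := char_poly_det A; rewrite -horner_coef0 cA horner_prod.
have -> : \prod_(i < m) ('X - (d i)%:P).[0] = (-1) ^+ m * \prod_(i < m) d i.
  rewrite -[m in (-1) ^+ m]card_ord -prodr_const -big_split/=.
  by apply: eq_bigr => i _; rewrite hornerXsubC sub0r mulN1r.
move=> /(mulfI _) <-; first exact: prodr_gt0.
by rewrite expf_neq0// oppr_eq0 oner_eq0.
Qed.

Lemma bigmin_le_mem (s : seq nat) (F : nat -> R) x j : j \in s ->
  \big[Num.min/x]_(i <- s) F i <= F j.
Proof.
elim: s => //= i s IH; rewrite inE big_cons => /predU1P[->|/IH h].
  by rewrite ge_min lexx.
by rewrite ge_min h orbT.
Qed.

Lemma bigmax_ge_mem (s : seq nat) (F : nat -> R) x j : j \in s ->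
  F j <= \big[Num.max/x]_(i <- s) F i.
Proof.
elim: s => //= i s IH; rewrite inE big_cons => /predU1P[->|/IH h].
  by rewrite le_max lexx.
by rewrite le_max h orbT.
Qed.

Lemma gram_sym n p (X : 'M[R]_(n, p)) k : (gram X k)^T = gram X k.
Proof. by rewrite /gram linearZ/= trmx_mul trmxK. Qed.

Lemma gram_quadratic n p (X : 'M[R]_(n, p)) k b :
  (b^T *m gram X k *m b) 0 0 = n%:R^-1 * sqn (submodel_mx X k *m b).
Proof.
by rewrite /gram -scalemxAr -scalemxAl mxE sqnE trmx_mul !mulmxA.
Qed.

(** [nu] sees nonzero eigenvalues only and defaults to 0 beyond them. As [#|k| <= n], the positive
    bound [lo] reaches the index [#|k|], so that no eigenvalue vanishes and the bounds hold for the
    whole spectrum. *)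
Lemma gram_bounds n p (X : 'M[R]_(n, p)) (k : {set 'I_p}) (lo hi : R) :
  (0 < n)%N -> (#|k| <= n)%N -> 0 < lo -> lo <= lambda_min X k -> lambda_max X k <= hi ->
  forall b, n%:R * lo * sqn b <= sqn (submodel_mx X k *m b) <= n%:R * hi * sqn b.
Proof.
move=> n0 kn lo0 hlo hhi b.
have n0' : 0 < n%:R :> R by rewrite ltr0n.
have [d [cA _]] := symmetric_spectral (gram_sym X k).
pose ds := [seq d i | i <- index_enum 'I_#|k|].
(* The list chosen by [xget] and [ds] give the same product of linear factors, hence agree up to
   order. *)
have pE : perm_eq (eigenvalues (gram X k)) ds.
  rewrite /eigenvalues perm_sort; apply: prod_XsubC_eq.
  rewrite big_map -cA; case: xgetP => [s -> //|/(_ ds)].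
  by rewrite /= big_map.
have sds : size ds = #|k| by rewrite size_map [index_enum _]unlock -enumT size_enum_ord.
pose fs := [seq a <- eigenvalues (gram X k) | a != 0].
have mk : minn n #|k| = #|k| by apply/minn_idPr.
have hnu j : (j < #|k|)%N -> lo <= nth 0 fs j <= hi.
  move=> jk; have jin : j.+1 \in index_iota 1 (minn n #|k|).+1.
    by rewrite mem_index_iota mk ltnS.
  apply/andP; split.
    by apply: (le_trans hlo); exact: (@bigmin_le_mem _ (nu (gram X k)) _ j.+1).
  by apply: le_trans hhi; exact: (@bigmax_ge_mem _ (nu (gram X k)) _ j.+1).
(* Otherwise the entry at index [#|k|.-1] is the default 0, below [lo]. *)
have sfs : (#|k| <= size fs)%N.
  case: (posnP #|k|) => [->//|k0]; rewrite leqNgt; apply/negP => h.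
  have k1 : (#|k|.-1 < #|k|)%N by rewrite prednK.
  have := hnu _ k1; rewrite nth_default; last by rewrite -ltnS prednK.
  by move=> /andP[/(lt_le_trans lo0)]; rewrite ltxx.
have fsE : fs = eigenvalues (gram X k).
  apply/all_filterP; rewrite all_count; apply/eqP/anti_leq.
  by rewrite count_size/= -size_filter -/fs (perm_size pE) sds sfs.
have hd a : eigenvalue (gram X k) a -> lo <= a <= hi.
  rewrite eigenvalue_root_char cA -(big_map d xpredT (fun a => 'X - a%:P)) -/ds.
  rewrite root_prod_XsubC -(perm_mem pE) -fsE => /(nthP 0)[j js <-]; apply: hnu.
  by rewrite fsE (perm_size pE) sds in js.
have := symmetric_quadratic_bounds (gram_sym X k) hd b.
by rewrite gram_quadratic ler_pdivlMl// ler_pdivrMl// !mulrA.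
Qed.

(** Coefficients of a submodel are handled as restrictions of full vectors supported in [k]: this
    turns [submodel_mx X k] into [X] and [principal_mx A k] into [A], and makes different models
    comparable. *)
Definition restr_col p (k : {set 'I_p}) (c : 'cV[R]_p) : 'cV[R]_#|k| :=
  \col_i c (enum_val i) 0.

Lemma exists_restr_col p (k : {set 'I_p}) (b : 'cV[R]_#|k|) :
  exists2 c : 'cV[R]_p, (forall j, j \notin k -> c j 0 = 0) & restr_col k c = b.
Proof.
exists (\col_j \sum_(i < #|k|) (if enum_val i == j then b i 0 else 0)).
  move=> j jk; rewrite mxE big1// => i _; case: eqP => // ij.
  by move: jk; rewrite -ij enum_valP.
apply/colP => i; rewrite !mxE (bigD1 i)//= eqxx big1 ?addr0// => i' ii'.
by rewrite (inj_eq enum_val_inj) (negbTE ii').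
Qed.

Lemma sum_restr_col p (k : {set 'I_p}) (c : 'cV[R]_p) (F : 'I_p -> R) :
  (forall j, j \notin k -> c j 0 = 0) ->
  \sum_(i < #|k|) c (enum_val i) 0 * F (enum_val i) = \sum_j c j 0 * F j.
Proof.
move=> ck; rewrite [RHS](bigID (mem k))/= [X in _ + X]big1 ?addr0; last first.
  by move=> j jk; rewrite ck// mul0r.
by rewrite [RHS]big_enum_val.
Qed.

Lemma sqn_restr_col p (k : {set 'I_p}) (c : 'cV[R]_p) :
  (forall j, j \notin k -> c j 0 = 0) -> sqn (restr_col k c) = sqn c.
Proof.
move=> ck; rewrite /sqn -(eq_bigr _ (fun j _ => esym (expr2 (c j 0)))).
rewrite -(sum_restr_col (fun j => c j 0) ck); apply: eq_bigr => i _.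
by rewrite mxE expr2.
Qed.

Lemma submodel_restr_col n p (X : 'M[R]_(n, p)) (k : {set 'I_p}) (c : 'cV[R]_p) :
  (forall j, j \notin k -> c j 0 = 0) -> submodel_mx X k *m restr_col k c = X *m c.
Proof.
move=> ck; apply/colP => i; rewrite !mxE.
under [RHS]eq_bigr do rewrite mulrC.
rewrite -(sum_restr_col (X i) ck); apply: eq_bigr => j _.
by rewrite !mxE mulrC.
Qed.

Lemma principal_restr_col p (A : 'M[R]_p) (k : {set 'I_p}) (c : 'cV[R]_p) :
  (forall j, j \notin k -> c j 0 = 0) ->
  ((restr_col k c)^T *m principal_mx A k *m restr_col k c) 0 0 = (c^T *m A *m c) 0 0.
Proof.
move=> ck; rewrite !mxE.
under [RHS]eq_bigr do rewrite mulrC.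
rewrite -(sum_restr_col (fun j => (c^T *m A) 0 j) ck); apply: eq_bigr => j _.
rewrite !mxE mulrC; congr (_ * _).
under [RHS]eq_bigr do rewrite mxE.
rewrite -(sum_restr_col (fun i => A i (enum_val j)) ck).
by apply: eq_bigr => i _; rewrite !mxE.
Qed.

Lemma principal_bounds p (A : 'M[R]_p) (k : {set 'I_p}) (lo hi : R) : A^T = A ->
  (forall a, eigenvalue A a -> lo < a < hi) -> forall b : 'cV[R]_#|k|,
  lo * sqn b <= (b^T *m principal_mx A k *m b) 0 0 <= hi * sqn b.
Proof.
move=> sA hA b; have [c ck <-] := exists_restr_col b.
rewrite principal_restr_col// sqn_restr_col//.
by apply: symmetric_quadratic_bounds => // a /hA/andP[/ltW -> /ltW ->].
Qed.

Lemma principal_det_gt0 p (A : 'M[R]_p) (k : {set 'I_p}) (lo hi : R) : A^T = A ->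
  0 < lo -> (forall a, eigenvalue A a -> lo < a < hi) -> 0 < \det (principal_mx A k).
Proof.
move=> sA lo0 hA; apply: (posdef_det_gt0 _ lo0) => [|x].
  by apply/matrixP => i j; rewrite !mxE -[in LHS]sA mxE.
by have /andP[] := principal_bounds sA hA x.
Qed.

End quadratic_forms.

Section least_squares.
Context (R : realType) (n k : nat) (Z : 'M[R]_(n, k)).

Definition lsq : 'M[R]_(k, n) := invmx (Z^T *m Z) *m Z^T.

Definition rss (y : 'cV[R]_n) : R := sqn (y - Z *m (lsq *m y)).

Lemma rss_ge0 y : 0 <= rss y. Proof. exact: sqn_ge0. Qed.

Context (m0 : R) (m00 : 0 < m0) (hZ : forall b, m0 * sqn b <= sqn (Z *m b)).

Lemma lsq_unit : Z^T *m Z \in unitmx.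
Proof.
rewrite unitmxE unitfE gt_eqF//; apply: (posdef_det_gt0 _ m00) => [|x].
  by rewrite trmx_mul trmxK.
by rewrite -mulmxA -mulmxA mulmxA -trmx_mul -sqnE.
Qed.

(** By the normal equations the residual is orthogonal to the column space of [Z]. *)
Lemma lsq_pythagoras y b :
  sqn (y - Z *m b) = rss y + sqn (Z *m (b - lsq *m y)).
Proof.
rewrite /rss; set bh := lsq *m y; set e := y - Z *m bh; set f := Z *m (b - bh).
have -> : y - Z *m b = e - f by rewrite /e /f mulmxBr opprB addrA subrK.
have ZTe : Z^T *m e = 0.
  rewrite /e /bh /lsq mulmxBr; apply/eqP; rewrite subr_eq0; apply/eqP.
  by rewrite !mulmxA mulmxV ?lsq_unit// mul1mx.
by rewrite sqnB_dot /f trmx_mul -mulmxA ZTe mulmx0 [X in 2 * X]mxE mulr0 subr0.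
Qed.

Lemma rss_le y b : rss y <= sqn (y - Z *m b).
Proof. by rewrite lsq_pythagoras lerDl sqn_ge0. Qed.

Lemma rss_le_sqn y : rss y <= sqn y.
Proof. by have := rss_le y 0; rewrite mulmx0 subr0. Qed.

Lemma sqn_lsq_le y : m0 * sqn (lsq *m y) <= sqn y - rss y.
Proof.
have := lsq_pythagoras y 0; rewrite mulmx0 subr0 sub0r mulmxN sqnN => ->.
by rewrite addrAC subrr add0r.
Qed.

Lemma lsq_translate (y : 'cV[R]_n) (b : 'cV[R]_k) : lsq *m (Z *m b + y) = b + lsq *m y.
Proof.
have lZ : lsq *m Z = 1%:M by rewrite /lsq -mulmxA mulVmx ?lsq_unit.
by rewrite mulmxDr mulmxA lZ mul1mx.
Qed.

(** Under the true model the residual sum of squares therefore depends on the noise alone. *)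
Lemma rss_translate y b : rss (Z *m b + y) = rss y.
Proof. by rewrite /rss lsq_translate mulmxDr opprD addrACA subrr add0r. Qed.

End least_squares.

(** * Gaussian noise and residual sums of squares *)

Section weighted_transfer.
Context d d' (T : measurableType d) (Y : measurableType d') (R : realType)
  (mu : {measure set T -> \bar R}) (nu : {measure set Y -> \bar R})
  (H : T -> R) (Z : T -> Y) (c : R).
Hypotheses (mH : measurable_fun setT H) (H0 : forall w, 0 <= H w)
  (mZ : measurable_fun setT Z).
Hypothesis HZ : forall B : set Y, measurable B ->
  (\int[mu]_w (H w * \1_B (Z w))%:E = c%:E * nu B)%E.
Local Open Scope ereal_scope.

Import HBNNSimple.

(* The hypothesis HZ is the case of indicator functions. *)
Lemma ge0_integral_weighted_transfer (g : Y -> R) :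
  measurable_fun setT g -> (forall x, (0 <= g x)%R) ->
  \int[mu]_w (H w * g (Z w))%:E = c%:E * \int[nu]_x (g x)%:E.
Proof.
move=> mg g0.
have mEg : measurable_fun setT (EFin \o g) by apply/measurable_EFinP.
pose h := nnsfun_approx measurableT mEg.
have hcv x : (h n x)%:E @[n --> \oo] --> (g x)%:E.
  by apply: (cvg_nnsfun_approx measurableT mEg) => // y _; rewrite lee_fin.
have hnd x : {homo (fun n => h n x) : m n / (m <= n)%N >-> (m <= n)%R}.
  by move=> m n mn; exact/lefP/nd_nnsfun_approx.
have step n : \int[mu]_w (H w * h n (Z w))%:E = c%:E * \int[nu]_x (h n x)%:E.
  have fR : finite_set (range (h n)) by exact: fimfunP.
  have mI y : measurable (h n @^-1` [set y]) by exact: measurable_funPTI.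
  have pos (x : Y) (y a : R) : (0 <= a)%R -> (0 <= y * (a * \1_(h n @^-1` [set y]) x))%R.
    move=> a0; rewrite indicE; have [xy|] := boolP (x \in _); last by rewrite !mulr0.
    by move: xy; rewrite inE/= => <-; rewrite !mulr_ge0.
  have mind y : measurable_fun setT (fun w => (H w * \1_(h n @^-1` [set y]) (Z w))%R).
    apply: measurable_funM => //.
    by apply: measurableT_comp mZ; exact: measurable_indic.
  transitivity (\sum_(y \in range (h n))
      \int[mu]_w (y * (H w * \1_(h n @^-1` [set y]) (Z w)))%:E).
    rewrite -ge0_integral_fsum//; last 2 first.
    - by move=> y; apply/measurable_EFinP/measurable_funM.
    - by move=> y w _; rewrite lee_fin pos.
    apply: eq_integral => w _; rewrite fsumEFin// fimfunE; congr EFin.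
    by rewrite !fsbig_finite//= mulr_sumr; apply: eq_bigr => y _; ring.
  transitivity (\sum_(y \in range (h n)) c%:E * \int[nu]_x (y * \1_(h n @^-1` [set y]) x)%:E).
    apply: eq_fsbigr => y; rewrite inE => -[x0 _ hy].
    have y0 : (0 <= y)%R by rewrite -hy.
    under eq_integral do rewrite EFinM.
    rewrite ge0_integralZl_EFin//; last 2 first.
    - by move=> w _; rewrite lee_fin mulr_ge0.
    - exact/measurable_EFinP.
    rewrite HZ//; under [in RHS]eq_integral do rewrite EFinM.
    rewrite ge0_integralZl_EFin//; last by apply/measurable_EFinP; exact: measurable_indic.
    by rewrite integral_indic// setIT muleCA.
  rewrite -ge0_mule_fsumr; last first.
    by move=> y; apply: integral_ge0 => x _; rewrite lee_fin; have := pos x y 1%R ler01; rewrite mul1r.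
  rewrite -ge0_integral_fsum//; last 2 first.
  - by move=> y; apply/measurable_EFinP/measurable_funM => //; exact: measurable_indic.
  - by move=> y x _; rewrite lee_fin; have := pos x y 1%R ler01; rewrite mul1r.
  by congr (_ * _); apply: eq_integral => x _; rewrite fsumEFin// -fimfunE.
have cv1 : \int[mu]_w (H w * h n (Z w))%:E @[n --> \oo] --> \int[mu]_w (H w * g (Z w))%:E.
  have -> : \int[mu]_w (H w * g (Z w))%:E =
      \int[mu]_w limn (fun n => (H w * h n (Z w))%:E).
    apply: eq_integral => w _; apply/esym/cvg_lim => //.
    exact: (cvgeZl (isT : (H w)%:E \is a fin_num) (hcv (Z w))).
  apply: cvg_monotone_convergence => //.
  - move=> n; apply/measurable_EFinP/measurable_funM => //.
    exact: (measurableT_comp (measurable_funP (h n)) mZ).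
  - by move=> n w _; rewrite lee_fin mulr_ge0.
  - by move=> w _ m n mn; rewrite lee_fin ler_wpM2l// hnd.
have cv2 : \int[nu]_x (h n x)%:E @[n --> \oo] --> \int[nu]_x (g x)%:E.
  have -> : \int[nu]_x (g x)%:E = \int[nu]_x limn (fun n => (h n x)%:E).
    by apply: eq_integral => x _; apply/esym/cvg_lim => //; exact: hcv.
  apply: cvg_monotone_convergence => //.
  - by move=> n; apply/measurable_EFinP.
  - by move=> n w _; rewrite lee_fin.
  - by move=> w _ m n mn; rewrite lee_fin hnd.
have cv3 := cvgeZl (isT : c%:E \is a fin_num) cv2.
rewrite -(cvg_lim _ cv1)// -(cvg_lim _ cv3)//.
by congr (limn _); apply/funext => n; exact: step.
Qed.

End weighted_transfer.

Section independence.
Context (R : realType) d (T : measurableType d) (P : probability T R)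
  (I : finType) (Z : I -> {RV P >-> R}).
Hypothesis indZ : mutually_independent Z.

(** Induction on the set [S] of indices whose function is not an indicator. For empty [S] this is
    independence of events. Otherwise pick an index [i0] in [S] and treat the product of the other
    factors as a weight: the induction hypothesis gives the formula with any indicator at [i0], and
    [ge0_integral_weighted_transfer] extends it to [g i0]. *)
Lemma independent_integral_prod (g : I -> R -> R) (m : I -> R) :
  (forall i, measurable_fun setT (g i)) -> (forall i x, 0 <= g i x) ->
  (forall i, \int[P]_w (g i (Z i w))%:E = (m i)%:E)%E ->
  (\int[P]_w (\prod_i g i (Z i w))%:E = (\prod_i m i)%:E)%E.
Proof.
move=> mg g0 hm.
suff: forall (S : {set I}) (g : I -> R -> R) (m : I -> R),
  (forall i, measurable_fun setT (g i)) -> (forall i x, 0 <= g i x) ->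
  (forall i, \int[P]_w (g i (Z i w))%:E = (m i)%:E)%E ->
  (forall i, i \notin S -> exists2 B, measurable B & g i = \1_B) ->
  (\int[P]_w (\prod_i g i (Z i w))%:E = (\prod_i m i)%:E)%E.
  by move=> /(_ [set: I]%SET g m mg g0 hm); apply=> i; rewrite inE.
move=> {g m mg g0 hm} S.
have [n sS] := ubnP #|S|; elim: n S sS => // n IH S sS g m mg g0 hm gS.
have [S0|[i0 i0S]] := set_0Vmem S.
  have hB i : exists B : set R, measurable B /\ g i = \1_B.
    by have [B mB ->] := gS i (ltac:(by rewrite S0 inE)); exists B.
  have [B hB'] := choice hB.
  have mB i : measurable (B i) by have [] := hB' i.
  have gB i : g i = \1_(B i) by have [] := hB' i.
  have := indZ [set: I]%SET mB.
  have -> : \bigcap_(i in [set` [set: I]%SET]) (Z i @^-1` B i) =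
      \bigcap_(i in [set: I]) (Z i @^-1` B i).
    by apply/seteqP; split => w h i hi; apply: h; rewrite /= ?inE.
  have mZB i : measurable (Z i @^-1` B i) by exact: measurable_funPTI.
  have -> : (\prod_(i in [set: I]%SET) P (Z i @^-1` B i) = (\prod_i m i)%:E)%E.
    rewrite -prodEFin; apply: eq_big => [i|i _]; first by rewrite inE.
    rewrite -hm -(setIT (Z i @^-1` B i)) -integral_indic//.
    by apply: eq_integral => w _; rewrite gB.
  move=> <-; rewrite -[X in P X]setIT -integral_indic//; last first.
    apply: fin_bigcap_measurable => //; exact: finite_finset.
  apply: eq_integral => w _; congr EFin; rewrite indicE.
  have [|wB] := boolP (w \in _).
    by rewrite inE => wB; apply: big1 => i _; rewrite gB indicE mem_set//; exact: wB.
  have [i wi] : exists i, ~ B i (Z i w).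
    by apply/not_existsP => h; move/negP: wB; apply; rewrite inE => i _; exact: contrapT (h i).
  by rewrite (bigD1 i)//= gB indicE memNset// mul0r.
pose c := \prod_(i | i != i0) m i.
have m0 i : 0 <= m i.
  by rewrite -lee_fin -hm; apply: integral_ge0 => w _; rewrite lee_fin.
pose H w := \prod_(i | i != i0) g i (Z i w).
have mH : measurable_fun setT H.
  rewrite /H; under eq_fun do rewrite big_mkcond/=.
  apply: measurable_prod => i _; case: (i != i0); last exact: measurable_cst.
  exact: (measurableT_comp (mg i)).
have key (B : set R) : measurable B ->
    (\int[P]_w (H w * \1_B (Z i0 w))%:E = c%:E * distribution P (Z i0) B)%E.
  move=> mB; pose g' i := if i == i0 then \1_B : R -> R else g i.
  pose m' i := if i == i0 then fine (P (Z i0 @^-1` B)) else m i.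
  have mZB : measurable (Z i0 @^-1` B) by exact: measurable_funPTI.
  have Pf : (P (Z i0 @^-1` B)) \is a fin_num by exact: fin_num_measure.
  have := IH (S :\ i0)%SET _ g' m'.
  have -> : (\prod_i m' i)%:E = (c%:E * distribution P (Z i0) B)%E.
    rewrite (bigD1 i0)//= /m' eqxx EFinM fineK// muleC; congr (_%:E * _)%E.
    by apply: eq_bigr => i /negbTE ->.
  have -> : (\int[P]_w (\prod_i g' i (Z i w))%:E = \int[P]_w (H w * \1_B (Z i0 w))%:E)%E.
    apply: eq_integral => w _; congr EFin; rewrite (bigD1 i0)//= /g' eqxx mulrC.
    by congr (_ * _); apply: eq_bigr => i /negbTE ->.
  apply.
  - by move: sS; rewrite (cardsD1 i0) i0S.
  - by move=> i; rewrite /g'; case: eqP => // _; exact: measurable_indic.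
  - by move=> i x; rewrite /g'; case: eqP.
  - move=> i; rewrite /g' /m'; case: eqP => [->|//].
    rewrite fineK// -[X in P X]setIT -integral_indic//.
  - move=> i; rewrite in_setD1 negb_and negbK /g'; case: eqP => [_ _|_ /= /gS//].
    by exists B.
have H0 w : 0 <= H w by apply: prodr_ge0.
have := @ge0_integral_weighted_transfer _ _ _ _ _ P (distribution P (Z i0)) H (Z i0) c
  mH H0 (measurable_funP (Z i0)) key (g i0) (mg i0) (g0 i0).
rewrite ge0_integral_distribution//; last 2 first.
- by apply/measurable_EFinP.
- by move=> y; rewrite lee_fin.
rewrite /comp hm -EFinM => h.
rewrite [RHS](_ : _ = (c * m i0)%:E); last by rewrite (bigD1 i0)//= mulrC.
rewrite -h.
by apply: eq_integral => w _; congr EFin; rewrite (bigD1 i0)//= mulrC.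
Qed.

End independence.

Section normal.
Context (R : realType) (s : R).
Hypothesis s0 : 0 < s.

Lemma ge0_integral_normal_prob (g : R -> R) : measurable_fun setT g ->
  (forall x, 0 <= g x) ->
  (\int[normal_prob 0 s]_x (g x)%:E =
   \int[lebesgue_measure]_x (normal_pdf 0 s x * g x)%:E)%E.
Proof.
move=> mg g0; apply/esym.
rewrite (@ge0_integral_weighted_transfer _ _ _ _ _ (@lebesgue_measure R)
  (normal_prob 0 s) (normal_pdf 0 s) idfun 1) ?mul1e//.
- exact: measurable_normal_pdf.
- by move=> x; exact: normal_pdf_ge0.
- exact: measurable_id.
- move=> B mB; rewrite mul1e /normal_prob [RHS]integral_mkcond.
  apply: eq_integral => x _; rewrite patchE indicE.
  by case: ifPn => _; rewrite ?mulr1 ?mulr0.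
Qed.

(** Multiplied by the normal density, the exponent has quadratic coefficient [u / (2 s ^ 2)];
    complete the square around [- w / u]. *)
Lemma normal_mgf (u w : R) : 0 < u ->
  (\int[normal_prob 0 s]_x (expR (- (((u - 1) * x ^+ 2 + 2 * w * x) / (2 * s ^+ 2))))%:E =
   ((Num.sqrt u)^-1 * expR (w ^+ 2 / (2 * u * s ^+ 2)))%:E)%E.
Proof.
move=> u0; have s20 : 0 < s ^+ 2 by rewrite exprn_gt0.
have s1 : s != 0 by rewrite gt_eqF.
have a0 : 0 < u / (2 * s ^+ 2) by rewrite divr_gt0// mulr_gt0.
have c0 : 0 <= normal_peak s * expR (w ^+ 2 / (2 * u * s ^+ 2)).
  by rewrite mulr_ge0 ?normal_peak_ge0 ?expR_ge0.
rewrite ge0_integral_normal_prob; last 2 first.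
- apply: measurableT_comp => //; apply: measurableT_comp => //.
  apply: measurable_funM => //; apply: measurable_funD; apply: measurable_funM => //.
- by move=> x; exact: expR_ge0.
transitivity (\int[lebesgue_measure]_x
  ((normal_peak s * expR (w ^+ 2 / (2 * u * s ^+ 2)))%:E *
   (expR (- (u / (2 * s ^+ 2) * (x - (- w / u)) ^+ 2)))%:E))%E.
  apply: eq_integral => x _; rewrite -EFinM; congr EFin.
  rewrite normal_pdfE// /normal_fun -!mulrA -!expRD; congr (_ * expR _).
  by field; rewrite ?gt_eqF.
rewrite ge0_integralZl_EFin//; last by apply/measurable_EFinP; exact: measurable_gauss.
rewrite integral_gauss// -EFinM; congr EFin.
rewrite mulrAC; congr (_ * _).
have -> : Num.sqrt (pi / (u / (2 * s ^+ 2))) = Num.sqrt (s ^+ 2 * pi *+ 2) * (Num.sqrt u)^-1.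
  rewrite -sqrtrV ?ltW// -sqrtrM; last by rewrite mulrn_wge0// mulr_ge0 ?pi_ge0// ltW.
  by congr Num.sqrt; field; rewrite ?gt_eqF.
rewrite /normal_peak mulrA mulVf ?mul1r// gt_eqF// sqrtr_gt0.
by rewrite mulrn_wgt0// mulr_gt0 ?pi_gt0.
Qed.

End normal.

Section noise.
Context (R : realType) d (T : measurableType d) (P : probability T R) (n : nat)
  (s : R) (eps : 'I_n -> {RV P >-> R}).
Hypotheses (s0 : 0 < s)
  (eps_normal : forall (i : 'I_n) (B : set R), measurable B ->
     distribution P (eps i) B = normal_prob 0 s B)
  (eps_indep : mutually_independent eps).

Definition noise (w : T) : 'cV[R]_n := \col_i eps i w.

Lemma noise_mgf (u : R) (v : 'cV[R]_n) : 0 < u ->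
  (\int[P]_w (expR (- (((u - 1) * sqn (noise w) + 2 * \sum_i v i 0 * noise w i 0)
       / (2 * s ^+ 2))))%:E =
   ((Num.sqrt u)^-1 ^+ n * expR (sqn v / (2 * u * s ^+ 2)))%:E)%E.
Proof.
move=> u0.
pose g (i : 'I_n) x := expR (- (((u - 1) * x ^+ 2 + 2 * v i 0 * x) / (2 * s ^+ 2))).
pose m (i : 'I_n) := (Num.sqrt u)^-1 * expR ((v i 0) ^+ 2 / (2 * u * s ^+ 2)).
have mg i : measurable_fun setT (g i).
  apply: measurableT_comp => //; apply: measurableT_comp => //.
  by apply: measurable_funM => //; apply: measurable_funD; apply: measurable_funM.
have := @independent_integral_prod _ _ _ P _ eps eps_indep g m mg
  (fun i x => expR_ge0 _).
have -> : (\prod_i m i) = (Num.sqrt u)^-1 ^+ n * expR (sqn v / (2 * u * s ^+ 2)).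
  rewrite big_split/= prodr_const card_ord; congr (_ * _).
  by rewrite -expR_sum; congr expR; rewrite -mulr_suml.
move=> <-.
  apply: eq_integral => w _; congr EFin; rewrite -expR_sum; congr expR.
  rewrite sumrN -mulr_suml; congr (- (_ / _)).
  rewrite big_split/= -!mulr_sumr; congr (_ * _ + _).
    by apply: eq_bigr => i _; rewrite mxE.
  by rewrite mulr_sumr; apply: eq_bigr => i _; rewrite mxE mulrA.
move=> i; rewrite /m -normal_mgf//.
transitivity (\int[P]_w (1 * g i (eps i w))%:E)%E.
  by apply: eq_integral => w _; rewrite mul1r.
rewrite (@ge0_integral_weighted_transfer _ _ T (measurableTypeR R) R P
  (normal_prob 0 s) (fun=> 1) (eps i) 1) ?mul1e//.
- exact: (measurable_funP (eps i)).
- move=> B mB; rewrite mul1e; transitivity (P (eps i @^-1` B)); last exact: eps_normal.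
  have mZB : measurable (eps i @^-1` B) by exact: measurable_funPTI.
  rewrite -[X in P X]setIT -integral_indic//.
  by apply: eq_integral => w _; rewrite mul1r.
- exact: mg.
- by move=> x; exact: expR_ge0.
Qed.

End noise.

Section measurable_vectors.
Context (R : realType) d (U : measurableType d).

Definition measurable_col n (f : U -> 'cV[R]_n) :=
  forall i, measurable_fun setT (fun w => f w i 0).

Lemma measurable_col_cst n (v : 'cV[R]_n) : measurable_col (fun _ => v).
Proof. by move=> i; exact: measurable_cst. Qed.

Lemma measurable_colD n (f g : U -> 'cV[R]_n) :
  measurable_col f -> measurable_col g -> measurable_col (fun w => f w + g w).
Proof.
move=> mf mg i; under eq_fun do rewrite mxE.
exact: measurable_funD.
Qed.

Lemma measurable_colB n (f g : U -> 'cV[R]_n) :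
  measurable_col f -> measurable_col g -> measurable_col (fun w => f w - g w).
Proof.
move=> mf mg i; under eq_fun do rewrite !mxE.
exact: measurable_funB.
Qed.

Lemma measurable_col_mulmx m n (A : 'M[R]_(m, n)) (f : U -> 'cV[R]_n) :
  measurable_col f -> measurable_col (fun w => A *m f w).
Proof.
move=> mf i; under eq_fun do rewrite mxE.
by apply: measurable_sum => j; apply: measurable_funM.
Qed.

Lemma measurable_sqn n (f : U -> 'cV[R]_n) :
  measurable_col f -> measurable_fun setT (fun w => sqn (f w)).
Proof. by move=> mf; apply: measurable_sum => j; apply: measurable_funX. Qed.

Lemma measurable_rss n k (Z : 'M[R]_(n, k)) (f : U -> 'cV[R]_n) :
  measurable_col f -> measurable_fun setT (fun w => rss Z (f w)).
Proof.
move=> mf; apply: measurable_sqn; apply: measurable_colB => //.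
by do 2 apply: measurable_col_mulmx.
Qed.

End measurable_vectors.

Lemma measurable_col_noise (R : realType) d (T : measurableType d)
    (P : probability T R) n (eps : 'I_n -> {RV P >-> R}) : measurable_col (noise eps).
Proof. by move=> i; under eq_fun do rewrite mxE; exact: measurable_funP. Qed.

Lemma measurable_col_of_tuple (R : realType) k :
  measurable_col (@col_of_tuple R k).
Proof.
move=> i; under eq_fun do rewrite mxE; exact: measurable_tnth.
Qed.

Lemma measurable_col_comp (R : realType) d1 d2 (U : measurableType d1)
    (V : measurableType d2) n (f : V -> 'cV[R]_n) (g : U -> V) :
  measurable_col f -> measurable_fun setT g -> measurable_col (fun u => f (g u)).
Proof. by move=> mf mg i; exact: (measurableT_comp (mf i) mg). Qed.

(** Weighted arithmetic-geometric inequality for [u] and 1. With [L = ln u], apply [1 + x <= exp x]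
    at [(1 - a) L] and at [- a L], multiply by [exp (a L)], and average with weights [a] and
    [1 - a]: the terms linear in [L] cancel. *)
Lemma powR_weighted_le (R : realType) (a u : R) : 0 <= a <= 1 -> 0 < u ->
  u `^ a <= (1 - a) + a * u.
Proof.
move=> /andP[a0 a1] u0; set L := ln u.
have -> : u = expR L by rewrite lnK.
have -> : expR L `^ a = expR (a * L) by rewrite /powR gt_eqF ?expR_gt0// expRK.
have h1 : expR (a * L) * (1 + (1 - a) * L) <= expR L.
  have -> : expR L = expR (a * L) * expR ((1 - a) * L).
    by rewrite -expRD; congr expR; ring.
  by rewrite ler_wpM2l ?expR_ge0// expR_ge1Dx.
have h2 : expR (a * L) * (1 + - (a * L)) <= 1.
  rewrite -[leRHS](_ : expR (a * L) * expR (- (a * L)) = 1).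
    by rewrite ler_wpM2l ?expR_ge0// expR_ge1Dx.
  by rewrite -expRD subrr expR0.
have a1' : 0 <= 1 - a by rewrite subr_ge0.
have := ler_wpM2l a0 h1; have := ler_wpM2l a1' h2.
by move: (expR (a * L)) (expR L) => e f; nra.
Qed.

(** * Chernoff bound for the residual sum of squares *)

Section chernoff.
Context (R : realType) d (T : measurableType d) (P : probability T R) (n k : nat)
  (s : R) (eps : 'I_n -> {RV P >-> R}).
Hypotheses (s0 : 0 < s)
  (eps_normal : forall (i : 'I_n) (B : set R), measurable B ->
     distribution P (eps i) B = normal_prob 0 s B)
  (eps_indep : mutually_independent eps).
Context (Z : 'M[R]_(n, k)) (m0 M0 : R).
Hypotheses (m00 : 0 < m0)
  (hm : forall b, m0 * sqn b <= sqn (Z *m b))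
  (hM : forall b, sqn (Z *m b) <= M0 * sqn b) (M00 : 0 < M0).

(* exp (- a rss / 2) is, up to a constant, the integral over b of
   exp (- a |y - Z b|^2 / 2). *)
Lemma expR_rss_le (a c : R) (y : 'cV[R]_n) : 0 < a ->
  ((expR (c - a * rss Z y / 2) * (Num.sqrt (pi / (a * M0 / 2))) ^+ k)%:E <=
   integral_Rn (fun b : k.-tuple R =>
     (expR (c - a * sqn (y - Z *m col_of_tuple b) / 2))%:E))%E.
Proof.
move=> a0; have aM : 0 < a * M0 / 2 by rewrite divr_gt0// mulr_gt0.
pose f (i : 'I_k) (x : R) := expR (- (a * M0 / 2 * (x - (lsq Z *m y) i 0) ^+ 2)).
apply: (@integral_Rn_ge_prod _ _ _ _ _ f).
- exact: expR_ge0.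
- exact: sqrtr_ge0.
- by move=> i x; exact: expR_ge0.
- by move=> i; exact: measurable_gauss.
- by move=> i; rewrite integral_gauss.
- by move=> i; rewrite integral_gauss// ltry.
- move=> b; rewrite lee_fin -expR_sum -expRD ler_expR.
  rewrite sumrN -mulr_sumr (lsq_pythagoras m00 hm).
  have : a * sqn (Z *m (col_of_tuple b - lsq Z *m y)) <= a * (M0 * sqn (col_of_tuple b - lsq Z *m y)).
    by rewrite ler_pM2l.
  have -> : sqn (col_of_tuple b - lsq Z *m y) = \sum_(i < k) (tnth b i - (lsq Z *m y) i 0) ^+ 2.
    by apply: eq_bigr => i _; rewrite !mxE.
  set S := \sum_(i < k) _; rewrite mulrDr; lra.
Qed.

(** Counterpart of [expR_rss_le]: once the noise is integrated out, it returns from the integral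
    over [b] to the residual sum of squares of the mean. One direction uses [M0] and the other [m0],
    so each coordinate costs the root of a condition number. *)
Lemma integral_expR_residual_le (c a : R) (v : 'cV[R]_n) : 0 <= c -> 0 < a ->
  (integral_Rn (fun b : k.-tuple R =>
     (c * expR (- (a * sqn (v - Z *m col_of_tuple b))))%:E) <=
   (c * expR (- (a * rss Z v)) * (Num.sqrt (pi / (a * m0))) ^+ k)%:E)%E.
Proof.
move=> c0 a0; have am : 0 < a * m0 by rewrite mulr_gt0.
pose f (i : 'I_k) (x : R) := expR (- (a * m0 * (x - (lsq Z *m v) i 0) ^+ 2)).
apply: (@integral_Rn_le_prod _ _ _ _ _ f).
- by rewrite mulr_ge0// expR_ge0.
- by move=> i x; exact: expR_ge0.
- by move=> i; exact: measurable_gauss.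
- by move=> i; rewrite integral_gauss.
- by move=> b; rewrite lee_fin mulr_ge0// expR_ge0.
- move=> b; rewrite lee_fin -mulrA ler_wpM2l// -expR_sum -expRD ler_expR.
  rewrite sumrN -mulr_sumr (lsq_pythagoras m00 hm).
  have : a * (m0 * sqn (col_of_tuple b - lsq Z *m v)) <= a * sqn (Z *m (col_of_tuple b - lsq Z *m v)).
    by rewrite ler_pM2l.
  have -> : sqn (col_of_tuple b - lsq Z *m v) = \sum_(i < k) (tnth b i - (lsq Z *m v) i 0) ^+ 2.
    by apply: eq_bigr => i _; rewrite !mxE.
  set S := \sum_(i < k) _; rewrite mulrDr; lra.
Qed.

(** An instance of [noise_mgf] with [u = 1 + la (1 - x)]. The Gaussian left in [v] has precision
    proportional to [la (1 - la x) / u], positive exactly when [la x < 1]. *)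
Lemma noise_shift_mgf (la x : R) (v : 'cV[R]_n) : 0 < 1 + la * (1 - x) ->
  (\int[P]_w (expR (la * x / s ^+ 2 * sqn (noise eps w) / 2
                    - la / s ^+ 2 * sqn (v + noise eps w) / 2))%:E =
   ((Num.sqrt (1 + la * (1 - x)))^-1 ^+ n *
    expR (- (la * (1 - la * x) / (1 + la * (1 - x)) / (2 * s ^+ 2) * sqn v)))%:E)%E.
Proof.
move=> u0; set u := 1 + la * (1 - x).
have s1 : s != 0 by rewrite gt_eqF.
transitivity (\int[P]_w ((expR (- (la * sqn v / (2 * s ^+ 2))))%:E *
   (expR (- (((u - 1) * sqn (noise eps w) + 2 * \sum_i (la *: v) i 0 * noise eps w i 0)
       / (2 * s ^+ 2))))%:E))%E.
  apply: eq_integral => w _; rewrite -EFinM -expRD; congr (expR _)%:E.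
  have -> : sqn (v + noise eps w) = sqn v + 2 * (\sum_i v i 0 * noise eps w i 0) + sqn (noise eps w).
    rewrite /sqn mulr_sumr -!big_split/=; apply: eq_bigr => i _; rewrite !mxE; ring.
  have -> : \sum_i (la *: v) i 0 * noise eps w i 0 = la * \sum_i v i 0 * noise eps w i 0.
    by rewrite mulr_sumr; apply: eq_bigr => i _; rewrite mxE mulrA.
  by rewrite /u; field.
rewrite ge0_integralZl_EFin//; last first.
  apply/measurable_EFinP; apply: measurableT_comp => //; apply: measurableT_comp => //.
  apply: measurable_funM => //; apply: measurable_funD; apply: measurable_funM => //.
    by apply: measurable_sqn; exact: measurable_col_noise.
  by apply: measurable_sum => i; apply: measurable_funM => //; exact: measurable_col_noise.
rewrite noise_mgf// -EFinM; congr EFin.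
rewrite mulrCA; congr (_ * _); rewrite -expRD; congr expR.
have -> : sqn (la *: v) = la ^+ 2 * sqn v.
  by rewrite /sqn mulr_sumr; apply: eq_bigr => i _; rewrite mxE exprMn.
by rewrite /u; field; rewrite s1 -/u gt_eqF.
Qed.

(** Chernoff's method with parameter [la / s ^ 2]. The residual sum of squares is replaced by its
    Gaussian integral over [b], so that only the moment generating function of independent normals
    is involved, not the law of a projection. The exponent is [n - k] and not [n] because each of
    the [k] integrations over [b] returns a factor [sqrt u]. *)
Lemma rss_small_prob (mu : 'cV[R]_n) (al C1 de x : R) : (k <= n)%N ->
  0 <= al -> 0 <= C1 -> 0 < de <= 1 / 4 -> 0 < x <= 2 ->
  (P [set w | rss Z (mu + noise eps w) / 2 + al <=
              x * (sqn (noise eps w) / 2 + C1)]%R <=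
   (expR (C1 / s ^+ 2) * (Num.sqrt (M0 / (m0 * de))) ^+ k *
    x `^ ((1 - de) * (n - k)%:R / 2) * expR (- (de * rss Z mu / (4 * s ^+ 2))))%:E)%E.
Proof.
move=> kn al0 C10 /andP[de0 de1] /andP[x0 x2].
set A := [set w | _].
have s20 : 0 < s ^+ 2 by rewrite exprn_gt0.
(* At [la = 1 / x] the Gaussian in [mu - Z b] would disappear and the integral over [b] diverge; the
   factor [1 - de] keeps it integrable and saves part of the signal [rss Z mu]. *)
pose la := (1 - de) / x; pose u := de + la.
have la0 : 0 < la by rewrite divr_gt0// subr_gt0 (le_lt_trans de1)//; lra.
have u0 : 0 < u by rewrite addr_gt0.
have lax : la * x = 1 - de by rewrite /la mulfVK// gt_eqF.
have uE : 1 + la * (1 - x) = u by rewrite mulrBr lax /u; ring.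
have mno := measurable_col_noise eps.
have mrss : measurable_fun setT (fun w => rss Z (mu + noise eps w)).
  by apply: measurable_rss; apply: measurable_colD => //; exact: measurable_col_cst.
have msqn : measurable_fun setT (fun w => sqn (noise eps w)) by exact: measurable_sqn.
have mA : measurable A.
  rewrite /A -[X in measurable X]setTI.
  apply: (@measurable_fun_le _ _ R setT (fun w => rss Z (mu + noise eps w) / 2 + al)
    (fun w => x * (sqn (noise eps w) / 2 + C1))) => //.
    by apply: measurable_funD => //; apply: measurable_funM.
  by apply: measurable_funM => //; apply: measurable_funD => //; apply: measurable_funM.
pose F (z : T * k.-tuple R) : \bar R := (expR (la * x / s ^+ 2 * sqn (noise eps z.1) / 2
    - la / s ^+ 2 * sqn ((mu - Z *m col_of_tuple z.2) + noise eps z.1) / 2))%:E.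
have mF : measurable_fun setT F.
  have m1 : measurable_col (fun z : T * k.-tuple R => noise eps z.1).
    exact: (measurable_col_comp (g := fst) mno measurable_fst).
  have m2 : measurable_col (fun z : T * k.-tuple R => col_of_tuple z.2).
    exact: (measurable_col_comp (g := snd) (@measurable_col_of_tuple R k) measurable_snd).
  apply/measurable_EFinP; apply: measurableT_comp => //; apply: measurable_funB.
    by apply: measurable_funM => //; apply: measurable_funM => //; exact: measurable_sqn.
  apply: measurable_funM => //; apply: measurable_funM => //; apply: measurable_sqn.
  apply: measurable_colD => //; apply: measurable_colB; first exact: measurable_col_cst.
  exact: measurable_col_mulmx.
have F0 z : (0 <= F z)%E by rewrite lee_fin expR_ge0.
pose q := Num.sqrt (pi / (la / s ^+ 2 * M0 / 2)).
have q0 : 0 < q.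
  by rewrite sqrtr_gt0 divr_gt0 ?pi_gt0// divr_gt0// mulr_gt0// divr_gt0.
pose c := la * de / u.
have c0 : 0 < c by rewrite divr_gt0// mulr_gt0.
have step1 : (P A <= (expR (C1 / s ^+ 2) / q ^+ k)%:E *
    \int[P]_w integral_Rn (fun b => F (w, b)))%E.
  rewrite -ge0_integralZl_EFin//; last 3 first.
  - by move=> w _; apply: integral_Rn_ge0.
  - exact: measurable_integral_Rn.
  - by rewrite divr_ge0 ?expR_ge0// exprn_ge0// ltW.
  rewrite -[A]setIT -integral_indic//.
  apply: ge0_le_integral_gen => w _; first by rewrite lee_fin.
  rewrite indicE; have [|_] := boolP (w \in A); last first.
    rewrite mule_ge0 ?integral_Rn_ge0// lee_fin divr_ge0 ?expR_ge0//.
    by rewrite exprn_ge0// ltW.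
  rewrite inE => Aw.
  have h := @expR_rss_le (la / s ^+ 2) (la * x / s ^+ 2 * sqn (noise eps w) / 2)
     (mu + noise eps w) (divr_gt0 la0 s20).
  apply: (@le_trans _ _ ((expR (C1 / s ^+ 2) / q ^+ k)%:E *
    (expR (la * x / s ^+ 2 * sqn (noise eps w) / 2 -
      la / s ^+ 2 * rss Z (mu + noise eps w) / 2) * q ^+ k)%:E)%E); last first.
    apply: lee_wpmul2l; first by rewrite lee_fin divr_ge0 ?expR_ge0// exprn_ge0// ltW.
    apply: (le_trans h); apply: le_integral_Rn => b; first by rewrite lee_fin expR_ge0.
    by rewrite /F/= (_ : mu - Z *m _ + _ = mu + noise eps w - Z *m col_of_tuple b)// addrAC.
  have qk0 : q ^+ k != 0 by rewrite expf_neq0// gt_eqF.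
  rewrite -EFinM lee_fin.
  set E := expR (_ - _); have -> : expR (C1 / s ^+ 2) / q ^+ k * (E * q ^+ k) =
    expR (C1 / s ^+ 2) * E by field.
  rewrite /E -expRD -[leLHS]expR0 ler_expR.
  have Aw' : la / s ^+ 2 * (rss Z (mu + noise eps w) / 2 + al) <=
     la / s ^+ 2 * (x * (sqn (noise eps w) / 2 + C1)) by rewrite ler_pM2l// divr_gt0.
  have e1 : la / s ^+ 2 * (x * C1) <= C1 / s ^+ 2.
    have -> : la / s ^+ 2 * (x * C1) = (la * x) * (C1 / s ^+ 2) by ring.
    by rewrite lax ler_piMl ?gerBl ?(ltW de0)// divr_ge0// ltW.
  have e2 : 0 <= la / s ^+ 2 * al by rewrite mulr_ge0// divr_ge0// ltW.
  rewrite (mulrAC la x); move: Aw' e1 e2 {qk0 E h}.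
  move: (la / s ^+ 2) (C1 / s ^+ 2) => L D; rewrite !mulrDr; lra.
(* For fixed [b] the expectation over the noise is explicit. *)
rewrite integral_Rn_tonelli// in step1.
have step2 : (integral_Rn (fun b => \int[P]_w F (w, b)) <=
   ((Num.sqrt u)^-1 ^+ n * expR (- (c / (2 * s ^+ 2) * rss Z mu)) *
    (Num.sqrt (pi / (c / (2 * s ^+ 2) * m0))) ^+ k)%:E)%E.
  apply: le_trans (integral_expR_residual_le _ _ _); last 2 first.
  - by rewrite exprn_ge0// invr_ge0 sqrtr_ge0.
  - by rewrite divr_gt0// mulr_gt0.
  apply: le_integral_Rn => b; first by apply: integral_ge0.
  rewrite /F/= noise_shift_mgf uE// lax (_ : 1 - (1 - de) = de)//; ring.
apply: (le_trans step1); apply: (le_trans (lee_wpmul2l _ step2)).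
  by rewrite lee_fin divr_ge0 ?expR_ge0// exprn_ge0// ltW.
rewrite -EFinM lee_fin.
(* The two Gaussian integrals over [b] cancel up to the condition number and [sqrt u]. *)
have qE : Num.sqrt (pi / (c / (2 * s ^+ 2) * m0)) = q * Num.sqrt (M0 / (m0 * de)) * Num.sqrt u.
  have qq : 0 < pi / (la / s ^+ 2 * M0 / 2).
    by rewrite divr_gt0 ?pi_gt0// divr_gt0// mulr_gt0// divr_gt0.
  have md : 0 < M0 / (m0 * de) by rewrite divr_gt0// mulr_gt0.
  rewrite /q -!sqrtrM ?(ltW qq) ?(ltW (mulr_gt0 qq md))//.
  by congr Num.sqrt; rewrite /c; field; rewrite !gt_eqF.
rewrite qE !exprMn.
have uk : (Num.sqrt u)^-1 ^+ n * Num.sqrt u ^+ k = (Num.sqrt u)^-1 ^+ (n - k).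
  rewrite -{1}(subnK kn) exprD -mulrA -exprMn mulVf ?expr1n ?mulr1//.
  by rewrite gt_eqF// sqrtr_gt0.
(* [u] is the mean of 1 and [1 / x] with weights [de] and [1 - de], hence at least
   [(1 / x) ^ (1 - de)]. *)
have xk : (Num.sqrt u)^-1 ^+ (n - k) <= x `^ ((1 - de) * (n - k)%:R / 2).
  have -> : x `^ ((1 - de) * (n - k)%:R / 2) = (x `^ ((1 - de) / 2)) ^+ (n - k).
    by rewrite -powR_mulrn ?powR_ge0// -powRrM; congr (_ `^ _); ring.
  apply: lerXn2r; rewrite ?nnegrE ?invr_ge0 ?sqrtr_ge0 ?powR_ge0//.
  rewrite -[leRHS]invrK lef_pV2 ?posrE ?sqrtr_gt0 ?invr_gt0 ?powR_gt0//.
  rewrite -powRN -(powR12_sqrt (ltW u0)).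
  have -> : x `^ (- ((1 - de) / 2)) = (x^-1 `^ (1 - de)) `^ 2^-1.
    rewrite -[x^-1]powR_inv1 ?(ltW x0)// -!powRrM; congr (_ `^ _); ring.
  apply: ge0_ler_powR; rewrite ?nnegrE ?powR_ge0 ?(ltW u0)// ?invr_ge0//.
  have := @powR_weighted_le R (1 - de) x^-1; rewrite opprB addrCA subrr addr0 => h.
  apply: h; last by rewrite invr_gt0.
  apply/andP; split; lra.
(* [x <= 2] gives [la >= (1 - de) / 2 >= de], whence [c >= de / 2]. *)
have cE : expR (- (c / (2 * s ^+ 2) * rss Z mu)) <= expR (- (de * rss Z mu / (4 * s ^+ 2))).
  rewrite ler_expR lerN2.
  have c2 : de / 2 <= c.
    rewrite /c ler_pdivlMr// /u.
    have : (1 - de) / 2 <= la by rewrite /la ler_wpM2l ?subr_ge0 ?lef_pV2 ?posrE//; lra.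
    nra.
  have := ler_wpM2r (rss_ge0 Z mu) c2.
  have s2i : 0 <= (2 * s ^+ 2)^-1 by rewrite invr_ge0 mulr_ge0// ltW.
  move=> /(ler_wpM2r s2i); congr (_ <= _).
    by field; rewrite gt_eqF.
  by field; rewrite gt_eqF.
have g0 : 0 <= Num.sqrt (M0 / (m0 * de)) ^+ k by rewrite exprn_ge0// sqrtr_ge0.
have -> : expR (C1 / s ^+ 2) / q ^+ k *
  ((Num.sqrt u)^-1 ^+ n * expR (- (c / (2 * s ^+ 2) * rss Z mu)) *
   (q ^+ k * Num.sqrt (M0 / (m0 * de)) ^+ k * Num.sqrt u ^+ k)) =
  expR (C1 / s ^+ 2) * Num.sqrt (M0 / (m0 * de)) ^+ k *
  ((Num.sqrt u)^-1 ^+ n * Num.sqrt u ^+ k) * expR (- (c / (2 * s ^+ 2) * rss Z mu)).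
  have qk0 : q ^+ k != 0 by rewrite expf_neq0// gt_eqF.
  move: (q ^+ k) qk0 ((Num.sqrt u)^-1 ^+ n) (Num.sqrt u ^+ k) => Q Q0 U1 U2.
  by field.
rewrite uk; apply: ler_pM; rewrite ?expR_ge0//.
by rewrite ler_wpM2l// mulr_ge0 ?expR_ge0.
Qed.

End chernoff.

(** * Subadditivity of powers, and negative moments from tail bounds *)

Section moments.
Context (R : realType) d (T : measurableType d) (P : probability T R).

(** For two terms, [u <= u ^ g] on the unit interval, applied to the shares [a / (a + b)] and
    [b / (a + b)]. *)
Lemma powR_le_sum (I : finType) (Q : pred I) (z : I -> R) (g : R) :
  0 < g <= 1 -> (forall i, 0 <= z i) ->
  (\sum_(i | Q i) z i) `^ g <= \sum_(i | Q i) z i `^ g.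
Proof.
move=> /andP[g0 g1] z0.
have add2 a b : 0 <= a -> 0 <= b -> (a + b) `^ g <= a `^ g + b `^ g.
  move=> a0 b0; have [ab0|ab0] := eqVneq (a + b) 0.
    by rewrite ab0 powR0 ?gt_eqF// addr_ge0 ?powR_ge0.
  have {}ab0 : 0 < a + b by rewrite lt0r ab0 addr_ge0.
  have frac c : 0 <= c <= a + b -> c / (a + b) * (a + b) `^ g <= c `^ g.
    move=> /andP[c0 cab]; have [->|c1] := eqVneq c 0.
      by rewrite !mul0r powR_ge0.
    have {}c0 : 0 < c by rewrite lt0r c1.
    have -> : c `^ g = (c / (a + b)) `^ g * (a + b) `^ g.
      by rewrite -powRM ?divfK ?gt_eqF// ?divr_ge0// ltW.
    rewrite ler_wpM2r ?powR_ge0// ger1_powR// divr_gt0//=.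
    by rewrite ler_pdivrMr// mul1r.
  have := lerD (frac a _) (frac b _).
  rewrite -mulrDl -mulrDl divff ?gt_eqF// mul1r; apply.
    by rewrite a0 lerDl.
  by rewrite b0 lerDr.
suff [//] : (\sum_(i | Q i) z i) `^ g <= \sum_(i | Q i) z i `^ g /\ 0 <= \sum_(i | Q i) z i.
elim/big_rec2: _ => [|i y x _ [IH x0]]; first by rewrite powR0// gt_eqF.
split; last by rewrite addr_ge0.
by apply: le_trans (add2 _ _ (z0 i) x0) _; rewrite lerD.
Qed.

(** Layer-cake formula for [V ^ (- s)], cut at the level [x0 ^ (- s)]: the probability is bounded by
    1 below the cut, by the tail hypothesis above. There it is at most [Q r ^ (- sg / s)],
    integrable with factor [1 / de] because [sg / s >= 1 + de]. The cut is free so that a very small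
    [Q] can be exploited with [x0 > 1]. *)
Lemma negative_moment_le (V : T -> R) (Q s sg de x0 : R) :
  measurable_fun setT V -> (forall w, 0 < V w) ->
  0 <= Q -> 0 < s -> 0 < de -> (1 + de) * s <= sg -> 1 <= x0 <= 2 ->
  (forall x, 0 < x <= 2 -> (P [set w | V w <= x]%R <= (Q * x `^ sg)%:E)%E) ->
  (\int[P]_w (V w `^ (- s))%:E <= (x0 `^ (- s) + Q / de * x0 `^ (sg - s))%:E)%E.
Proof.
move=> mV V0 Q0 s0 de0 hsg /andP[x01 x02] hV.
have x00 : 0 < x0 by exact: lt_le_trans x01.
have mX : measurable_fun setT (fun w => V w `^ (- s)).
  apply: (measurableT_comp (f := fun x : R => x `^ (- s)) (g := V)) mV.
  exact: measurable_powR_fun.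
pose X : {RV P >-> R} := HB.pack (fun w => V w `^ (- s))
  (isMeasurableFun.Build _ _ _ _ _ mX).
have X0 w : 0 <= X w by exact: powR_ge0.
have := ge0_expectation_ccdf X0; rewrite expectation_def => ->.
pose r0 := x0 `^ (- s); have r00 : 0 < r0 by rewrite powR_gt0.
have sg1 : 1 + de <= sg / s by rewrite ler_pdivlMr.
have split_dom : `[0%R, +oo[%classic = `[0%R, r0[ `|` `[r0, +oo[ :> set R.
  apply/seteqP; split => x /=; rewrite !in_itv/= ?andbT.
    by move=> xg0; case: (ltP x r0) => _; [left; rewrite xg0|right].
  by case=> [/andP[]//|/(le_trans (ltW r00))].
rewrite split_dom ge0_integral_setU//=; last 2 first.
- by apply: measurable_funTS; exact: ccdf_measurable.
- apply/disj_setPS => x /= []; rewrite !in_itv/= andbT => /andP[_ x1] /(lt_le_trans x1).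
  by rewrite ltxx.
rewrite EFinD; apply: leeD.
- apply: (@le_trans _ _ (\int[lebesgue_measure]_(x in `[0%R, r0[) (cst 1%E x))%E).
    by apply: ge0_le_integral_gen => x _ //=; exact: probability_le1.
  rewrite integral_cst//= mul1e lebesgue_measure_itv/= lte_fin r00.
  by rewrite oppr0 adde0.
- have r1 : 1 < sg / s by apply: lt_le_trans sg1; rewrite ltrDl.
  apply: (@le_trans _ _ (Q * (r0 `^ (1 - sg / s) / (sg / s - 1)))%:E).
    apply: (@integral_le_cst _ _ R lebesgue_measure _ _
      (fun x : R => (x `^ (- (sg / s)))%:E)) => //.
    + by apply: measurableT_comp => //; exact: measurable_powR_fun.
    + by move=> x _; rewrite lee_fin powR_ge0.
    + move=> r; rewrite /= in_itv/= andbT => rr0.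
      have rg0 : 0 < r by exact: lt_le_trans rr0.
      pose x := r `^ (- s^-1); have xg0 : 0 < x by rewrite powR_gt0.
      have xs : x `^ (- s) = r.
        by rewrite -powRrM mulrNN mulVf ?gt_eqF// powRr1// ltW.
      have xsg : x `^ sg = r `^ (- (sg / s)).
        by rewrite -powRrM mulNr mulrC.
      have xx0 : x <= x0.
        have -> : x0 = r0 `^ (- s^-1).
          by rewrite -powRrM mulrNN mulfV ?gt_eqF// powRr1// ltW.
        rewrite /x !powRN lef_pV2 ?posrE ?powR_gt0//.
        by apply: ge0_ler_powR; rewrite ?nnegrE ?invr_ge0 ?(ltW s0) ?(ltW rg0) ?(ltW r00).
      have := hV x; rewrite xg0/= (le_trans xx0 x02) xsg => /(_ isT) h.
      rewrite -EFinM; apply: le_trans h; rewrite /ccdf /distribution /pushforward.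
      apply: le_measure; rewrite ?inE.
      * by apply: measurable_funPTI; exact: measurable_itv.
      * rewrite -[X in measurable X]setTI; exact: (@measurable_fun_le _ _ R setT V (fun=> x)).
      * move=> w /=; rewrite in_itv/= andbT => Xr.
        rewrite leNgt; apply/negP => xV; move: Xr; apply/negP; rewrite -leNgt.
        rewrite -xs !powRN lef_pV2 ?posrE ?powR_gt0//.
        by apply: ge0_ler_powR; rewrite ?nnegrE ?(ltW s0) ?(ltW xg0) ?(ltW (V0 w)) ?(ltW xV).
    + by rewrite integral_powR_tail.
  rewrite lee_fin -mulrA ler_wpM2l// mulrC.
  have -> : r0 `^ (1 - sg / s) = x0 `^ (sg - s).
    by rewrite /r0 -powRrM; congr (_ `^ _); field; rewrite gt_eqF.
  rewrite ler_wpM2r ?powR_ge0// lef_pV2 ?posrE ?subr_gt0//; lra.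
Qed.

End moments.

(** * Bounds on the evidence of a model *)

Section half_power.
Context (R : realType) (r : nat).

(* s^(r + 1/2), the growth in s of the mass of one coordinate of [prior_core s]. *)
Definition hpow (s : R) : R := s ^+ r * Num.sqrt s.

Lemma hpow_gt0 s : 0 < s -> 0 < hpow s.
Proof. by move=> s0; rewrite mulr_gt0 ?exprn_gt0 ?sqrtr_gt0. Qed.

Lemma hpowM s t : 0 <= s -> hpow (s * t) = hpow s * hpow t.
Proof. by move=> s0; rewrite /hpow exprMn sqrtrM// mulrACA. Qed.

Lemma hpowE s : 0 <= s -> hpow s = s `^ (r%:R + 1 / 2).
Proof.
move=> s0; rewrite powRD; last first.
  by apply/implyP; rewrite gt_eqF// ltr_wpDl// divr_gt0.
by rewrite /hpow powR_mulrn// div1r powR12_sqrt.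
Qed.

Lemma ler_hpow s t : 0 <= s -> s <= t -> hpow s <= hpow t.
Proof.
move=> s0 st; apply: ler_pM; rewrite ?exprn_ge0 ?sqrtr_ge0 ?ler_wsqrtr//.
by apply: lerXn2r => //; rewrite nnegrE// (le_trans s0).
Qed.

Lemma hpow_exp_powR s (k : nat) : 0 <= s -> hpow s ^+ k = s `^ ((r%:R + 1 / 2) * k%:R).
Proof. by move=> s0; rewrite powRrM -hpowE// powR_mulrn// mulr_ge0 ?exprn_ge0 ?sqrtr_ge0. Qed.

End half_power.

Section prior_normalization.
Context (R : realType) (k r : nat) (A : 'M[R]_k) (a1 a2 : R).
Hypotheses (a10 : 0 < a1) (a20 : 0 < a2) (detA : 0 < \det A)
  (hA : forall b : 'cV[R]_k, a1 * sqn b <= (b^T *m A *m b) 0 0 <= a2 * sqn b).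

(** The part of [pmom_kernel] that depends on [b], with [s] standing for [tau * v]. *)
Definition prior_core (s : R) (b : 'cV[R]_k) : R :=
  expR (- ((b^T *m A *m b) 0 0) / (2 * s)) * \prod_(i < k) (b i 0) ^+ (2 * r).

Lemma prior_core_ge0 s b : 0 <= prior_core s b.
Proof.
rewrite mulr_ge0 ?expR_ge0// prodr_ge0// => i _.
by rewrite exprM exprn_ge0// sqr_ge0.
Qed.

Definition prior_mass (s : R) : R :=
  fine (integral_Rn (fun b : k.-tuple R => (prior_core s (col_of_tuple b))%:E)).

Definition prior_mass_lb : R := expR (- 4) * hpow r (2 / a2).
Definition prior_mass_ub : R := moment_const R r * hpow r (2 / a1).

(** Replacing the quadratic form of [A] by [a2 |b|^2] or [a1 |b|^2] decouples the coordinates, each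
    of which contributes a Gaussian moment. *)
Lemma prior_mass_bounds s : 0 < s ->
  (((prior_mass_lb * hpow r s) ^+ k)%R%:E <=
   integral_Rn (fun b : k.-tuple R => (prior_core s (col_of_tuple b))%:E) <=
   ((prior_mass_ub * hpow r s) ^+ k)%R%:E)%E.
Proof.
move=> s0; have s20 : 0 < 2 * s by rewrite mulr_gt0.
have sqrE (b : k.-tuple R) : sqn (col_of_tuple b) = \sum_(i < k) tnth b i ^+ 2.
  by apply: eq_bigr => i _; rewrite mxE.
have hsq (a : R) : 0 < a -> 0 < a / (2 * s) by move=> a0; rewrite divr_gt0.
have mf a : measurable_fun setT (fun x : R => expR (- (a * x ^+ 2)) * x ^+ (2 * r)).
  apply: measurable_funM => //; apply: measurableT_comp => //.
  by apply: measurableT_comp => //; apply: measurable_funM.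
have f0 a x : 0 <= expR (- (a * x ^+ 2)) * x ^+ (2 * r) :> R.
  by rewrite mulr_ge0 ?expR_ge0// exprM exprn_ge0// sqr_ge0.
have prodE a (b : k.-tuple R) : 1 * \prod_(i < k) (expR (- (a / (2 * s) * tnth b i ^+ 2)) * tnth b i ^+ (2 * r)) =
    expR (- (a * sqn (col_of_tuple b)) / (2 * s)) * \prod_(i < k) (col_of_tuple b i 0) ^+ (2 * r).
  rewrite mul1r big_split/= -expR_sum sumrN -mulr_sumr -sqrE; congr (expR _ * _).
    by field; rewrite gt_eqF.
  by apply: eq_bigr => i _; rewrite mxE.
have pr0 (b : k.-tuple R) : 0 <= \prod_(i < k) (col_of_tuple b i 0) ^+ (2 * r).
  by rewrite prodr_ge0// => i _; rewrite exprM exprn_ge0// sqr_ge0.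
have ub1 a : 0 < a -> (\int[lebesgue_measure]_x (expR (- (a * x ^+ 2)) * x ^+ (2 * r))%:E <=
    (moment_const R r * hpow r a^-1)%:E)%E.
  move=> a0; have := gauss_moment_ub r 0 a0.
  rewrite expr0n/= add0r /hpow sqrtrV ?(ltW a0)// mulrA.
  by under eq_integral do rewrite subr0.
apply/andP; split.
- rewrite -[leLHS]mul1e -EFinM.
  apply: (@integral_Rn_ge_prod _ _ _ _ _ (fun=> fun x => expR (- (a2 / (2 * s) * x ^+ 2)) * x ^+ (2 * r))) => //.
  + by rewrite mulr_ge0 ?ltW ?hpow_gt0// mulr_gt0 ?expR_gt0 ?hpow_gt0// divr_gt0.
  + move=> _; have := gauss_moment_lb0 r (hsq _ a20).
    rewrite -mulrA -[(Num.sqrt _)^-1]sqrtrV ?(ltW (hsq _ a20))// -/(hpow _ _).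
    have -> : (a2 / (2 * s))^-1 = 2 / a2 * s by field; rewrite !gt_eqF.
    by rewrite hpowM ?divr_ge0 ?(ltW a10) ?(ltW a20)// mulrA.
  + by move=> _; apply: le_lt_trans (ub1 _ (hsq _ a20)) _; exact: ltry.
  + move=> b; rewrite lee_fin prodE /prior_core ler_wpM2r// ler_expR.
    rewrite !mulNr lerN2 ler_wpM2r ?invr_ge0 ?(ltW s20)//.
    by have /andP[] := hA (col_of_tuple b).
- rewrite -[leRHS]mul1e -EFinM.
  apply: (@integral_Rn_le_prod _ _ _ _ _ (fun=> fun x => expR (- (a1 / (2 * s) * x ^+ 2)) * x ^+ (2 * r))) => //.
  + move=> _; apply: (le_trans (ub1 _ (hsq _ a10))).
    have -> : (a1 / (2 * s))^-1 = 2 / a1 * s by field; rewrite !gt_eqF.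
    by rewrite hpowM ?divr_ge0 ?(ltW a10) ?(ltW a20)// mulrA.
  + by move=> b; rewrite lee_fin prior_core_ge0.
  + move=> b; rewrite lee_fin prodE /prior_core ler_wpM2r// ler_expR.
    rewrite !mulNr lerN2 ler_wpM2r ?invr_ge0 ?(ltW s20)//.
    by have /andP[] := hA (col_of_tuple b).
Qed.

Lemma prior_mass_lb_gt0 : 0 < prior_mass_lb.
Proof. by rewrite mulr_gt0 ?expR_gt0 ?hpow_gt0// divr_gt0. Qed.

Lemma prior_mass_ub_gt0 : 0 < prior_mass_ub.
Proof. by rewrite mulr_gt0 ?moment_const_gt0 ?hpow_gt0// divr_gt0. Qed.

Lemma prior_mass_fin s : 0 < s ->
  integral_Rn (fun b : k.-tuple R => (prior_core s (col_of_tuple b))%:E) = (prior_mass s)%:E.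
Proof.
move=> s0; rewrite fineK// ge0_fin_numE; last first.
  by apply: integral_Rn_ge0 => b; rewrite lee_fin prior_core_ge0.
by have /andP[_ h] := prior_mass_bounds s0; apply: le_lt_trans h (ltry _).
Qed.

Lemma prior_mass_ge s : 0 < s -> (prior_mass_lb * hpow r s) ^+ k <= prior_mass s.
Proof.
by move=> s0; rewrite -lee_fin -prior_mass_fin//; have /andP[] := prior_mass_bounds s0.
Qed.

Lemma prior_mass_le s : 0 < s -> prior_mass s <= (prior_mass_ub * hpow r s) ^+ k.
Proof.
by move=> s0; rewrite -lee_fin -prior_mass_fin//; have /andP[] := prior_mass_bounds s0.
Qed.

Lemma prior_mass_gt0 s : 0 < s -> 0 < prior_mass s.
Proof.
move=> s0; apply: lt_le_trans (prior_mass_ge s0).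
by rewrite exprn_gt0// mulr_gt0 ?prior_mass_lb_gt0// hpow_gt0.
Qed.

Lemma measurable_quadratic_form d (U : measurableType d) (f : U -> 'cV[R]_k) :
  measurable_col f -> measurable_fun setT (fun u => ((f u)^T *m A *m f u) 0 0).
Proof.
move=> mf.
have -> : (fun u => ((f u)^T *m A *m f u) 0 0) = (fun u => \sum_i f u i 0 * (A *m f u) i 0).
  by apply/funext => u; rewrite -mulmxA mxE; apply: eq_bigr => i _; rewrite mxE.
apply: measurable_sum => i; apply: measurable_funM => //.
exact: measurable_col_mulmx.
Qed.

Lemma measurable_prior_core d (U : measurableType d) (s : U -> R) (f : U -> 'cV[R]_k) :
  measurable_fun setT s -> measurable_col f ->
  measurable_fun setT (fun u => prior_core (s u) (f u)).
Proof.
move=> ms mf; apply: measurable_funM.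
  apply: measurableT_comp => //; apply: measurable_funM.
    by apply: measurableT_comp => //; exact: measurable_quadratic_form.
  by apply: measurable_funV; exact: measurable_funM.
apply: measurable_prod => i _; exact: measurable_funX.
Qed.

Lemma integral_RnZl (k' : nat) (c : R) (f : k'.-tuple R -> R) : 0 <= c ->
  measurable_fun setT f -> (forall b, 0 <= f b) ->
  (integral_Rn (fun b => (c * f b)%:E) = c%:E * integral_Rn (fun b => (f b)%:E))%E.
Proof.
move=> c0; elim: k' f => [|k' IH] f mf f0 /=; first by rewrite EFinM.
rewrite -ge0_integralZl_EFin//; last 2 first.
- by move=> x _; apply: integral_Rn_ge0 => b; rewrite lee_fin.
- apply: (@measurable_integral_Rn _ _ _ _ (fun z : R * k'.-tuple R => (f [tuple of z.1 :: z.2])%:E)).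
    apply/measurable_EFinP; apply: (measurableT_comp mf).
    exact: measurable_cons.
  by move=> z; rewrite lee_fin.
apply: eq_integral => x _; apply: (IH (fun b => f [tuple of x :: b])) => //.
by apply: (measurableT_comp mf); exact: measurable_cons.
Qed.

(** The determinant and the powers of [tau * v] also occur in the normalizing constant and cancel;
    only the mass of [prior_core] has to be estimated. *)
Lemma pmom_pdfE tau v b : 0 < tau -> 0 < v ->
  pmom_pdf r A tau v b = prior_core (tau * v) b / prior_mass (tau * v).
Proof.
move=> t0 v0; have s0 : 0 < tau * v by rewrite mulr_gt0.
pose kap : R := (2 * pi) `^ (- (k%:R / 2)) * (tau * v) `^ (- (r * k)%:R - k%:R / 2) *
  Num.sqrt (\det A).
have kap0 : 0 < kap by rewrite !mulr_gt0 ?powR_gt0 ?sqrtr_gt0// mulr_gt0 ?pi_gt0.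
have kE c : pmom_kernel r A tau v c = kap * prior_core (tau * v) c.
  by rewrite /pmom_kernel /prior_core /kap !mulrA.
rewrite /pmom_pdf /pmom_const kE.
under eq_integral_Rn do rewrite kE.
rewrite integral_RnZl ?(ltW kap0)//; last 2 first.
- by apply: measurable_prior_core => //; exact: measurable_col_of_tuple.
- by move=> c; exact: prior_core_ge0.
rewrite prior_mass_fin// -EFinM/=.
by field; rewrite !gt_eqF// prior_mass_gt0.
Qed.

End prior_normalization.

Ltac positivity :=
  lazymatch goal with
  | |- is_true (0 < _ * _) => apply: mulr_gt0; positivity
  | |- is_true (0 <= _ * _) => apply: mulr_ge0; positivity
  | |- is_true (0 < _^-1) => rewrite invr_gt0; positivity
  | |- is_true (0 <= _^-1) => rewrite invr_ge0; positivity
  | |- is_true (0 < _ ^+ _) => apply: exprn_gt0; positivity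
  | |- is_true (0 <= _ ^+ 2) => apply: sqr_ge0
  | |- is_true (0 <= _ ^+ (2 * _)) => rewrite exprM; apply: exprn_ge0; apply: sqr_ge0
  | |- is_true (0 <= _ ^+ _) => apply: exprn_ge0; positivity
  | |- is_true (0 < _ `^ _) => apply: powR_gt0; positivity
  | |- is_true (0 <= _ `^ _) => apply: powR_ge0
  | |- is_true (0 < expR _) => apply: expR_gt0
  | |- is_true (0 <= expR _) => apply: expR_ge0
  | |- is_true (0 < Num.sqrt _) => rewrite sqrtr_gt0; positivity
  | |- is_true (0 <= Num.sqrt _) => apply: sqrtr_ge0
  | |- is_true (0 < hpow _ _) => apply: hpow_gt0; positivity
  | |- is_true (0 <= hpow _ _) => apply: mulr_ge0; [apply: exprn_ge0; positivity | apply: sqrtr_ge0]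
  | |- is_true (0 < pi) => apply: pi_gt0
  | |- is_true (0 <= pi) => apply: pi_ge0
  | |- is_true (0 <= sqn _) => apply: sqn_ge0
  | |- is_true (0 <= rss _ _) => apply: rss_ge0
  | |- is_true (0 <= igamma_fun _ _ _) => apply: igamma_fun_ge0
  | |- is_true (0 <= _ + _) => apply: addr_ge0; positivity
  | |- is_true (0 < _ + _) =>
      first [ apply: addr_gt0; positivity | apply: ltr_wpDl; positivity
            | apply: ltr_wpDr; positivity ]
  | |- is_true (0 < moment_const _ _) => apply: moment_const_gt0
  | |- is_true (0 < prior_mass_lb _ _) => apply: prior_mass_lb_gt0; positivity
  | |- is_true (0 < prior_mass_ub _ _) => apply: prior_mass_ub_gt0; positivity
  | |- is_true (0 < Gamma _) => apply: Gamma_gt0; positivity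
  | |- is_true (0 < igamma1 _) => apply: igamma1_gt0; positivity
  | |- _ => first [ assumption | apply: ltW; assumption | done | rewrite ltr0n; done
                  | apply: ltW; progress positivity_strict ]
  end
with positivity_strict := lazymatch goal with
  | |- is_true (0 < moment_const _ _) => positivity
  | |- is_true (0 < prior_mass_lb _ _) => positivity
  | |- is_true (0 < prior_mass_ub _ _) => positivity
  | |- is_true (0 < Gamma _) => positivity
  | |- is_true (0 < igamma1 _) => positivity
  end.

Section marginal_bounds.
Context (R : realType) (n k r : nat) (Z : 'M[R]_(n, k)) (A : 'M[R]_k) (y : 'cV[R]_n)
  (alpha1 alpha2 a1 a2 m0 : R).
Hypotheses (n0 : (0 < n)%N) (alpha10 : 0 < alpha1) (alpha20 : 0 < alpha2)
  (a10 : 0 < a1) (a20 : 0 < a2) (m00 : 0 < m0) (detA : 0 < \det A)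
  (hA : forall b : 'cV[R]_k, a1 * sqn b <= (b^T *m A *m b) 0 0 <= a2 * sqn b)
  (hm : forall b, m0 * sqn b <= sqn (Z *m b)).

Definition joint_density (tau v : R) (b : 'cV[R]_k) : R :=
  likelihood Z y b v * pmom_pdf r A tau v b *
  inv_gamma_pdf (1 / 2) (n%:R / 2) tau * inv_gamma_pdf alpha1 alpha2 v.

Definition evidence : \bar R :=
  (\int[lebesgue_measure]_(tau in `]0%R, +oo[)
   \int[lebesgue_measure]_(v in `]0%R, +oo[)
     integral_Rn (fun b : k.-tuple R => (joint_density tau v (col_of_tuple b))%:E))%E.

(** Constants shared by all models, which cancel in evidence ratios. *)
Definition prior_scale : R :=
  (2 * pi) `^ (- (n%:R / 2)) * ((n%:R / 2) `^ (1 / 2) / Gamma (1 / 2)) *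
  (alpha2 `^ alpha1 / Gamma alpha1).

Let N : R := n%:R / 2 + alpha1.
Let B : R := rss Z y / 2 + alpha2.

Lemma prior_scale_gt0 : 0 < prior_scale.
Proof.
by rewrite /prior_scale; positivity.
Qed.

Lemma joint_densityE tau v b : 0 < tau -> 0 < v ->
  joint_density tau v b = prior_scale * igamma_fun (1 / 2) (n%:R / 2) tau *
    igamma_fun N alpha2 v * expR (- (sqn (y - Z *m b) / (2 * v))) *
    (prior_core r A (tau * v) b / prior_mass r A (tau * v)).
Proof.
move=> t0 v0; rewrite /joint_density (pmom_pdfE r a10 a20 detA hA)//.
rewrite /likelihood -/(sqn _) /inv_gamma_pdf /igamma_fun /prior_scale.
rewrite powRM ?(ltW v0) ?mulr_ge0 ?pi_ge0//.
have -> : v `^ (- (N + 1)) = v `^ (- (n%:R / 2)) * v `^ (- (alpha1 + 1)).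
  rewrite -powRD; first by congr (_ `^ _); rewrite /N; ring.
  by apply/implyP => _; exact: lt0r_neq0.
rewrite mulNr; move: (prior_core _ _ _ _ / _) => c.
move: (v `^ _) (v `^ _) (expR _) (expR _) (expR _) (tau `^ _) ((2 * pi) `^ _) (_ / Gamma _) (_ / Gamma _).
by move=> *; ring.
Qed.

Lemma joint_density_ge0 tau v b : 0 < tau -> 0 < v -> 0 <= joint_density tau v b.
Proof.
move=> t0 v0; rewrite joint_densityE//.
have := prior_scale_gt0; have := prior_core_ge0 r A (tau * v) b.
have : 0 < prior_mass r A (tau * v) by apply: prior_mass_gt0 a10 a20 hA _ _; rewrite mulr_gt0.
by move=> *; positivity.
Qed.

(* [u + 2 <= N (1 + u / N)] for [N >= 2], and [1 + s <= exp s] *)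
Lemma residual_ratio_le (q v : R) (a : nat) : 2 <= N -> 0 <= q -> 0 < v ->
  (q / v + 2) ^+ a <= ((q / B + 1) * N) ^+ a * expR (a%:R * B / (v * N)).
Proof.
move=> N2 q0 v0.
have N0 : 0 < N by apply: lt_le_trans N2.
have B0 : 0 < B by rewrite ltr_wpDl// divr_ge0// rss_ge0.
have -> : expR (a%:R * B / (v * N)) = expR (B / (v * N)) ^+ a.
  by rewrite -expRM_natl mulrA.
rewrite -exprMn; apply: lerXn2r; rewrite ?nnegrE.
- by rewrite addr_ge0// divr_ge0// ltW.
- by rewrite !mulr_ge0 ?expR_ge0 ?addr_ge0 ?divr_ge0// ltW.
apply: (@le_trans _ _ ((q / B + 1) * N * (1 + B / (v * N)))); last first.
  rewrite ler_wpM2l ?expR_ge1Dx//.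
  by rewrite !mulr_ge0 ?addr_ge0 ?divr_ge0// ltW.
have -> : (q / B + 1) * N * (1 + B / (v * N)) = q / v + N + q / B * N + B / v.
  by field; rewrite !gt_eqF.
have : 0 <= q / B * N by positivity.
have : 0 <= B / v by positivity.
lra.
Qed.

Definition evidence_ub_const : R :=
  moment_const R r * Num.sqrt 2 / prior_mass_lb r a2.

Lemma evidence_ub_const_gt0 : 0 < evidence_ub_const.
Proof.
by rewrite /evidence_ub_const; positivity.
Qed.

Let hr : R := r%:R + 1 / 2.

(** The prior exponential is dropped, and [lsq_pythagoras] with [hm] leaves independent Gaussians
    centred at the least squares estimate, whose squared norm is at most [|y|^2 / m0]. Their moments
    produce [(|y|^2 / v + 2) ^ (r k)], which depends on [v]; [residual_ratio_le] trades it for a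
    constant and a factor [exp (r k B / (v N))], which merely lowers the inverse-gamma scale. *)
Lemma integral_joint_density_le tau v : 2 <= N -> 0 < tau -> 0 < v ->
  (integral_Rn (fun b : k.-tuple R => (joint_density tau v (col_of_tuple b))%:E) <=
   (prior_scale * (evidence_ub_const * (((sqn y / B + 1) * N) ^+ r) / hpow r m0) ^+ k *
    igamma_fun (1 / 2 + hr * k%:R) (n%:R / 2) tau *
    igamma_fun N (B * (1 - (r * k)%:R / N)) v)%:E)%E.
Proof.
move=> N2 t0 v0.
have N0 : 0 < N by apply: lt_le_trans N2.
have B0 : 0 < B by rewrite ltr_wpDl// divr_ge0// rss_ge0.
have s0 : 0 < tau * v by rewrite mulr_gt0.
have v20 : 0 < 2 * v by rewrite mulr_gt0.
pose c := prior_scale * igamma_fun (1 / 2) (n%:R / 2) tau * igamma_fun N alpha2 v *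
   expR (- (rss Z y / (2 * v))) / (prior_mass_lb r a2 * hpow r (tau * v)) ^+ k.
pose bh := lsq Z *m y.
pose M := moment_const R r * (sqn bh + (m0 / (2 * v))^-1) ^+ r / Num.sqrt (m0 / (2 * v)).
have lb0 : 0 < prior_mass_lb r a2 * hpow r (tau * v).
  by rewrite mulr_gt0 ?prior_mass_lb_gt0 ?hpow_gt0.
have c0 : 0 <= c.
  by have := prior_scale_gt0; rewrite /c => ?; positivity.
have mv0 : 0 < m0 / (2 * v) by rewrite divr_gt0.
apply: (@le_trans _ _ (c * M ^+ k)%:E).
  apply: (@integral_Rn_le_prod _ _ _ _ _
    (fun i x => expR (- (m0 / (2 * v) * (x - bh i 0) ^+ 2)) * x ^+ (2 * r))) => //.
  - by move=> i x; rewrite mulr_ge0 ?expR_ge0// exprM exprn_ge0// sqr_ge0.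
  - move=> i; apply: measurable_funM => //; apply: measurableT_comp => //.
    apply: measurableT_comp => //; apply: measurable_funM => //.
    by apply: measurable_funX; apply: measurable_funB.
  - move=> i; apply: le_trans (gauss_moment_ub r (bh i 0) mv0) _.
    rewrite lee_fin /M ler_wpM2r ?invr_ge0 ?sqrtr_ge0// ler_wpM2l ?(ltW (moment_const_gt0 _ _))//.
    apply: lerXn2r; rewrite ?nnegrE ?addr_ge0 ?sqr_ge0 ?sqn_ge0 ?invr_ge0 ?(ltW mv0)//.
    by rewrite lerD2r sqn_coord.
  - by move=> b; rewrite lee_fin joint_density_ge0.
  - move=> b; rewrite lee_fin joint_densityE// /c; set u := col_of_tuple b.
    have -> : \prod_(i < k) (expR (- (m0 / (2 * v) * (tnth b i - bh i 0) ^+ 2)) * tnth b i ^+ (2 * r)) =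
        expR (- (m0 * sqn (u - bh) / (2 * v))) * \prod_(i < k) (u i 0) ^+ (2 * r).
      rewrite big_split/= -expR_sum sumrN -mulr_sumr; congr (expR (- _) * _).
        rewrite [RHS]mulrAC; congr (_ * _); apply: eq_bigr => i _.
        by rewrite !mxE.
      by apply: eq_bigr => i _; rewrite mxE.
    rewrite (lsq_pythagoras m00 hm) mulrDl opprD expRD.
    have J0 : 0 < prior_mass r A (tau * v) by apply: (prior_mass_gt0 r a10 a20 hA).
    have hq : prior_core r A (tau * v) u / prior_mass r A (tau * v) <=
        \prod_(i < k) (u i 0) ^+ (2 * r) / (prior_mass_lb r a2 * hpow r (tau * v)) ^+ k.
      apply: ler_pM; rewrite ?prior_core_ge0 ?invr_ge0 ?(ltW J0)//.
        rewrite /prior_core -[leRHS]mul1r ler_wpM2r//.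
          by apply: prodr_ge0 => i _; positivity.
        rewrite expR_le1 mulNr oppr_le0; have /andP[+ _] := hA u.
        by move/(le_trans _) => h; apply: divr_ge0; [apply: h|]; positivity.
      rewrite lef_pV2 ?posrE// ?(prior_mass_ge r a10 a20 hA s0)//.
      by positivity.
    have he : expR (- (sqn (Z *m (u - bh)) / (2 * v))) <= expR (- (m0 * sqn (u - bh) / (2 * v))).
      by rewrite ler_expR lerN2 ler_wpM2r ?hm// invr_ge0 ltW.
    have q0 : 0 <= prior_core r A (tau * v) u / prior_mass r A (tau * v).
      by rewrite divr_ge0 ?prior_core_ge0// ltW.
    have := ler_pM (expR_ge0 _) q0 he hq.
    have : 0 <= prior_scale * igamma_fun (1 / 2) (n%:R / 2) tau * igamma_fun N alpha2 v *
      expR (- (rss Z y / (2 * v))) by have := prior_scale_gt0 => ?; positivity.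
    move=> X0 /(ler_wpM2l X0).
    rewrite -/bh; move: (expR _) (expR _) (expR _) (\prod_(i < k) _) ((_ ^+ k)^-1) (prior_core _ _ _ _ / _).
    by move: (prior_scale * _ * _) => *; lra.
rewrite lee_fin.
pose q : R := sqn y / v + 2.
have Mle : M <= prior_mass_lb r a2 * hpow r (tau * v) *
    (evidence_ub_const / (hpow r m0 * hpow r tau) * q ^+ r).
  have -> : prior_mass_lb r a2 * hpow r (tau * v) *
      (evidence_ub_const / (hpow r m0 * hpow r tau) * q ^+ r) =
      moment_const R r * (v / m0 * q) ^+ r / Num.sqrt (m0 / (2 * v)).
    rewrite hpowM ?(ltW t0)// /evidence_ub_const {2 3}/hpow.
    rewrite !sqrtrM ?(ltW m00)// sqrtrV ?(ltW v20)// sqrtrM// !exprMn !exprVn.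
    have : prior_mass_lb r a2 != 0 by rewrite lt0r_neq0//; positivity.
    have : hpow r tau != 0 by rewrite lt0r_neq0//; positivity.
    have : Num.sqrt v != 0 by rewrite lt0r_neq0//; positivity.
    have : Num.sqrt m0 != 0 by rewrite lt0r_neq0//; positivity.
    have : m0 ^+ r != 0 by rewrite lt0r_neq0//; positivity.
    have : Num.sqrt 2 != 0 :> R by rewrite lt0r_neq0//; positivity.
    move: (Num.sqrt m0) (Num.sqrt v) (hpow r tau) (prior_mass_lb r a2) (m0 ^+ r) (v ^+ r) (Num.sqrt 2) (moment_const R r) (q ^+ r) => ? ? ? ? ? ? ? ? ? *.
    field; do ?[apply/andP; split] => //.
  rewrite /M ler_wpM2r ?invr_ge0 ?sqrtr_ge0// ler_wpM2l ?(ltW (moment_const_gt0 _ _))//.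
  apply: lerXn2r; rewrite ?nnegrE; try by positivity.
    by rewrite /q; positivity.
  have -> : v / m0 * q = sqn y / m0 + (m0 / (2 * v))^-1.
    by rewrite /q; field; rewrite !gt_eqF.
  rewrite lerD2r ler_pdivlMr// mulrC; apply: le_trans (sqn_lsq_le m00 hm y) _.
  by rewrite gerBl rss_ge0.
have M0 : 0 <= M by rewrite /M; have := moment_const_gt0 R r => ?; positivity.
have Mk : M ^+ k <= (prior_mass_lb r a2 * hpow r (tau * v) *
    (evidence_ub_const / (hpow r m0 * hpow r tau) * q ^+ r)) ^+ k.
  by apply: lerXn2r; rewrite ?nnegrE// (le_trans M0).
apply: (le_trans (ler_wpM2l c0 Mk)).
have := @residual_ratio_le (sqn y) v (r * k)%N N2 (sqn_ge0 _) v0.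
rewrite -/q => hq.
have C0 := evidence_ub_const_gt0; have K0 := prior_scale_gt0.
apply: (@le_trans _ _ (c * (prior_mass_lb r a2 * hpow r (tau * v)) ^+ k *
    (evidence_ub_const / (hpow r m0 * hpow r tau)) ^+ k * (((sqn y / B + 1) * N) ^+ (r * k) *
        expR ((r * k)%:R * B / (v * N))))).
  rewrite [X in c * X <= _]exprMn [X in c * (_ * X) <= _]exprMn -[(q ^+ r) ^+ k]exprM.
  rewrite [leLHS]mulrA [leLHS]mulrA ler_wpM2l//.
  by positivity.
rewrite /c mulfVK; last by rewrite lt0r_neq0//; positivity.
have -> : igamma_fun (1 / 2 + hr * k%:R) (n%:R / 2) tau =
    igamma_fun (1 / 2) (n%:R / 2) tau / hpow r tau ^+ k.
  rewrite /igamma_fun hpow_exp_powR ?(ltW t0)// -powRN mulrAC -powRD; last first.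
    by apply/implyP => _; exact: lt0r_neq0.
  by congr (_ `^ _ * _); rewrite /hr; ring.
have -> : igamma_fun N (B * (1 - (r * k)%:R / N)) v =
    igamma_fun N alpha2 v * expR (- (rss Z y / (2 * v))) * expR ((r * k)%:R * B / (v * N)).
  rewrite /igamma_fun -!mulrA -!expRD; congr (_ * expR _).
  by rewrite /B; field; rewrite !gt_eqF.
have : hpow r tau != 0 by rewrite lt0r_neq0//; positivity.
have : hpow r m0 != 0 by rewrite lt0r_neq0//; positivity.
move: (expR _) (expR _) (_ * N : R) evidence_ub_const (hpow r tau) (hpow r m0) => e1 e2 Q C ht h0 t1 t2.
rewrite !exprMn !exprVn !exprMn -!exprM.
have := expf_neq0 k t1; have := expf_neq0 k t2.
move: (ht ^+ k) (h0 ^+ k) (C ^+ k) (Q ^+ _) => *.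
rewrite le_eqVlt; apply/orP; left; apply/eqP.
by field; apply/andP; split.
Qed.

(** The integral over [v] with the lowered scale costs at most [exp (2 r k)]. The integral over
    [tau] gives [(n / 2) ^ (- hr k)] times [igamma1 (1 / 2 + hr k)]; by [igamma1_half] the two
    combine into [hpow r (4 hr k / n) ^ k], where [k / n] is the gain over a crude bound. *)
Lemma evidence_le : 2 <= N -> (r * k)%:R <= N / 2 ->
  (evidence <= (prior_scale * ((n%:R / 2) `^ (- (1 / 2)) * (Num.sqrt 2 * igamma1 (1 / 2)) * igamma1 N) *
   (evidence_ub_const * hpow r (4 * hr * k%:R / n%:R) * (expR 2 * (sqn y / B + 1) * N) ^+ r / hpow r m0) ^+ k *
    B `^ (- N))%:E)%E.
Proof.
move=> N2 rkN.
have N0 : 0 < N by apply: lt_le_trans N2.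
have B0 : 0 < B by rewrite ltr_wpDl// divr_ge0// rss_ge0.
have nn0 : 0 < n%:R :> R by rewrite ltr0n.
have K0 := prior_scale_gt0; have C0 := evidence_ub_const_gt0.
set W := (evidence_ub_const * (((sqn y / B + 1) * N) ^+ r) / hpow r m0) ^+ k.
have W0 : 0 <= W by rewrite /W; positivity.
have hr0 : 0 < hr by rewrite /hr ltr_wpDl.
pose th : R := 1 - (r * k)%:R / N.
have th12 : 1 / 2 <= th.
  rewrite /th lerBrDr -lerBrDl ler_pdivrMr//; lra.
have th0 : 0 < th by apply: lt_le_trans th12.
have Bth0 : 0 < B * th by rewrite mulr_gt0.
pose F tau := prior_scale * W * igamma_fun (1 / 2 + hr * k%:R) (n%:R / 2) tau.
have F0 tau : 0 <= F tau by rewrite /F; positivity.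
have inner tau : 0 < tau ->
  (\int[lebesgue_measure]_(v in `]0%R, +oo[)
     integral_Rn (fun b : k.-tuple R => (joint_density tau v (col_of_tuple b))%:E) <=
   (F tau * ((B * th) `^ (- N) * igamma1 N))%:E)%E.
  move=> t0.
  apply: (@integral_le_cst _ (measurableTypeR R) R lebesgue_measure _ _ (fun v => (igamma_fun N (B * th) v)%:E)) => //.
  - by apply/measurable_EFinP; apply: measurable_funTS; exact: measurable_igamma_fun.
  - by move=> v _; rewrite lee_fin igamma_fun_ge0.
  - move=> v; rewrite /= in_itv/= andbT => v0.
    by apply: integral_Rn_ge0 => b; rewrite lee_fin joint_density_ge0.
  - move=> v; rewrite /= in_itv/= andbT => v0.
    by rewrite -EFinM; exact: integral_joint_density_le.
  - by rewrite -/(igamma N (B * th)) igammaE.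
have ah0 : 0 < 1 / 2 + hr * k%:R by rewrite ltr_pwDl// mulr_ge0// ltW.
apply: (@le_trans _ _ (prior_scale * W * ((B * th) `^ (- N) * igamma1 N) *
    ((n%:R / 2) `^ (- (1 / 2 + hr * k%:R)) * igamma1 (1 / 2 + hr * k%:R)))%:E).
  apply: (@integral_le_cst _ (measurableTypeR R) R lebesgue_measure _ _ (fun tau => (igamma_fun (1 / 2 + hr * k%:R) (n%:R / 2) tau)%:E)) => //.
  - by have := igamma1_gt0 N0 => ?; positivity.
  - by apply/measurable_EFinP; apply: measurable_funTS; exact: measurable_igamma_fun.
  - by move=> v _; rewrite lee_fin igamma_fun_ge0.
  - move=> tau; rewrite /= in_itv/= andbT => t0.
    apply: integral_ge0 => v; rewrite /= in_itv/= andbT => v0.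
    by apply: integral_Rn_ge0 => b; rewrite lee_fin joint_density_ge0.
  - move=> tau; rewrite /= in_itv/= andbT => t0.
    by apply: le_trans (inner _ t0) _; rewrite -EFinM lee_fin /F mulrAC.
  - by rewrite -/(igamma (1 / 2 + hr * k%:R) (n%:R / 2)) igammaE// divr_gt0.
rewrite lee_fin.
have i0 := igamma1_gt0 N0.
have h1 : igamma1 (1 / 2 + hr * k%:R) <= (2 * (hr * k%:R)) `^ (hr * k%:R) * (Num.sqrt 2 * igamma1 (1 / 2)).
  by rewrite addrC; apply: igamma1_half; positivity.
(* [1 / th <= exp (2 (1 - th))] for [th] between 1/2 and 1, and [N (1 - th) = r k]. *)
have h2 : (B * th) `^ (- N) <= B `^ (- N) * expR 2 ^+ (r * k).
  rewrite powRM ?(ltW B0)// ?(ltW th0)// ler_wpM2l ?powR_ge0//.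
  have -> : th `^ (- N) = th^-1 `^ N by rewrite -powR_inv1 ?(ltW th0)// -powRrM mulN1r.
  have hth : th^-1 <= expR (2 * (1 - th)).
    rewrite -[th^-1]mul1r ler_pdivrMr//.
    have h := expR_ge1Dx (2 * (1 - th)).
    have th1 : th <= 1 by rewrite /th lerBlDr lerDl divr_ge0// ltW.
    apply: (@le_trans _ _ ((1 + 2 * (1 - th)) * th)); last by rewrite ler_wpM2r// ltW.
    by clearbody th; move: th th1 th12 {h Bth0 th0 inner} => x; nra.
  apply: (@le_trans _ _ (expR (2 * (1 - th)) `^ N)).
    by apply: ge0_ler_powR; rewrite ?nnegrE ?expR_ge0 ?invr_ge0 ?(ltW N0) ?(ltW th0).
  rewrite -expRM -expRM_natl ler_expR /th le_eqVlt; apply/orP; left; apply/eqP.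
  by field; rewrite gt_eqF.
have h3 : (n%:R / 2) `^ (- (1 / 2 + hr * k%:R)) * (2 * (hr * k%:R)) `^ (hr * k%:R) =
    (n%:R / 2) `^ (- (1 / 2)) * hpow r (4 * hr * k%:R / n%:R) ^+ k :> R.
  rewrite hpow_exp_powR; last by positivity.
  rewrite opprD powRD; last by apply/implyP => _; rewrite lt0r_neq0// divr_gt0.
  rewrite -mulrA; congr (_ * _).
  have -> : 4 * hr * k%:R / n%:R = (n%:R / 2)^-1 * (2 * (hr * k%:R)).
    by field; rewrite gt_eqF.
  rewrite [RHS]powRM; [|by positivity|by positivity].
  by congr (_ * _); rewrite -(@powR_inv1 _ (n%:R / 2)) ?divr_ge0// -powRrM mulN1r.
apply: (@le_trans _ _ (prior_scale * W * ((B `^ (- N) * expR 2 ^+ (r * k)) * igamma1 N) *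
   ((n%:R / 2) `^ (- (1 / 2 + hr * k%:R)) * ((2 * (hr * k%:R)) `^ (hr * k%:R) * (Num.sqrt 2 * igamma1 (1 / 2)))))).
  have i12 : 0 < igamma1 (1 / 2 + hr * k%:R) by exact: igamma1_gt0.
  apply: ler_pM; [by positivity|by positivity| |].
    by rewrite ler_wpM2l ?ler_wpM2r ?(ltW i0)//; positivity.
  by rewrite ler_wpM2l ?powR_ge0.
rewrite [X in _ * X <= _]mulrA h3 /W.
move: (expR 2) (_ + 1 : R) evidence_ub_const (hpow r _) (hpow r m0) => e2 Q C ht h0.
rewrite !exprMn -!exprM.
move: (ht ^+ k) (h0 ^-k ) (C ^+ k) (Q ^+ _) (e2 ^+ _) (N ^+ _) (igamma1 _) (igamma1 _) => *.
rewrite le_eqVlt; apply/orP; left; apply/eqP.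
by ring.
Qed.

Definition evidence_lb_const (bl : R) : R :=
  bl ^+ (2 * r) * Num.sqrt 2 * expR (- 1 - 2 * a2) / prior_mass_ub r a1.

Section lower_bound.
Context (M0 bl bu : R).
Hypotheses (M01 : 1 <= M0) (bl0 : 0 < bl) (hM : forall b, sqn (Z *m b) <= M0 * sqn b)
  (hbh : forall i, bl <= `|(lsq Z *m y) i 0| <= bu).

Let B2 : R := B + k%:R * (a2 * bu ^+ 2 / n%:R).

Lemma evidence_lb_const_gt0 : 0 < evidence_lb_const bl.
Proof. by rewrite /evidence_lb_const; positivity. Qed.

(** For such [tau] the prior exponent is at most [w |b|^2], so coordinates decouple and
    [gauss_moment_lb] applies at estimates between [bl] and [bu]. Each coordinate has Gaussian width
    of order [sqrt v] against a normalization of order [v ^ (r + 1 / 2)]: the shape grows by [r k].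
    The prior exponent at the estimate enlarges the scale to [B2]. *)
Lemma integral_joint_density_ge tau v : n%:R <= tau <= 2 * n%:R -> 0 < v ->
  ((prior_scale * (evidence_lb_const bl / (Num.sqrt M0 * hpow r (2 * n%:R))) ^+ k *
    ((2 * n%:R) `^ (- (3 / 2)) * expR (- (1 / 2))) *
    igamma_fun (N + (r * k)%:R) B2 v)%:E <=
   integral_Rn (fun b : k.-tuple R => (joint_density tau v (col_of_tuple b))%:E))%E.
Proof.
move=> /andP[nt tn] v0.
have nn0 : 0 < n%:R :> R by rewrite ltr0n.
have t0 : 0 < tau by apply: lt_le_trans nt.
have s0 : 0 < tau * v by rewrite mulr_gt0.
have M00 : 0 < M0 by apply: lt_le_trans M01.
have mv0 : 0 < M0 / (2 * v) by positivity.
have K0 := prior_scale_gt0; have C0 := evidence_lb_const_gt0.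
pose L := prior_mass_ub r a1 * hpow r (2 * n%:R * v).
have L0 : 0 < L by rewrite /L; positivity.
pose bh := lsq Z *m y.
pose c := prior_scale * igamma_fun (1 / 2) (n%:R / 2) tau * igamma_fun N alpha2 v *
   expR (- (rss Z y / (2 * v))) / L ^+ k.
have c0 : 0 <= c by rewrite /c; positivity.
pose w : R := a2 / (2 * (n%:R * v)).
have w0 : 0 < w by rewrite /w; positivity.
pose m : R := bl ^+ (2 * r) / Num.sqrt (M0 / (2 * v)) * expR (- 1 - w * (2 * bu ^+ 2 + 2 / (M0 / (2 * v)))).
have m_ge0 : 0 <= m by rewrite /m; positivity.
apply: (@le_trans _ _ (c * m ^+ k)%:E); last first.
  apply: (@integral_Rn_ge_prod _ _ _ _ _
    (fun i x => expR (- (M0 / (2 * v) * (x - bh i 0) ^+ 2) - w * x ^+ 2) * x ^+ (2 * r))) => //.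
  - by move=> i x; positivity.
  - move=> i; apply: measurable_funM => //; apply: measurableT_comp => //.
    apply: measurable_funB; last by apply: measurable_funM => //; exact: measurable_funX.
    apply: measurableT_comp => //; apply: measurable_funM => //.
    by apply: measurable_funX; apply: measurable_funB.
  - move=> i; apply: le_trans (gauss_moment_lb r (bh i 0) mv0 (ltW w0)).
    have /andP[h1 h2] := hbh i.
    have h3 : bl ^+ 2 <= bh i 0 ^+ 2.
      by rewrite -[_ ^+ 2 in leRHS]real_normK ?num_real// lerXn2r// nnegrE// ltW.
    have h4 : bh i 0 ^+ 2 <= bu ^+ 2.
      by rewrite -[_ ^+ 2 in leLHS]real_normK ?num_real// lerXn2r// nnegrE// (le_trans _ h2).
    rewrite lee_fin /m; apply: ler_pM; [by positivity|by positivity| |].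
      rewrite ler_wpM2r ?invr_ge0 ?sqrtr_ge0// !exprM.
      by apply: lerXn2r; rewrite ?nnegrE ?sqr_ge0.
    by rewrite ler_expR lerB// ler_wpM2l ?(ltW w0)// lerD2r ler_wpM2l.
  - move=> i; apply: (@le_lt_trans _ _ (\int[lebesgue_measure]_x
        (expR (- (M0 / (2 * v) * (x - bh i 0) ^+ 2)) * x ^+ (2 * r))%:E)%E).
      apply: ge0_le_integral_gen => x _; rewrite lee_fin; first by positivity.
      rewrite ler_wpM2r ?ler_expR; [by []|by positivity|].
      by rewrite gerBl; positivity.
    by apply: le_lt_trans (gauss_moment_ub r (bh i 0) mv0) (ltry _).
  - move=> b; rewrite lee_fin joint_densityE// /c; set u := col_of_tuple b.
    have -> : \prod_(i < k) (expR (- (M0 / (2 * v) * (tnth b i - bh i 0) ^+ 2) - w * tnth b i ^+ 2) * tnth b i ^+ (2 * r)) =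
        expR (- (M0 * sqn (u - bh) / (2 * v))) * (expR (- (w * sqn u)) * \prod_(i < k) (u i 0) ^+ (2 * r)).
      rewrite big_split/= -expR_sum big_split/= expRD mulrA; congr (expR _ * expR _ * _).
      + rewrite sumrN -mulr_sumr; congr (- _); rewrite [RHS]mulrAC; congr (_ * _).
        by apply: eq_bigr => i _; rewrite !mxE.
      + rewrite sumrN -mulr_sumr; congr (- (_ * _)).
        by apply: eq_bigr => i _; rewrite !mxE.
      + by apply: eq_bigr => i _; rewrite mxE.
    rewrite (lsq_pythagoras m00 hm) (mulrDl (rss Z y)) opprD expRD.
    have J0 : 0 < prior_mass r A (tau * v) by apply: (prior_mass_gt0 r a10 a20 hA).
    have he : expR (- (M0 * sqn (u - bh) / (2 * v))) <= expR (- (sqn (Z *m (u - bh)) / (2 * v))).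
      by rewrite ler_expR lerN2 ler_wpM2r ?hM// invr_ge0; positivity.
    have P0 : 0 <= \prod_(i < k) (u i 0) ^+ (2 * r).
      by apply: prodr_ge0 => i _; positivity.
    have hq : expR (- (w * sqn u)) * \prod_(i < k) (u i 0) ^+ (2 * r) / L ^+ k <=
       prior_core r A (tau * v) u / prior_mass r A (tau * v).
      apply: ler_pM; [by positivity|by positivity| |].
        rewrite /prior_core ler_wpM2r// ler_expR mulNr lerN2.
        apply: (@le_trans _ _ (a2 * sqn u / (2 * (tau * v)))).
          by rewrite ler_wpM2r ?invr_ge0//; [positivity|have /andP[] := hA u].
        rewrite /w [leRHS]mulrAC ler_wpM2l//; first by positivity.
        rewrite lef_pV2 ?posrE; [|by positivity|by positivity].
        by rewrite ler_wpM2l// ler_wpM2r// ltW.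
      rewrite lef_pV2 ?posrE; [|by positivity|by positivity].
      apply: le_trans (prior_mass_le r a10 a20 hA s0) _.
      apply: lerXn2r; rewrite ?nnegrE; [by positivity|by positivity|].
      rewrite /L ler_wpM2l//; first by have := prior_mass_ub_gt0 r a10; positivity.
      by apply: ler_hpow; [positivity|rewrite ler_wpM2r// ltW].
    have q0 : 0 <= expR (- (w * sqn u)) * \prod_(i < k) (u i 0) ^+ (2 * r) / L ^+ k.
      by positivity.
    have := ler_pM (expR_ge0 _) q0 he hq.
    have : 0 <= prior_scale * igamma_fun (1 / 2) (n%:R / 2) tau * igamma_fun N alpha2 v *
      expR (- (rss Z y / (2 * v))) by positivity.
    move=> X0 /(ler_wpM2l X0).
    rewrite -/bh; move: (expR _) (expR _) (expR _) (expR _) (\prod_(i < k) _) ((_ ^+ k)^-1) (prior_core _ _ _ _ / _).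
    by move: (prior_scale * _ * _) => *; lra.
rewrite lee_fin.
pose g : R := a2 * bu ^+ 2 / n%:R.
have n1 : 1 <= n%:R :> R by rewrite (ler_nat R 1 n).
have Lm : evidence_lb_const bl / (Num.sqrt M0 * hpow r (2 * n%:R)) * (v ^- r * expR (- (g / v))) <= m / L.
  rewrite /m /L.
  have -> : bl ^+ (2 * r) / Num.sqrt (M0 / (2 * v)) * expR (- 1 - w * (2 * bu ^+ 2 + 2 / (M0 / (2 * v)))) / (prior_mass_ub r a1 * hpow r (2 * n%:R * v)) =
    bl ^+ (2 * r) * Num.sqrt 2 / (Num.sqrt M0 * hpow r (2 * n%:R)) / prior_mass_ub r a1 * v ^- r * expR (- 1 - w * (2 * bu ^+ 2 + 2 / (M0 / (2 * v)))).
    rewrite hpowM; last by positivity.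
    rewrite {2}/hpow.
    rewrite (sqrtrM _ (ltW M00)) sqrtrV; last by positivity.
    rewrite (sqrtrM v); last by [].
    have : prior_mass_ub r a1 != 0 by rewrite lt0r_neq0//; positivity.
    have : hpow r (2 * n%:R) != 0 :> R by rewrite lt0r_neq0//; positivity.
    have : Num.sqrt v != 0 by rewrite lt0r_neq0//; positivity.
    have : Num.sqrt M0 != 0 by rewrite lt0r_neq0//; positivity.
    have : v ^+ r != 0 by rewrite lt0r_neq0//; positivity.
    have : Num.sqrt 2 != 0 :> R by rewrite lt0r_neq0//; positivity.
    move: (Num.sqrt M0) (Num.sqrt v) (hpow r _) (prior_mass_ub r a1) (v ^+ r) (Num.sqrt 2) (bl ^+ _) (expR _) => ? ? ? ? ? ? ? ? *.
    by field; do ?[apply/andP; split].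
  rewrite /evidence_lb_const.
  have he : expR (- 1 - 2 * a2) * expR (- (g / v)) <= expR (- 1 - w * (2 * bu ^+ 2 + 2 / (M0 / (2 * v)))).
    rewrite -expRD ler_expR.
    have -> : w * (2 * bu ^+ 2 + 2 / (M0 / (2 * v))) = g / v + 2 * a2 / (n%:R * M0).
      by rewrite /w /g; field; rewrite !gt_eqF.
    have : 2 * a2 / (n%:R * M0) <= 2 * a2.
      rewrite ler_pdivrMr; last by positivity.
      rewrite ler_peMr; [by []|by positivity|].
      by rewrite -[leLHS]mulr1 ler_pM.
    by move: (_ / (n%:R * M0)) (g / v) => *; lra.
  have X0 : 0 <= bl ^+ (2 * r) * Num.sqrt 2 / (Num.sqrt M0 * hpow r (2 * n%:R)) / prior_mass_ub r a1 * v ^- r.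
    by positivity.
  move: he => /(ler_wpM2l X0).
  move: (expR _) (expR _) (expR _) (prior_mass_ub _ _)^-1 (_ * hpow _ _)^-1 (v ^- r) (bl ^+ _) (Num.sqrt 2) => *.
  by lra.
have hig : (2 * n%:R) `^ (- (3 / 2)) * expR (- (1 / 2)) <= igamma_fun (1 / 2) (n%:R / 2) tau.
  apply: ler_pM; [by positivity|by positivity| |].
    have -> : 1 / 2 + 1 = 3 / 2 :> R by field.
    rewrite !powRN lef_pV2 ?posrE; [|by positivity|by positivity].
    by apply: ge0_ler_powR => //; rewrite ?nnegrE; positivity.
  rewrite ler_expR mulNr lerN2 ler_pdivrMr//.
  by move: (tau : R) (n%:R : R) nt => a b; lra.
have Lk : (evidence_lb_const bl / (Num.sqrt M0 * hpow r (2 * n%:R)) * (v ^- r * expR (- (g / v)))) ^+ k <= (m / L) ^+ k.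
  by apply: lerXn2r => //; rewrite ?nnegrE; positivity.
apply: (@le_trans _ _ (prior_scale * ((2 * n%:R) `^ (- (3 / 2)) * expR (- (1 / 2))) *
   (igamma_fun N alpha2 v * expR (- (rss Z y / (2 * v))) *
   (evidence_lb_const bl / (Num.sqrt M0 * hpow r (2 * n%:R)) * (v ^- r * expR (- (g / v)))) ^+ k))).
  have -> : igamma_fun (N + (r * k)%:R) B2 v =
      igamma_fun N alpha2 v * expR (- (rss Z y / (2 * v))) * (v ^- r * expR (- (g / v))) ^+ k.
    rewrite exprMn -expRM_natl exprVn -exprM /igamma_fun.
    have -> : v ^- (r * k) = v `^ (- (r * k)%:R) by rewrite powRN powR_mulrn// ltW.
    have -> : - (N + (r * k)%:R + 1) = - (N + 1) + - (r * k)%:R by ring.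
    rewrite powRD; last by apply/implyP => _; exact: lt0r_neq0.
    have -> : expR (- B2 / v) = expR (- alpha2 / v) * expR (- (rss Z y / (2 * v))) * expR (k%:R * - (g / v)).
      rewrite -!expRD; congr expR; rewrite /B2 /B /g.
      by field; rewrite !gt_eqF.
    move: (v `^ _) (v `^ _) (expR _) (expR _) (expR _) => *.
    by ring.
  rewrite [X in _ <= _ * (_ * X)]exprMn.
  rewrite le_eqVlt; apply/orP; left; apply/eqP.
  move: (_ ^+ k) (_ ^+ k) (igamma_fun _ _ _) (expR _) (expR _) (_ `^ _) => *.
  by ring.
have -> : c * m ^+ k = prior_scale * igamma_fun (1 / 2) (n%:R / 2) tau *
   (igamma_fun N alpha2 v * expR (- (rss Z y / (2 * v))) * (m / L) ^+ k).
  rewrite /c [in RHS]exprMn exprVn.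
  move: (m ^+ k) (_ ^- k) (igamma_fun _ _ _) (igamma_fun _ _ _) (expR _) => *.
  by ring.
apply: ler_pM; [by positivity| |by rewrite ler_wpM2l// ltW|].
  by positivity.
by rewrite ler_wpM2l//; positivity.
Qed.

(** [tau] is restricted to an interval of length [n], the order of magnitude of its prior scale;
    [igamma1_addn] undoes the shift of the shape. The factor [(n / 2) ^ (-1/2)] is displayed so as
    to cancel with the one in [evidence_le]. *)
Lemma evidence_ge : 1 <= N ->
  ((prior_scale * ((n%:R / 2) `^ (- (1 / 2)) * (expR (- (1 / 2)) / 4) * igamma1 N) *
   (evidence_lb_const bl / (Num.sqrt M0 * hpow r (2 * n%:R)) * (N / 3 / B2) ^+ r) ^+ k *
    B2 `^ (- N))%:E <= evidence)%E.
Proof.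
move=> N1.
have nn0 : 0 < n%:R :> R by rewrite ltr0n.
have N0 : 0 < N by apply: lt_le_trans N1.
have B20 : 0 < B2.
  rewrite /B2 ltr_pwDl//; last by positivity.
  by rewrite ltr_wpDl// divr_ge0// rss_ge0.
have K0 := prior_scale_gt0; have C0 := evidence_lb_const_gt0.
have M00 : 0 < M0 by apply: lt_le_trans M01.
have i0 := igamma1_gt0 N0.
set W := (evidence_lb_const bl / (Num.sqrt M0 * hpow r (2 * n%:R))) ^+ k.
have W0 : 0 < W by rewrite /W; positivity.
pose D := prior_scale * W * ((2 * n%:R) `^ (- (3 / 2)) * expR (- (1 / 2))) *
   (B2 `^ (- (N + (r * k)%:R)) * ((N / 3) ^+ (r * k) * igamma1 N)).
have D0 : 0 < D by rewrite /D; positivity.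
have inner tau : n%:R <= tau <= 2 * n%:R ->
  (D%:E <= \int[lebesgue_measure]_(v in `]0%R, +oo[)
     integral_Rn (fun b : k.-tuple R => (joint_density tau v (col_of_tuple b))%:E))%E.
  move=> ht.
  apply: (@le_trans _ _ (\int[lebesgue_measure]_(v in `]0%R, +oo[)
    (prior_scale * W * ((2 * n%:R) `^ (- (3 / 2)) * expR (- (1 / 2))) * igamma_fun (N + (r * k)%:R) B2 v)%:E)%E); last first.
    apply: ge0_le_integral_gen => v; rewrite /= in_itv/= andbT => v0.
      by rewrite lee_fin; positivity.
    exact: integral_joint_density_ge.
  under eq_integral do rewrite EFinM.
  rewrite ge0_integralZl_EFin//; last 2 first.
  - by apply/measurable_EFinP; apply: measurable_funTS; exact: measurable_igamma_fun.
  - by positivity.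
  have Nr0 : 0 < N + (r * k)%:R by rewrite ltr_pwDl.
  rewrite -/(igamma _ _) igammaE// -EFinM lee_fin /D.
  rewrite ler_wpM2l//; first by positivity.
  by rewrite ler_wpM2l ?powR_ge0// igamma1_addn.
  by move=> v _; rewrite lee_fin igamma_fun_ge0.
apply: (@le_trans _ _ (D%:E * n%:R%:E)%E).
  rewrite -EFinM lee_fin /D le_eqVlt; apply/orP; left; apply/eqP.
  rewrite [X in _ * X * _ = _]exprMn -[((N / 3 / B2) ^+ r) ^+ k]exprM -/W.
  have -> : B2 `^ (- (N + (r * k)%:R)) = B2 `^ (- N) * B2 ^- (r * k).
    rewrite opprD powRD; last by apply/implyP => _; exact: lt0r_neq0.
    by congr (_ * _); rewrite powRN powR_mulrn// ltW.
  rewrite [X in _ * (_ * X) * _ = _]exprMn [X in _ * (_ * (_ * X)) * _ = _]exprVn.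
  (* The right side is the prior density of [tau] at order [n], up to constants, times the length
     [n] of the interval. *)
  have -> : (n%:R / 2) `^ (- (1 / 2)) * (expR (- (1 / 2)) / 4) =
      (2 * n%:R) `^ (- (3 / 2)) * n%:R * expR (- (1 / 2)) :> R.
    have -> : (2 * n%:R) `^ (- (3 / 2)) = (2 * n%:R) ^- 2 * (2 * n%:R) `^ (1 / 2) :> R.
      rewrite -[(2 * n%:R) ^- 2]powR_invn; last by positivity.
      by rewrite -powRD; [congr (_ `^ _); field|apply/implyP => _; rewrite lt0r_neq0//; positivity].
    have -> : 2 * n%:R = 4 * (n%:R / 2) :> R by field.
    have -> : (n%:R / 2) `^ (- (1 / 2)) = (n%:R / 2) `^ (1 / 2) / (n%:R / 2) :> R.
      rewrite -{3}[n%:R / 2]powRr1; last by positivity.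
      rewrite -powRN -powRD; last by apply/implyP => _; rewrite lt0r_neq0//; positivity.
      by congr (_ `^ _); field.
    rewrite [(4 * _) `^ _]powRM; [|by []|by positivity].
    have -> : 4 `^ (1 / 2) = 2 :> R.
      have -> : 4 = 2 ^+ 2 :> R by ring.
      by rewrite -powR_mulrn// -powRrM (_ : 2%:R * (1 / 2) = 1) ?powRr1//; field.
    move: (expR _) (_ `^ _) => *; field; rewrite gt_eqF//.
  move: ((N / 3) ^+ _) (B2 ^- _) (B2 `^ _) (_ `^ _) (expR _) => *.
  by ring.
rewrite /evidence.
have -> : (D%:E * n%:R%:E = \int[lebesgue_measure]_(tau in `]0%R, +oo[) (D * \1_`[n%:R, 2 * n%:R] tau)%:E)%E.
  under eq_integral do rewrite EFinM.
  rewrite ge0_integralZl_EFin//; last 2 first.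
  - by apply/measurable_EFinP; apply: measurable_funTS; exact: measurable_indic.
  - by rewrite ltW.
  congr (_ * _)%E; rewrite integral_indic// setIidl.
    apply: (etrans _ (esym (lebesgue_measure_itv _))).
    by rewrite /= lte_fin ltr_pMl// ltr1n/= -EFinB; congr EFin; ring.
  by move=> x /=; rewrite !in_itv/= => /andP[h _]; rewrite (lt_le_trans _ h).
apply: ge0_le_integral_gen => tau; rewrite /= in_itv/= andbT => t0.
  by rewrite lee_fin mulr_ge0// ltW.
rewrite indicE; case: (boolP (tau \in _)) => [|_]; last first.
  rewrite mulr0; apply: integral_ge0 => v; rewrite /= in_itv/= andbT => v0.
  by apply: integral_Rn_ge0 => b; rewrite lee_fin joint_density_ge0.
by rewrite inE/= in_itv/= mulr1 => h; exact: inner.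
Qed.

End lower_bound.
End marginal_bounds.

(** * Measurability of evidence and posterior as functions of the response *)

Section measurability.
Context (R : realType).

Lemma measurable_integral_param d (U : measurableType d) (D : set (measurableTypeR R))
    (g : U * R -> \bar R) : measurable D -> measurable_fun setT g ->
  (forall z, 0 <= g z)%E ->
  measurable_fun setT (fun u => (\int[lebesgue_measure]_(x in D) g (u, x))%E).
Proof.
move=> mD mg g0.
pose G (z : U * measurableTypeR R) : \bar R := (g z * (\1_D z.2)%:E)%E.
have mG : measurable_fun setT G.
  apply: emeasurable_funM => //; apply/measurable_EFinP.
  by apply: measurableT_comp => //; exact: measurable_indic.
have G0 z : (0 <= G z)%E by rewrite mule_ge0// lee_fin.
have := measurable_fun_fubini_tonelli_F (m2 := @lebesgue_measure R) G mG G0.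
rewrite /fubini_F; apply: eq_measurable_fun => u _.
rewrite [RHS]integral_mkcond; apply: eq_integral => x _.
by rewrite /G /= epatch_indic.
Qed.

Context (n k r : nat) (Z : 'M[R]_(n, k)) (A : 'M[R]_k).
Context d (U : measurableType d).

Lemma measurable_inv_gamma_pdf (a c : R) (tau : U -> R) : measurable_fun setT tau ->
  measurable_fun setT (fun u => inv_gamma_pdf a c (tau u)).
Proof.
move=> mt; apply: measurable_funM.
  apply: measurable_funM => //.
  exact: (measurableT_comp (f := fun x : R => x `^ _) (measurable_powR _) mt).
apply: measurableT_comp => //; apply: measurable_funM => //.
exact: measurable_funV.
Qed.

Lemma inv_gamma_pdf_ge0 (a c x : R) : 0 < a -> 0 <= inv_gamma_pdf a c x.
Proof. by move=> a0; rewrite /inv_gamma_pdf; have := Gamma_gt0 a0 => ?; positivity. Qed.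

Lemma measurable_likelihood (y : U -> 'cV[R]_n) (b : U -> 'cV[R]_k) (v : U -> R) :
  measurable_col y -> measurable_col b -> measurable_fun setT v ->
  measurable_fun setT (fun u => likelihood Z (y u) (b u) (v u)).
Proof.
move=> my mb mv; apply: measurable_funM.
  apply: (measurableT_comp (f := fun x : R => x `^ _) (measurable_powR _)).
  exact: measurable_funM.
apply: measurableT_comp => //; apply: measurable_funM.
  apply: measurableT_comp => //; apply: measurable_sqn.
  by apply: measurable_colB => //; exact: measurable_col_mulmx.
by apply: measurable_funV; exact: measurable_funM.
Qed.

Lemma pmom_kernel_ge0 (tau v : R) (b : 'cV[R]_k) : 0 <= pmom_kernel r A tau v b.
Proof.
rewrite /pmom_kernel !mulr_ge0 ?powR_ge0 ?sqrtr_ge0 ?expR_ge0// prodr_ge0// => i _.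
by positivity.
Qed.

Lemma pmom_pdf_ge0 (tau v : R) (b : 'cV[R]_k) : 0 <= pmom_pdf r A tau v b.
Proof.
rewrite mulr_ge0 ?pmom_kernel_ge0// invr_ge0 fine_ge0//.
by apply: integral_Rn_ge0 => c; rewrite lee_fin pmom_kernel_ge0.
Qed.

End measurability.

Lemma measurable_pmom_kernel (R : realType) (k r : nat) (A : 'M[R]_k) d (U : measurableType d)
    (tau v : U -> R) (b : U -> 'cV[R]_k) :
  measurable_fun setT tau -> measurable_fun setT v -> measurable_col b ->
  measurable_fun setT (fun u => pmom_kernel r A (tau u) (v u) (b u)).
Proof.
move=> mt mv mb.
have mtv : measurable_fun setT (fun u => tau u * v u) by exact: measurable_funM.
have := measurable_prior_core r A mtv mb; rewrite /prior_core => mc.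
rewrite /pmom_kernel; under eq_fun do rewrite -mulrA.
apply: measurable_funM => //; apply: measurable_funM => //; apply: measurable_funM => //.
exact: measurableT_comp (measurable_powR _) mtv.
Qed.

Lemma measurable_pmom_pdf (R : realType) (k r : nat) (A : 'M[R]_k) d (U : measurableType d)
    (tau v : U -> R) (b : U -> 'cV[R]_k) :
  measurable_fun setT tau -> measurable_fun setT v -> measurable_col b ->
  measurable_fun setT (fun u => pmom_pdf r A (tau u) (v u) (b u)).
Proof.
move=> mt mv mb; apply: measurable_funM; last exact: measurable_pmom_kernel.
apply: measurable_funV; apply: measurableT_comp; first exact: fine_measurable.
apply: (@measurable_integral_Rn _ _ _ _ (fun z : U * k.-tuple R =>
  (pmom_kernel r A (tau z.1) (v z.1) (col_of_tuple z.2))%:E)).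
  apply/measurable_EFinP; apply: measurable_pmom_kernel.
  - exact: measurableT_comp mt _.
  - exact: measurableT_comp mv _.
  - by apply: measurable_col_comp => //; exact: measurable_col_of_tuple.
by move=> z; rewrite lee_fin pmom_kernel_ge0.
Qed.

Lemma measurable_evidence (R : realType) (n k r : nat) (Z : 'M[R]_(n, k)) (A : 'M[R]_k)
    (alpha1 alpha2 : R) d (U : measurableType d) (y : U -> 'cV[R]_n) :
  0 < alpha1 -> measurable_col y ->
  measurable_fun setT (fun u => evidence r Z A (y u) alpha1 alpha2).
Proof.
move=> a0 my.
pose J (z : U * R * R * k.-tuple R) : \bar R := (joint_density r Z A (y z.1.1.1) alpha1 alpha2 z.1.1.2 z.1.2 (col_of_tuple z.2))%:E.
have J0 z : (0 <= J z)%E.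
  rewrite lee_fin; apply: mulr_ge0; last exact: inv_gamma_pdf_ge0.
  apply: mulr_ge0; last by apply: inv_gamma_pdf_ge0; rewrite divr_gt0.
  apply: mulr_ge0; last exact: pmom_pdf_ge0.
  by rewrite mulr_ge0 ?powR_ge0 ?expR_ge0.
have mJ : measurable_fun setT J.
  have m1 : measurable_fun setT (fun z : U * R * R * k.-tuple R => z.1.2) by exact: measurableT_comp.
  have m2 : measurable_fun setT (fun z : U * R * R * k.-tuple R => z.1.1.2).
    by apply: measurableT_comp => //; exact: measurableT_comp.
  have m3 : measurable_col (fun z : U * R * R * k.-tuple R => col_of_tuple z.2).
    by apply: measurable_col_comp => //; exact: measurable_col_of_tuple.
  apply/measurable_EFinP; rewrite /joint_density.
  apply: measurable_funM; last first.
    by apply: (measurable_inv_gamma_pdf _ _ m1).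
  apply: measurable_funM; last exact: measurable_inv_gamma_pdf.
  apply: measurable_funM; last exact: measurable_pmom_pdf.
  apply: measurable_likelihood => //.
  by apply: (measurable_col_comp my); do 2 apply: measurableT_comp => //.
pose G (z : U * R * R) := integral_Rn (fun b => J (z, b)).
have mG : measurable_fun setT G by exact: measurable_integral_Rn.
have G0 z : (0 <= G z)%E by exact: integral_Rn_ge0.
have mH := measurable_integral_param (measurable_itv `]0%R, +oo[) mG G0.
apply: (@measurable_integral_param _ _ _ _ _ (measurable_itv `]0%R, +oo[) mH) => z.
exact: integral_ge0.
Qed.

Lemma measurable_posterior (R : realType) (r : nat) (alpha1 alpha2 c1 c2 q : R) (n p : nat)
    (X : 'M[R]_(n, p)) (A : 'M[R]_p) (k : {set 'I_p}) d (U : measurableType d) (y : U -> 'cV[R]_n) :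
  0 < alpha1 -> measurable_col y ->
  measurable_fun setT (fun u => posterior r alpha1 alpha2 c1 c2 q X A k (y u)).
Proof.
move=> a0 my.
have mm j : measurable_fun setT (fun u => fine (marginal r alpha1 alpha2 X A j (y u))).
  apply: measurableT_comp; first exact: fine_measurable.
  exact: (@measurable_evidence _ _ _ _ (submodel_mx X j) (principal_mx A j)).
apply: measurable_funM; first exact: measurable_funM.
apply: measurable_funV; apply: measurable_sum => j; exact: measurable_funM.
Qed.

(** * The evidence of a model against that of the true one *)

Section evidence_ratio.
Context (R : realType) (n p r : nat) (X : 'M[R]_(n, p)) (A : 'M[R]_p)
  (t : {set 'I_p}) (beta : 'cV[R]_p) (alpha1 alpha2 a1 a2 s e bm b2 : R).
Hypotheses (n0 : (0 < n)%N) (alpha10 : 0 < alpha1) (alpha20 : 0 < alpha2)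
  (a10 : 0 < a1) (a20 : 0 < a2) (s0 : 0 < s) (e0 : 0 < e) (e1 : e <= 1) (bm0 : 0 < bm)
  (gram_lb : forall k : {set 'I_p}, (#|k| <= n)%N -> forall b,
     n%:R * e * sqn b <= sqn (submodel_mx X k *m b))
  (gram_ub : forall k : {set 'I_p}, (#|k| <= n)%N -> forall b,
     sqn (submodel_mx X k *m b) <= n%:R / e * sqn b)
  (principal_quad : forall (k : {set 'I_p}) b,
     a1 * sqn b <= (b^T *m principal_mx A k *m b) 0 0 <= a2 * sqn b)
  (principal_det : forall k : {set 'I_p}, 0 < \det (principal_mx A k))
  (beta_out : forall j, j \notin t -> beta j 0 = 0)
  (beta_in : forall j, j \in t -> bm <= `|beta j 0|)
  (beta_b2 : sqn beta <= b2) (tn : (#|t| <= n)%N).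

Let N : R := n%:R / 2 + alpha1.
Let hr : R := r%:R + 1 / 2.

(** [b2 + 1] bounds each true coefficient, since its square is at most [b2]; [bm] leaves room for
    the estimation error. *)
Definition coef_ub : R := b2 + 1 + bm.
Definition residual_shift : R := alpha2 + #|t|%:R * (a2 * coef_ub ^+ 2).
(* On good noise it dominates the inverse-gamma scale of the evidence of t: the
   second summand of the shift is the prior exponent at the least squares
   estimate, whose coordinates are at most coef_ub. *)
Definition scaled_residual (eta : 'cV[R]_n) : R := sqn eta / 2 + residual_shift.
Definition model_residual (k : {set 'I_p}) (eta : 'cV[R]_n) : R :=
  rss (submodel_mx X k) (X *m beta + eta) / 2 + alpha2.
Definition model_evidence (k : {set 'I_p}) (eta : 'cV[R]_n) : \bar R :=
  evidence r (submodel_mx X k) (principal_mx A k) (X *m beta + eta) alpha1 alpha2.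

(** The last bound, half the smallest signal after taking roots, keeps every estimated coordinate
    under [t] between [bm / 2] and [coef_ub]. *)
Definition good_noise (eta : 'cV[R]_n) : Prop :=
  [/\ s ^+ 2 * n%:R / 4 <= sqn eta, sqn eta <= 4 * s ^+ 2 * n%:R &
      sqn (lsq (submodel_mx X t) *m eta) <= bm ^+ 2 / 4].

Definition evidence_base : R := prior_scale n alpha1 alpha2 * igamma1 N * (n%:R / 2) `^ (- (1 / 2)).

Definition signal_const : R := 2 * (16 * b2 / s ^+ 2 + 4) + 1.
Definition model_factor : R :=
  evidence_ub_const r a2 * hpow r (4 * hr) * (expR 2 * signal_const * (1 / 2 + alpha1)) ^+ r.
Definition true_factor : R :=
  hpow r 2 * (6 * (2 * s ^+ 2 + residual_shift)) ^+ r / evidence_lb_const r a1 a2 (bm / 2).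

Let nn0 : 0 < n%:R :> R. Proof. by rewrite ltr0n. Qed.
Let nn1 : 1 <= n%:R :> R. Proof. by rewrite (ler_nat R 1 n). Qed.
Let N0 : 0 < N. Proof. by rewrite addr_gt0// divr_gt0. Qed.
Let b20 : 0 <= b2. Proof. exact: le_trans (sqn_ge0 _) beta_b2. Qed.

Lemma residual_shift_ge : alpha2 <= residual_shift.
Proof. by rewrite /residual_shift lerDl; positivity. Qed.

Lemma residual_shift_gt0 : 0 < residual_shift.
Proof. exact: lt_le_trans residual_shift_ge. Qed.

Lemma scaled_residual_gt0 eta : 0 < scaled_residual eta.
Proof. by rewrite ltr_wpDl ?residual_shift_gt0// divr_ge0 ?sqn_ge0. Qed.

Lemma model_residual_gt0 k eta : 0 < model_residual k eta.
Proof. by rewrite ltr_wpDl// divr_ge0 ?rss_ge0. Qed.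

Lemma evidence_base_gt0 : 0 < evidence_base.
Proof.
have := prior_scale_gt0 n0 alpha10 alpha20 => ?.
by rewrite /evidence_base; positivity.
Qed.

Lemma model_factor_gt0 : 0 < model_factor.
Proof.
have := evidence_ub_const_gt0 r a20 => ?.
have ? : 0 < hr by rewrite /hr; positivity.
have ? : 0 < signal_const by rewrite /signal_const; positivity.
by rewrite /model_factor; positivity.
Qed.

Lemma true_factor_gt0 : 0 < true_factor.
Proof.
have := residual_shift_gt0 => ?.
have ? : 0 < bm / 2 by rewrite divr_gt0.
have := evidence_lb_const_gt0 r a2 a10 (divr_gt0 bm0 (ltr0n R 2)) => ?.
by rewrite /true_factor; positivity.
Qed.

Lemma response_true_model eta : X *m beta + eta = submodel_mx X t *m restr_col t beta + eta.
Proof. by rewrite submodel_restr_col. Qed.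

(** On good noise [scaled_residual] is at least [s ^ 2 n / 8], so the mean, of squared norm at most
    [n b2 / e], is comparable to it. *)
Lemma sqn_response_le eta : good_noise eta ->
  sqn (X *m beta + eta) <= (16 * b2 / s ^+ 2 + 4) / e * scaled_residual eta.
Proof.
move=> [h1 h2 _].
have B0 := residual_shift_gt0.
apply: le_trans (sqnD_le _ _) _.
have hX : sqn (X *m beta) <= n%:R / e * b2.
  rewrite -(submodel_restr_col X beta_out).
  apply: le_trans (gram_ub tn _) _; rewrite ler_wpM2l//; first by positivity.
  by rewrite sqn_restr_col.
have -> : (16 * b2 / s ^+ 2 + 4) / e * scaled_residual eta =
   16 * b2 / s ^+ 2 / e * scaled_residual eta + 4 / e * scaled_residual eta by field; rewrite !gt_eqF.
have hB : s ^+ 2 * n%:R / 8 <= scaled_residual eta.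
  by rewrite /scaled_residual; move: (s ^+ 2 * n%:R) (sqn eta) h1 => a b; move: residual_shift B0 => c; lra.
apply: lerD.
  apply: (@le_trans _ _ (16 * b2 / s ^+ 2 / e * (s ^+ 2 * n%:R / 8))); last first.
    by rewrite ler_wpM2l//; positivity.
  have -> : 16 * b2 / s ^+ 2 / e * (s ^+ 2 * n%:R / 8) = 2 * (n%:R / e * b2).
    by field; rewrite !gt_eqF.
  by rewrite ler_wpM2l.
apply: (@le_trans _ _ (4 * 1 * scaled_residual eta)).
  by rewrite /scaled_residual; move: (sqn eta) => b; move: residual_shift B0 => c; lra.
rewrite ler_wpM2r ?(ltW (scaled_residual_gt0 _))// ler_wpM2l//.
by rewrite invf_ge1.
Qed.

(** [model_residual] has no useful deterministic lower bound, so the ratio is kept as a multiple of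
    the random quotient. This raises the exponent of the quotient from [N] to [N + r |k|]. *)
Lemma response_ratio_le (k : {set 'I_p}) eta : good_noise eta -> (#|k| <= n)%N ->
  sqn (X *m beta + eta) / model_residual k eta + 1 <=
  signal_const / e * (scaled_residual eta / model_residual k eta).
Proof.
move=> ge kn; have hy := sqn_response_le ge.
have B0 := model_residual_gt0 k eta; have S0 := scaled_residual_gt0 eta.
have hB : model_residual k eta <= sqn (X *m beta + eta) / 2 + scaled_residual eta.
  apply: lerD; first by rewrite ler_wpM2r// (rss_le_sqn (mulr_gt0 nn0 e0) (gram_lb kn)).
  rewrite (le_trans residual_shift_ge)// /scaled_residual lerDr.
  by positivity.
rewrite -(ler_pM2r B0) mulrDl mul1r mulfVK ?gt_eqF// mulrA mulfVK ?gt_eqF//.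
apply: (le_trans (lerD hy hB)).
have e1' : 1 <= e^-1 by rewrite invf_ge1.
rewrite /signal_const; move: (16 * b2 / s ^+ 2 + 4) hy => g hy.
have : scaled_residual eta <= e^-1 * scaled_residual eta by rewrite ler_peMl// ltW.
have -> : (2 * g + 1) / e * scaled_residual eta =
  2 * (g / e * scaled_residual eta) + e^-1 * scaled_residual eta by ring.
have key (q u v w : R) : 0 <= w -> w <= q -> v <= u -> q + (w / 2 + v) <= 2 * q + u by lra.
by apply: key => //; exact: sqn_ge0.
Qed.

(** Per index, [response_ratio_le] costs [e ^ (- r)] and [hpow r (n e)] costs [e ^ (- r - 1 / 2)],
    rounded by [e <= sqrt e] to a total of [2 r + 1]. The powers [n ^ r] cancel and [sqrt n] stays
    in the denominator. *)
Lemma model_evidence_le (k : {set 'I_p}) eta : good_noise eta -> (#|k| <= n)%N -> 2 <= N ->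
  (r * #|k|)%:R <= N / 2 ->
  (model_evidence k eta <= (evidence_base * (Num.sqrt 2 * igamma1 (1 / 2)) *
    (model_factor * e ^- (2 * r).+1 * hpow r (#|k|%:R / n%:R) / Num.sqrt n%:R) ^+ #|k| *
    (scaled_residual eta / model_residual k eta) `^ (N + (r * #|k|)%:R) *
    scaled_residual eta `^ (- N))%:E)%E.
Proof.
move=> ge kn N2 rkN.
have B0 := model_residual_gt0 k eta; have S0 := scaled_residual_gt0 eta.
have m00 : 0 < n%:R * e by rewrite mulr_gt0.
have K0 := prior_scale_gt0 n0 alpha10 alpha20.
have C0 := evidence_ub_const_gt0 r a20.
have G0 : 0 < signal_const by rewrite /signal_const; positivity.
have hr0 : 0 < hr by rewrite /hr; positivity.
have i0 := igamma1_gt0 N0.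
have h := evidence_le (X *m beta + eta) n0 alpha10 alpha20 a10 a20 m00 (principal_det k)
  (@principal_quad k) (gram_lb kn) N2 rkN.
apply: (le_trans h) => {h}.
rewrite lee_fin -/(model_residual k eta) -/N -/hr.
set U := scaled_residual eta / model_residual k eta.
have U0 : 0 < U by rewrite divr_gt0.
have hq := response_ratio_le ge kn; rewrite -/U in hq.
set q := sqn _ / model_residual k eta + 1 in hq *.
have q0 : 0 <= q by rewrite /q; positivity.
have -> : model_residual k eta `^ (- N) = U `^ N * scaled_residual eta `^ (- N).
  rewrite -[X in X `^ (- N)](_ : scaled_residual eta / U = _); last first.
    by rewrite /U; field; rewrite !gt_eqF.
  rewrite powRM ?(ltW S0) ?invr_ge0 ?(ltW U0)// mulrC; congr (_ * _).
  by rewrite -powR_inv1 ?(ltW U0)// -powRrM mulrN mulN1r opprK.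
have hF : evidence_ub_const r a2 * hpow r (4 * hr * #|k|%:R / n%:R) * (expR 2 * q * N) ^+ r / hpow r (n%:R * e) <=
    model_factor * e ^- (2 * r).+1 * hpow r (#|k|%:R / n%:R) / Num.sqrt n%:R * U ^+ r.
  have hq2 : expR 2 * q * N <= expR 2 * signal_const * (1 / 2 + alpha1) * (U * n%:R / e).
    have -> : expR 2 * signal_const * (1 / 2 + alpha1) * (U * n%:R / e) =
       expR 2 * (signal_const / e * U) * ((1 / 2 + alpha1) * n%:R) by field; rewrite gt_eqF.
    apply: ler_pM; [by positivity|by positivity|by rewrite ler_wpM2l ?expR_ge0|].
    rewrite mulrDl /N; apply: lerD; first by rewrite mulrAC mul1r.
    by rewrite ler_peMr// ltW.
  have hq3 : (expR 2 * q * N) ^+ r <= (expR 2 * signal_const * (1 / 2 + alpha1) * (U * n%:R / e)) ^+ r.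
    by apply: lerXn2r; rewrite ?nnegrE//; positivity.
  have -> : 4 * hr * #|k|%:R / n%:R = 4 * hr * (#|k|%:R / n%:R) by rewrite mulrA.
  rewrite [hpow r (4 * hr * _)]hpowM; last by positivity.
  have se : e <= Num.sqrt e.
    by rewrite -[leLHS]ger0_norm ?(ltW e0)// -sqrtr_sqr ler_wsqrtr// expr2 ler_piMr// ltW.
  apply: (@le_trans _ _ (evidence_ub_const r a2 * (hpow r (4 * hr) * hpow r (#|k|%:R / n%:R)) *
     (expR 2 * signal_const * (1 / 2 + alpha1) * (U * n%:R / e)) ^+ r / ((n%:R ^+ r * e ^+ r) * (Num.sqrt n%:R * e)))).
    apply: ler_pM.
    - by have := @hpow_gt0 R r => ?; rewrite !mulr_ge0 ?exprn_ge0 ?sqrtr_ge0//; positivity.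
    - by positivity.
    - rewrite ler_wpM2l// !mulr_ge0 ?exprn_ge0 ?sqrtr_ge0//; positivity.
    rewrite lef_pV2 ?posrE; [|by positivity|by positivity].
    rewrite /hpow exprMn ler_wpM2l//; first by positivity.
    by rewrite sqrtrM ?ler0n// ler_wpM2l.
  rewrite le_eqVlt; apply/orP; left; apply/eqP; rewrite /model_factor.
  have -> : (expR 2 * signal_const * (1 / 2 + alpha1) * (U * n%:R / e)) ^+ r =
     (expR 2 * signal_const * (1 / 2 + alpha1)) ^+ r * U ^+ r * n%:R ^+ r / e ^+ r.
    by rewrite (exprMn _ _ (U * n%:R / e)) (exprMn _ (U * n%:R)) (exprMn _ U) exprVn !mulrA.
  have -> : e ^- (2 * r).+1 = (e ^+ r * e ^+ r * e)^-1 by rewrite mul2n -addnn -addn1 !exprD expr1.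
  have key (E Nr Sq e' Ur G H1 H2 C : R) : E != 0 -> Nr != 0 -> Sq != 0 -> e' != 0 ->
    C * (H1 * H2) * (G * Ur * Nr / E) / (Nr * E * (Sq * e')) = C * H1 * G / (E * E * e') * H2 / Sq * Ur.
    by move=> *; field; do ?[apply/andP; split].
  by apply: key; rewrite lt0r_neq0//; positivity.
have hF0 : 0 <= evidence_ub_const r a2 * hpow r (4 * hr * #|k|%:R / n%:R) * (expR 2 * q * N) ^+ r / hpow r (n%:R * e).
  rewrite !mulr_ge0 ?exprn_ge0 ?sqrtr_ge0//; positivity.
have hFk := lerXn2r #|k| hF0 (le_trans hF0 hF) hF.
rewrite powRD; last by apply/implyP => _; exact: lt0r_neq0.
have -> : U `^ (r * #|k|)%:R = (U ^+ r) ^+ #|k| by rewrite powR_mulrn ?(ltW U0)// exprM.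
rewrite [in leRHS]exprMn in hFk.
have key (K i1 np c Mk Mk' Ur UN SN : R) : 0 <= K * (np * c * i1) -> 0 <= UN * SN ->
    Mk <= Mk' * Ur -> K * (np * c * i1) * Mk * (UN * SN) <= K * i1 * np * c * Mk' * (UN * Ur) * SN.
  move=> h1 h2 h3.
  rewrite [leRHS](_ : _ = K * (np * c * i1) * (Mk' * Ur) * (UN * SN)); last by ring.
  by rewrite ler_wpM2r// ler_wpM2l.
by apply: key; [positivity|positivity|exact: hFk].
Qed.

(** Under [t] the signal drops out of the residual sum of squares, which is then at most [|eta|^2];
    hence the scale [B2] is at most [scaled_residual]. The power [n ^ (r + 1)] is [hpow r n] times
    the factor [sqrt n] from the largest eigenvalue. *)
Lemma true_evidence_ge eta : good_noise eta -> 1 <= N ->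
  ((evidence_base * (expR (- (1 / 2)) / 4) * (true_factor * e^-1 * n%:R ^+ r.+1) ^- #|t| *
    scaled_residual eta `^ (- N))%:E <= model_evidence t eta)%E.
Proof.
move=> ge N1.
have S0 := scaled_residual_gt0 eta.
have m00 : 0 < n%:R * e by rewrite mulr_gt0.
have K0 := prior_scale_gt0 n0 alpha10 alpha20.
have bl0 : 0 < bm / 2 by rewrite divr_gt0.
have C0 := evidence_lb_const_gt0 r a2 a10 bl0.
have i0 := igamma1_gt0 N0.
have B0 := residual_shift_gt0.
have M01 : 1 <= n%:R / e.
  by rewrite ler_pdivlMr// mul1r (le_trans e1).
have [ge1 ge2 ge3] := ge.
set y := X *m beta + eta.
have hbh i : bm / 2 <= `|(lsq (submodel_mx X t) *m y) i 0| <= coef_ub.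
  rewrite /y response_true_model (lsq_translate m00 (gram_lb tn)) mxE [X in `|X + _|]mxE.
  have h1 : `|(lsq (submodel_mx X t) *m eta) i 0| <= bm / 2.
    rewrite -[leRHS]ger0_norm ?(ltW bl0)// -ler_sqr ?nnegrE//.
    rewrite !real_normK ?num_real//; apply: le_trans (sqn_coord _ _) _.
    by apply: (le_trans ge3); rewrite expr_div_n; lra.
  have h2 := beta_in (enum_valP i).
  have h3 : `|beta (enum_val i) 0| <= b2 + 1.
    have h31 : `|beta (enum_val i) 0| ^+ 2 <= b2.
      by rewrite real_normK ?num_real//; exact: le_trans (sqn_coord _ _) beta_b2.
    by move: `|_| h31 (normr_ge0 (beta (enum_val i) 0)) => x; nra.
  move: (beta _ _) (_ *m eta : 'cV_#|t|) h1 h2 h3 => x z h1 h2 h3.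
  have := lerB_normD x (z i 0); have := ler_normD x (z i 0).
  rewrite /coef_ub; move: `|x + _| `|x| `|z i 0| h1 h2 h3 => u v w *.
  by apply/andP; split; lra.
have h := evidence_ge r n0 alpha10 alpha20 a10 a20 m00 (principal_det t)
  (@principal_quad t) (gram_lb tn) M01 bl0 (gram_ub tn) hbh N1.
apply: le_trans h; rewrite lee_fin -/N -/y.
set B2 := rss _ _ / 2 + alpha2 + _.
have B20 : 0 < B2 by rewrite /B2; have := rss_ge0 (submodel_mx X t) y => ?; positivity.
have B2S : B2 <= scaled_residual eta.
  rewrite /B2 /scaled_residual /residual_shift -addrA; apply: lerD; last first.
    rewrite lerD2l ler_wpM2l// ler_pdivrMr//; apply: ler_peMr => //.
    by positivity.
  rewrite ler_wpM2r// /y response_true_model (rss_translate m00 (gram_lb tn)).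
  exact: rss_le_sqn m00 (gram_lb tn) _.
have SG : scaled_residual eta <= (2 * s ^+ 2 + residual_shift) * n%:R.
  rewrite mulrDl; apply: lerD; last by rewrite ler_peMr// ltW.
  by move: ge2; move: (s ^+ 2) (sqn eta) (n%:R : R) => a b c *; lra.
have G20 : 0 < 2 * s ^+ 2 + residual_shift by positivity.
have T0 := true_factor_gt0.
have se : e <= Num.sqrt e.
  by rewrite -[leLHS]ger0_norm ?(ltW e0)// -sqrtr_sqr ler_wsqrtr// expr2 ler_piMr// ltW.
have hb : (true_factor * e^-1 * n%:R ^+ r.+1)^-1 <=
    evidence_lb_const r a1 a2 (bm / 2) / (Num.sqrt (n%:R / e) * hpow r (2 * n%:R)) * (N / 3 / B2) ^+ r.
  have -> : (true_factor * e^-1 * n%:R ^+ r.+1)^-1 =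
     evidence_lb_const r a1 a2 (bm / 2) / (Num.sqrt n%:R / e * (hpow r 2 * (n%:R ^+ r * Num.sqrt n%:R))) *
     (6 * (2 * s ^+ 2 + residual_shift)) ^- r.
    rewrite /true_factor.
    have -> : n%:R ^+ r.+1 = Num.sqrt n%:R * Num.sqrt n%:R * n%:R ^+ r :> R.
      by rewrite exprS -expr2 sqr_sqrtr// ltW.
    have key (E Nr Sq e' H L : R) : E != 0 -> Nr != 0 -> Sq != 0 -> e' != 0 -> H != 0 -> L != 0 ->
      (H * E / L / e' * (Sq * Sq * Nr))^-1 = L / (Sq / e' * (H * (Nr * Sq))) / E.
      by move=> *; field; do ?[apply/andP; split].
    by apply: key; rewrite lt0r_neq0//; positivity.
  apply: ler_pM; [by positivity|by positivity| |].
    rewrite ler_wpM2l ?(ltW C0)// lef_pV2 ?posrE; [|by positivity|by positivity].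
    apply: ler_pM; [by positivity|by positivity| |].
      rewrite sqrtrM ?ler0n// sqrtrV ?(ltW e0)// ler_wpM2l// lef_pV2 ?posrE//.
      by positivity.
    by rewrite hpowM.
  rewrite -exprVn; apply: lerXn2r; rewrite ?nnegrE; [by positivity|by positivity|].
  rewrite ler_pdivlMr// mulrC ler_pdivrMr; last by positivity.
  apply: le_trans B2S _; apply: le_trans SG _.
  rewrite [leRHS](_ : _ = (2 * s ^+ 2 + residual_shift) * (2 * N)); last by field.
  rewrite ler_wpM2l ?(ltW G20)// /N.
  by move: (n%:R : R) alpha1 alpha10 => *; lra.
have hbt := lerXn2r #|t| _ _ hb; rewrite exprVn in hbt.
have hB : scaled_residual eta `^ (- N) <= B2 `^ (- N).
  rewrite !powRN lef_pV2 ?posrE ?powR_gt0//.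
  by apply: ge0_ler_powR; rewrite ?nnegrE ?(ltW N0) ?(ltW B20) ?(ltW S0).
rewrite /evidence_base -/N.
apply: (@le_trans _ _ (prior_scale n alpha1 alpha2 * ((n%:R / 2) `^ (- (1 / 2)) * (expR (- (1 / 2)) / 4) * igamma1 N) *
   ((true_factor * e^-1 * n%:R ^+ r.+1) ^- #|t| * B2 `^ (- N)))); last first.
  rewrite -[leRHS]mulrA ler_wpM2l; [by []|by positivity|].
  rewrite ler_wpM2r ?powR_ge0//; apply: hbt; rewrite nnegrE; first by positivity.
  by positivity.
rewrite [leLHS](_ : _ = prior_scale n alpha1 alpha2 * ((n%:R / 2) `^ (- (1 / 2)) * (expR (- (1 / 2)) / 4) * igamma1 N) *
   ((true_factor * e^-1 * n%:R ^+ r.+1) ^- #|t| * scaled_residual eta `^ (- N))).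
  rewrite ler_wpM2l//; first by positivity.
  by rewrite ler_wpM2l//; positivity.
by move: (_ `^ _) (_ `^ _) (expR _) (igamma1 _) (_ ^- _) => *; ring.
Qed.

End evidence_ratio.

(** * Negative moments of residual ratios *)

Lemma measurable_le_set d (T : measurableType d) (R : realType) (f g : T -> R) :
  measurable_fun setT f -> measurable_fun setT g -> measurable [set w | f w <= g w].
Proof.
by move=> mf mg; rewrite -[X in measurable X]setTI; exact: (@measurable_fun_le _ _ R setT f g).
Qed.

Lemma measurable_lt_set d (T : measurableType d) (R : realType) (f g : T -> R) :
  measurable_fun setT f -> measurable_fun setT g -> measurable [set w | f w < g w].
Proof.
move=> mf mg; rewrite (_ : [set w | f w < g w] = ~` [set w | g w <= f w]).
  by apply: measurableC; exact: measurable_le_set.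
by apply/seteqP; split => w /=; rewrite ltNge => /negP.
Qed.

Section noise_events.
Context (R : realType) d (T : measurableType d) (P : probability T R) (n p r : nat)
  (X : 'M[R]_(n, p)) (t : {set 'I_p}) (beta : 'cV[R]_p) (eps : 'I_n -> {RV P >-> R})
  (alpha1 alpha2 a2 s e bm b2 de : R).
Hypotheses (n0 : (0 < n)%N) (alpha10 : 0 < alpha1) (alpha20 : 0 < alpha2)
  (a20 : 0 < a2) (s0 : 0 < s) (e0 : 0 < e) (e1 : e <= 1) (bm0 : 0 < bm)
  (de0 : 0 < de) (de8 : de <= 1 / 8)
  (gram_lb : forall k : {set 'I_p}, (#|k| <= n)%N -> forall b,
     n%:R * e * sqn b <= sqn (submodel_mx X k *m b))
  (gram_ub : forall k : {set 'I_p}, (#|k| <= n)%N -> forall b,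
     sqn (submodel_mx X k *m b) <= n%:R / e * sqn b)
  (beta_out : forall j, j \notin t -> beta j 0 = 0)
  (beta_in : forall j, j \in t -> bm <= `|beta j 0|)
  (eps_normal : forall (i : 'I_n) (B : set R), measurable B ->
     distribution P (eps i) B = normal_prob 0 s B)
  (eps_indep : mutually_independent eps).

Let N : R := n%:R / 2 + alpha1.
Let C1 : R := residual_shift t alpha2 a2 bm b2.
Let S w := scaled_residual t alpha2 a2 bm b2 (noise eps w).
Let B k w := model_residual X beta alpha2 k (noise eps w).

(* On good noise the odds of k are at most a constant times
   residual_quotient^-(N + r |k|); moment_order is that exponent, lowered so that
   the moment is finite. *)
Definition residual_quotient (k : {set 'I_p}) (w : T) : R := B k w / S w.
Definition moment_order (k : {set 'I_p}) : R := (1 - 4 * de) * (N + (r * #|k|)%:R).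
Definition chernoff_const : R := 1 + expR (C1 / s ^+ 2) / de.
(** The second entry, times [e n], bounds from below the Chernoff exponent of a missing index; the
    cap 1 keeps [1 + e * signal_rate] at most 2. *)
Definition signal_rate : R := Num.min 1 (de * bm ^+ 2 / (4 * s ^+ 2)).

Let nn0 : 0 < n%:R :> R. Proof. by rewrite ltr0n. Qed.
Let m00 : 0 < n%:R * e. Proof. by rewrite mulr_gt0. Qed.
Let M00 : 0 < n%:R / e. Proof. by rewrite divr_gt0. Qed.
Let C10 : 0 < C1. Proof. exact: residual_shift_gt0. Qed.
Let S0 w : 0 < S w. Proof. exact: scaled_residual_gt0. Qed.
Let B0 k w : 0 < B k w. Proof. exact: model_residual_gt0. Qed.

Lemma chernoff_const_gt0 : 0 < chernoff_const.
Proof. by rewrite /chernoff_const; positivity. Qed.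

Lemma signal_rate_gt0 : 0 < signal_rate.
Proof. by rewrite lt_min ltr01/=; positivity. Qed.

Lemma residual_quotient_gt0 k w : 0 < residual_quotient k w.
Proof. by rewrite divr_gt0. Qed.

Lemma measurable_residual_quotient k : measurable_fun setT (residual_quotient k).
Proof.
have mn := measurable_col_noise eps.
apply: measurable_funM; last apply: measurable_funV.
  apply: measurable_funD => //; apply: measurable_funM => //.
  by apply: measurable_rss; apply: measurable_colD => //; exact: measurable_col_cst.
apply: measurable_funD => //; apply: measurable_funM => //.
exact: measurable_sqn.
Qed.

Lemma sqrt_condition_number : Num.sqrt (n%:R / e / (n%:R * e * de)) = (e * Num.sqrt de)^-1.
Proof.
have -> : n%:R / e / (n%:R * e * de) = (e ^+ 2 * de)^-1.
  by field; rewrite !gt_eqF.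
rewrite sqrtrV; last by positivity.
by rewrite sqrtrM ?sqr_ge0// sqrtr_sqr ger0_norm// ltW.
Qed.

Let esq_le1 : e * Num.sqrt de <= 1.
Proof.
rewrite -[leRHS]mulr1; apply: ler_pM; rewrite ?sqrtr_ge0 ?(ltW e0)//.
by rewrite -sqrtr1 ler_wsqrtr//; move: de8; lra.
Qed.

Let esq0 : 0 < e * Num.sqrt de. Proof. by positivity. Qed.

Lemma residual_quotient_small (k : {set 'I_p}) x : (#|k| <= n)%N -> 0 < x <= 2 ->
  (P [set w | residual_quotient k w <= x]%R <=
   (expR (C1 / s ^+ 2) * (e * Num.sqrt de) ^- #|k| *
      expR (- (de * rss (submodel_mx X k) (X *m beta) / (4 * s ^+ 2))) *
    x `^ ((1 - de) * (n - #|k|)%:R / 2))%:E)%E.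
Proof.
move=> kn x02.
have := @rss_small_prob _ _ _ P n #|k| s eps s0 eps_normal eps_indep (submodel_mx X k)
  (n%:R * e) (n%:R / e) m00 (gram_lb kn) (gram_ub kn) M00 (X *m beta) alpha2 C1 de x kn
  (ltW alpha20) (ltW C10) _ x02.
rewrite de0/= sqrt_condition_number exprVn => h.
apply: le_trans (le_trans (h _) _); last 2 first.
- by move: de8; lra.
- by rewrite mulrAC.
rewrite le_eqVlt; apply/orP; left; apply/eqP; congr (P _).
apply/seteqP; split => w /=; by rewrite /residual_quotient ler_pdivrMr.
Qed.

(** As [(1 + de) (1 - 4 de) <= 1 - 3 de], the two sides differ by [de n] in their main terms, which
    covers [alpha1 + r k + k / 2]. This is the reason for the factor 4. *)
Lemma moment_order_le (k : {set 'I_p}) : (#|k| <= n)%N ->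
  alpha1 + r.+1%:R * #|k|%:R <= de * n%:R ->
  (1 + de) * moment_order k <= (1 - de) * (n - #|k|)%:R / 2.
Proof.
move=> kn; rewrite /moment_order natrB// natrM -natr1 mulrDl mul1r /N.
have key (rk k' n' a D : R) : 0 <= rk -> 0 <= k' -> 0 <= n' -> 0 <= a -> 0 <= D -> D <= 1 / 8 ->
    a + (rk + k') <= D * n' ->
    (1 + D) * ((1 - 4 * D) * (n' / 2 + a + rk)) <= (1 - D) * (n' - k') / 2.
  move=> rk0 k0 n'0 a0 D0 D8 h.
  have := mulr_ge0 D0 (addr_ge0 a0 rk0); have := mulr_ge0 D0 k0.
  have := mulr_ge0 (mulr_ge0 D0 D0) (addr_ge0 (addr_ge0 n'0 a0) (addr_ge0 rk0 rk0)).
  have := mulr_ge0 (mulr_ge0 D0 D0) a0.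
  move: h => ? ? ? ? ?; nra.
by apply: key; rewrite ?mulr_ge0// ltW.
Qed.

Lemma moment_order_ge (k : {set 'I_p}) : n%:R / 4 <= moment_order k.
Proof.
have key (D x a b : R) : D <= 1 / 8 -> 0 <= x -> 0 <= a -> 0 <= b ->
    x / 4 <= (1 - 4 * D) * (x / 2 + a + b).
  move=> D8 x0 a0 b0; have D2 : 1 / 2 <= 1 - 4 * D by lra.
  have h : 0 <= x / 2 + a + b by rewrite !addr_ge0// divr_ge0.
  by apply: le_trans (ler_wpM2r h D2); lra.
by apply: key => //; exact: ltW.
Qed.

Lemma residual_moment_le (k : {set 'I_p}) : (#|k| <= n)%N ->
  alpha1 + r.+1%:R * #|k|%:R <= de * n%:R ->
  (\int[P]_w (residual_quotient k w `^ (- moment_order k))%:E <=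
   (chernoff_const * (e * Num.sqrt de) ^- #|k|)%:E)%E.
Proof.
move=> kn hk.
have mo0 : 0 < moment_order k by apply: lt_le_trans (moment_order_ge k); rewrite divr_gt0.
set Q := expR (C1 / s ^+ 2) * (e * Num.sqrt de) ^- #|k| *
      expR (- (de * rss (submodel_mx X k) (X *m beta) / (4 * s ^+ 2))).
have Q0 : 0 <= Q by rewrite /Q; positivity.
apply: le_trans (@negative_moment_le _ _ _ P (residual_quotient k) Q _
  ((1 - de) * (n - #|k|)%:R / 2) de 1 (measurable_residual_quotient k) (residual_quotient_gt0 k)
  Q0 mo0 de0 (moment_order_le kn hk) _ _) _.
- by rewrite lexx ler1n.
- by move=> x x02; exact: residual_quotient_small.
rewrite !powR1 mulr1 lee_fin /chernoff_const mulrDl mul1r; apply: lerD.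
  by rewrite -exprVn exprn_ege1// invf_ge1.
rewrite [leRHS]mulrAC; apply: ler_wpM2r; first by positivity.
rewrite /Q; apply: ler_piMr; first by positivity.
by rewrite expR_le1 oppr_le0; positivity.
Qed.

(** The residual of the mean is [X] applied to a vector supported in the union of [k] and [t], whose
    coordinate [j] is still [beta j]; the eigenvalue bound for the union applies. *)
Lemma rss_missing (k : {set 'I_p}) j : (#|k :|: t| <= n)%N -> j \in t -> j \notin k ->
  n%:R * e * bm ^+ 2 <= rss (submodel_mx X k) (X *m beta).
Proof.
move=> ktn jt jk; rewrite /rss.
have [c ck <-] := exists_restr_col (lsq (submodel_mx X k) *m (X *m beta)).
rewrite submodel_restr_col// -mulmxBr -(@submodel_restr_col _ _ _ X (k :|: t)); last first.
  by move=> i; rewrite inE negb_or => /andP[ik it]; rewrite !mxE ck// beta_out// subrr.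
apply: le_trans (gram_lb ktn _); rewrite ler_wpM2l ?(ltW m00)//.
rewrite sqn_restr_col; last first.
  by move=> i; rewrite inE negb_or => /andP[ik it]; rewrite !mxE ck// beta_out// subrr.
apply: le_trans (sqn_coord _ j); rewrite !mxE ck// subr0.
rewrite -[leRHS]real_normK ?num_real//; apply: lerXn2r; rewrite ?nnegrE ?(ltW bm0)//.
exact: beta_in.
Qed.

(** The signal makes the tail bound exponentially small, so the cut of [negative_moment_le] can be
    moved above 1, after which both of its terms decay. *)
Lemma residual_moment_missing_le (k : {set 'I_p}) j : (#|k :|: t| <= n)%N ->
  j \in t -> j \notin k -> alpha1 + r.+1%:R * #|k|%:R <= de * n%:R ->
  (\int[P]_w (residual_quotient k w `^ (- moment_order k))%:E <=
   (chernoff_const * (e * Num.sqrt de) ^- #|k| * expR (- (signal_rate / 16 * (e * n%:R))))%:E)%E.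
Proof.
move=> ktn jt jk hk.
have kn : (#|k| <= n)%N by apply: leq_trans (subset_leq_card _) ktn; exact: finset.subsetUl.
have mo0 : 0 < moment_order k by apply: lt_le_trans (moment_order_ge k); rewrite divr_gt0.
set Q := expR (C1 / s ^+ 2) * (e * Num.sqrt de) ^- #|k| *
      expR (- (de * rss (submodel_mx X k) (X *m beta) / (4 * s ^+ 2))).
have Q0 : 0 <= Q by rewrite /Q; positivity.
have y0 := signal_rate_gt0.
have y1 : signal_rate <= 1 by rewrite ge_min lexx.
have y2 : signal_rate <= de * bm ^+ 2 / (4 * s ^+ 2) by rewrite ge_min lexx orbT.
(* At the cut [1 + u], the first term is at most [exp (- u n / 8)] because [1 + u >= exp (u / 2)]
   and the order is at least [n / 4]; in the second, the signal gives [exp (- u n)] against a growth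
   of at most [exp (u n / 2)]. *)
pose u := e * signal_rate.
have u0 : 0 < u by rewrite mulr_gt0.
have u1 : u <= 1 by rewrite -[leRHS]mulr1 ler_pM// ltW.
apply: le_trans (@negative_moment_le _ _ _ P (residual_quotient k) Q _
  ((1 - de) * (n - #|k|)%:R / 2) de (1 + u) (measurable_residual_quotient k) (residual_quotient_gt0 k)
  Q0 mo0 de0 (moment_order_le kn hk) _ _) _.
- by apply/andP; split; lra.
- by move=> x x02; exact: residual_quotient_small.
rewrite lee_fin.
have un0 : 0 <= u * n%:R by rewrite mulr_ge0// ltW.
have u10 : 0 < 1 + u by rewrite addr_gt0.
have h1 : (1 + u) `^ (- moment_order k) <= expR (- (signal_rate / 16 * (e * n%:R))).
  have hu : expR (u / 2) <= 1 + u.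
    have h : 0 < 1 - u / 2 by lra.
    rewrite -(ler_pM2r h); apply: (@le_trans _ _ 1); last by nra.
    apply: (@le_trans _ _ (expR (u / 2) * expR (- (u / 2)))).
      by rewrite ler_wpM2l ?expR_ge0// (le_trans _ (expR_ge1Dx _)).
    by rewrite -expRD subrr expR0.
  rewrite powRN expRN lef_pV2 ?posrE ?expR_gt0 ?powR_gt0//.
  apply: (@le_trans _ _ (expR (u / 2) `^ moment_order k)); last first.
    by apply: ge0_ler_powR; rewrite ?nnegrE ?expR_ge0 ?(ltW u10) ?(ltW mo0).
  rewrite -expRM ler_expR.
  apply: (@le_trans _ _ (u / 2 * (n%:R / 4))); last first.
    by rewrite ler_wpM2l ?moment_order_ge// divr_ge0// ltW.
  rewrite (_ : signal_rate / 16 * (e * n%:R) = u * n%:R / 16); last by rewrite /u; ring.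
  have key (x : R) : 0 <= x -> x / 16 <= x / 8 by lra.
  by rewrite (_ : u / 2 * (n%:R / 4) = u * n%:R / 8); [exact: key|field].
have h2 : (1 + u) `^ ((1 - de) * (n - #|k|)%:R / 2 - moment_order k) <= expR (u * (n%:R / 2)).
  apply: (@le_trans _ _ ((1 + u) `^ (n%:R / 2))).
    apply: ler_powR; first by lra.
    have : (n - #|k|)%:R <= n%:R :> R by rewrite ler_nat leq_subr.
    have : 0 <= (n - #|k|)%:R :> R by [].
    have key (a b c D : R) : 0 <= c -> 0 <= D -> 0 <= a -> a <= b -> (1 - D) * a / 2 - c <= b / 2.
      by move=> c0 D0 a0 ab; have := mulr_ge0 D0 a0; lra.
    by move=> *; apply: key => //; exact: ltW.
  rewrite expRM; apply: ge0_ler_powR; rewrite ?nnegrE ?expR_ge0 ?(ltW u10) ?divr_ge0//.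
  exact: expR_ge1Dx.
have h3 : Q <= expR (C1 / s ^+ 2) * (e * Num.sqrt de) ^- #|k| * expR (- (u * n%:R)).
  rewrite /Q; apply: ler_wpM2l; first by positivity.
  rewrite ler_expR lerN2.
  apply: (@le_trans _ _ (de * (n%:R * e * bm ^+ 2) / (4 * s ^+ 2))); last first.
    rewrite ler_wpM2r//; first by positivity.
    by rewrite ler_wpM2l ?(ltW de0)//; exact: rss_missing jk.
  have -> : de * (n%:R * e * bm ^+ 2) / (4 * s ^+ 2) = n%:R * e * (de * bm ^+ 2 / (4 * s ^+ 2)).
    by field; rewrite gt_eqF.
  rewrite (_ : u * n%:R = n%:R * e * signal_rate); last by rewrite /u; ring.
  by rewrite ler_wpM2l// ltW.
set E16 := expR (- (signal_rate / 16 * _)) in h1 *.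
have h4 : expR (- (u * n%:R)) * expR (u * (n%:R / 2)) <= E16.
  rewrite -expRD ler_expR (_ : signal_rate / 16 * (e * n%:R) = u * n%:R / 16); last by rewrite /u; ring.
  have key (x : R) : 0 <= x -> - x + x / 2 <= - (x / 16) by lra.
  by rewrite mulrA; exact: key.
rewrite /chernoff_const; set G := (e * Num.sqrt de) ^- #|k| in h3 *.
have G1 : 1 <= G by rewrite /G -exprVn exprn_ege1// invf_ge1.
have E0 : 0 <= E16 by exact: expR_ge0.
have c0 : 0 <= expR (C1 / s ^+ 2) / de by rewrite divr_ge0 ?expR_ge0// ltW.
have -> : (1 + expR (C1 / s ^+ 2) / de) * G * E16 = G * E16 + expR (C1 / s ^+ 2) / de * G * E16 by ring.
apply: lerD; first by apply: (le_trans h1); rewrite ler_peMl.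
apply: (@le_trans _ _ (expR (C1 / s ^+ 2) * G * expR (- (u * n%:R)) / de * expR (u * (n%:R / 2)))).
  apply: ler_pM; rewrite ?powR_ge0 ?divr_ge0 ?(ltW de0)//.
  by rewrite ler_wpM2r// invr_ge0 ltW.
rewrite [leLHS](_ : _ = expR (C1 / s ^+ 2) / de * G * (expR (- (u * n%:R)) * expR (u * (n%:R / 2)))); last by ring.
by rewrite ler_wpM2l// mulr_ge0// (le_trans _ G1).
Qed.

Lemma markov_le (f : T -> R) (a m : R) (D : set T) : measurable_fun setT f ->
  (forall w, 0 <= f w) -> 0 < a -> (forall w, D w -> a <= f w) -> measurable D ->
  (\int[P]_w (f w)%:E <= m%:E)%E -> (P D <= (m / a)%:E)%E.
Proof.
move=> mf f0 a0 Df mD hm.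
rewrite EFinM lee_pdivlMr// muleC -integral_cst//.
apply: le_trans hm; apply: (@le_trans _ _ (\int[P]_(w in D) (f w)%:E)%E).
  by apply: ge0_le_integral_gen => w Dw; rewrite lee_fin ?(ltW a0) ?Df.
apply: ge0_subset_integral => //; first by apply/measurable_EFinP.
by move=> w _; rewrite lee_fin.
Qed.

Let mn : measurable_col (noise eps). Proof. exact: measurable_col_noise. Qed.
Let msq : measurable_fun setT (fun w => sqn (noise eps w)).
Proof. exact: measurable_sqn. Qed.

Lemma integral_expR_sqn_noise (c : R) : 0 < 1 - 2 * s ^+ 2 * c ->
  (\int[P]_w (expR (c * sqn (noise eps w)))%:E = ((Num.sqrt (1 - 2 * s ^+ 2 * c))^-1 ^+ n)%:E)%E.
Proof.
move=> u0; have := noise_mgf s0 eps_normal eps_indep (0 : 'cV[R]_n) u0.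
have -> : sqn (0 : 'cV[R]_n) = 0 by rewrite /sqn big1// => i _; rewrite mxE expr0n.
rewrite mul0r expR0 mulr1 => <-; apply: eq_integral => w _; congr (expR _)%:E.
rewrite (_ : \sum_i _ = 0) ?mulr0 ?addr0; last by rewrite big1// => i _; rewrite mxE mul0r.
by field; rewrite gt_eqF.
Qed.

Lemma noise_large_prob :
  (P [set w | 4 * s ^+ 2 * n%:R < sqn (noise eps w)]%R <= ((Num.sqrt 2 * expR (- 1)) ^+ n)%:E)%E.
Proof.
(* Half of the critical exponent: the moment generating function is [2 ^ (n / 2)], the threshold
   value [exp n]. *)
pose c : R := (4 * s ^+ 2)^-1.
have cE : 1 - 2 * s ^+ 2 * c = 1 / 2 by rewrite /c; field; rewrite gt_eqF.
have -> : (Num.sqrt 2 * expR (- 1)) ^+ n = Num.sqrt 2 ^+ n / expR n%:R :> R.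
  by rewrite exprMn -expRM_natl mulrN1 expRN.
apply: (@markov_le (fun w => expR (c * sqn (noise eps w)))).
- by apply: measurableT_comp => //; exact: measurable_funM.
- by move=> w; exact: expR_ge0.
- exact: expR_gt0.
- move=> w /= h; rewrite ler_expR /c mulrC ler_pdivlMr; last by positivity.
  by rewrite mulrC ltW.
- exact: measurable_lt_set.
- rewrite integral_expR_sqn_noise ?cE ?divr_gt0//.
  by rewrite div1r sqrtrV// invrK.
Qed.

Lemma noise_small_prob :
  (P [set w | sqn (noise eps w) < s ^+ 2 * n%:R / 4]%R <= ((expR (1 / 8) / Num.sqrt 2) ^+ n)%:E)%E.
Proof.
(* The moment generating function is [2 ^ (- n / 2)], the threshold value [exp (- n / 8)]. *)
pose c : R := - (2 * s ^+ 2)^-1.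
have cE : 1 - 2 * s ^+ 2 * c = 2 by rewrite /c; field; rewrite gt_eqF.
have -> : (expR (1 / 8) / Num.sqrt 2) ^+ n = (Num.sqrt 2)^-1 ^+ n / expR (- (n%:R * (1 / 8))) :> R.
  by rewrite exprMn -expRM_natl expRN invrK mulrC.
apply: (@markov_le (fun w => expR (c * sqn (noise eps w)))).
- by apply: measurableT_comp => //; exact: measurable_funM.
- by move=> w; exact: expR_ge0.
- exact: expR_gt0.
- move=> w /= h; rewrite ler_expR /c mulNr lerN2 mulrC ler_pdivrMr; last by positivity.
  rewrite (_ : n%:R * (1 / 8) * (2 * s ^+ 2) = s ^+ 2 * n%:R / 4); last by field.
  exact: ltW.
- exact: measurable_lt_set.
- by rewrite integral_expR_sqn_noise ?cE.
Qed.

(** By [sqn_lsq_le] a large estimation error forces [|eps|^2 - rss >= n e bm ^ 2 / 4]; with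
    [|eps|^2 <= 4 s ^ 2 n] this means [rss <= (1 - u) |eps|^2], an event covered by [rss_small_prob]
    with zero mean and zero shifts. *)
Lemma lsq_error_prob : (#|t| <= n)%N -> alpha1 + r.+1%:R * #|t|%:R <= de * n%:R ->
  (P [set w | sqn (noise eps w) <= 4 * s ^+ 2 * n%:R /\
      bm ^+ 2 / 4 < sqn (lsq (submodel_mx X t) *m noise eps w)]%R <=
   ((e * Num.sqrt de) ^- #|t| * expR (- (signal_rate / 16 * (e * n%:R))))%:E)%E.
Proof.
move=> tn hk.
have y0 := signal_rate_gt0.
have y1 : signal_rate <= 1 by rewrite ge_min lexx.
have y2 : signal_rate <= de * bm ^+ 2 / (4 * s ^+ 2) by rewrite ge_min lexx orbT.
pose u := e * signal_rate / 2.
have u0 : 0 < u by rewrite divr_gt0// mulr_gt0.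
have u12 : u <= 1 / 2.
  by rewrite ler_wpM2r// -[leRHS]mulr1 ler_pM// ltW.
pose x := 1 - u.
have x0 : 0 < x by rewrite /x; lra.
have x2 : x <= 2 by rewrite /x; lra.
set D := [set w | _].
have mlsq : measurable_fun setT (fun w => sqn (lsq (submodel_mx X t) *m noise eps w)).
  by apply: measurable_sqn; exact: measurable_col_mulmx.
have mD : measurable D.
  rewrite (_ : D = [set w | sqn (noise eps w) <= 4 * s ^+ 2 * n%:R] `&`
    [set w | bm ^+ 2 / 4 < sqn (lsq (submodel_mx X t) *m noise eps w)])//.
  by apply: measurableI; [exact: measurable_le_set|exact: measurable_lt_set].
pose D2 := [set w | rss (submodel_mx X t) (0 + noise eps w) / 2 + 0 <= x * (sqn (noise eps w) / 2 + 0)]%R.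
have mD2 : measurable D2.
  apply: measurable_le_set.
    apply: measurable_funD => //; apply: measurable_funM => //.
    by apply: measurable_rss; apply: measurable_colD => //; exact: measurable_col_cst.
  apply: measurable_funM => //; apply: measurable_funD => //; exact: measurable_funM.
have DD2 : D `<=` D2.
  move=> w [h1 h2]; rewrite /D2/= add0r !addr0.
  have h3 := sqn_lsq_le m00 (gram_lb tn) (noise eps w).
  rewrite mulrA ler_wpM2r//.
  have h4 : n%:R * e * (bm ^+ 2 / 4) <= sqn (noise eps w) - rss (submodel_mx X t) (noise eps w).
    by apply: le_trans h3; rewrite ler_wpM2l ?(ltW m00)// ltW.
  have h5 : u * sqn (noise eps w) <= n%:R * e * (bm ^+ 2 / 4).
    apply: (@le_trans _ _ (u * (4 * s ^+ 2 * n%:R))); first by rewrite ler_wpM2l// ltW.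
    rewrite (_ : u * _ = n%:R * e * (signal_rate * s ^+ 2 * 2)); last by rewrite /u; field.
    rewrite ler_wpM2l ?(ltW m00)//.
    apply: (@le_trans _ _ (de * bm ^+ 2 / (4 * s ^+ 2) * s ^+ 2 * 2)).
      by rewrite ler_wpM2r// ler_wpM2r// sqr_ge0.
    rewrite (_ : _ * 2 = de * bm ^+ 2 / 2); last by field; rewrite gt_eqF.
    have := mulr_ge0 (sqr_ge0 bm) (_ : 0 <= 1 / 2 - de); rewrite -mulrA.
    move: (bm ^+ 2) => b h; have := h ltac:(move: de8; lra); lra.
  rewrite /x mulrBl mul1r; move: (sqn _) (rss _ _) (u * _) (n%:R * e * _) h4 h5 => *; lra.
apply: (@le_trans _ _ (P D2)); first by apply: le_measure; rewrite ?inE.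
have := @rss_small_prob _ _ _ P n #|t| s eps s0 eps_normal eps_indep (submodel_mx X t)
  (n%:R * e) (n%:R / e) m00 (gram_lb tn) (gram_ub tn) M00 0 0 0 de x tn (lexx 0) (lexx 0).
rewrite de0 x0 x2/= sqrt_condition_number exprVn => h.
apply: le_trans (h _ erefl) _; first by move: de8; lra.
rewrite lee_fin mul0r expR0 mul1r.
have nt2 : n%:R / 2 <= (n - #|t|)%:R :> R.
  rewrite natrB//.
  have key (a b D' k' : R) : 0 <= a -> 0 <= k' -> 0 <= b -> D' <= 1 / 8 -> 0 <= D' -> alpha1 + (b + 1) * k' <= D' * a -> a / 2 <= a - k'.
    move=> a0 k0 b0 D8 D0 h'; have := mulr_ge0 b0 k0; have := ler_wpM2r a0 D8; move: alpha10 => *; lra.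
  by apply: (key _ r%:R de) => //; [exact: ltW|rewrite natr1].
apply: (@le_trans _ _ ((e * Num.sqrt de) ^- #|t| * x `^ ((1 - de) * (n - #|t|)%:R / 2))).
  apply: ler_piMr; first by positivity.
  by rewrite expR_le1 oppr_le0; positivity.
apply: ler_wpM2l; first by positivity.
have u1 : u <= 1 by lra.
apply: (@le_trans _ _ (expR (- u) `^ ((1 - de) * (n - #|t|)%:R / 2))).
  apply: ge0_ler_powR; rewrite ?nnegrE ?expR_ge0 ?(ltW x0)//.
    by rewrite divr_ge0// mulr_ge0//; move: de8; lra.
  by rewrite /x -[X in X <= _]/(1 + - u) expR_ge1Dx.
rewrite -expRM ler_expR mulNr lerN2.
have key (a b D' : R) : 0 <= a -> a / 2 <= b -> D' <= 1 / 8 -> a / 8 <= (1 - D') * b / 2.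
  by move=> a0 ab D8; have := @ler_wpM2r R b _ _ _ D8; nra.
rewrite (_ : signal_rate / 16 * (e * n%:R) = u * (n%:R / 8)); last by rewrite /u; field.
by rewrite ler_wpM2l ?(ltW u0)//; apply: key => //; exact: ltW.
Qed.

End noise_events.

(** * From evidence ratios to the posterior *)

Lemma normalized_weight_error (R : realFieldType) (I : finType) (a : I -> R) (t : I) :
  (forall k, 0 <= a k) -> 0 < a t ->
  `|a t / (\sum_k a k) - 1| <= \sum_(k | k != t) a k / a t.
Proof.
move=> a0 at0; rewrite (bigD1 t)//= -mulr_suml.
set S := \sum_(k | _) _; have S0 : 0 <= S by exact: sumr_ge0.
have aS0 : 0 < a t + S by rewrite ltr_pwDl.
have -> : a t / (a t + S) - 1 = - (S / (a t + S)) by field; rewrite gt_eqF.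
rewrite normrN ger0_norm ?divr_ge0 ?(ltW aS0)//.
by rewrite ler_wpM2l// lef_pV2 ?posrE// lerDl.
Qed.

(** The sum over subsets factorizes: an index of [t] contributes 2 and any other
    [1 + 1 / p <= exp (1 / p)]. *)
Lemma sum_subset_weights (R : realType) (p : nat) (t : {set 'I_p}) :
  \sum_(k : {set 'I_p}) p%:R ^- #|k :\: t| <= 2 ^+ #|t| * expR 1 :> R.
Proof.
pose F (i : 'I_p) : R := if i \in t then 1 else p%:R^-1.
have -> : \sum_(k : {set 'I_p}) p%:R ^- #|k :\: t| = \prod_(i < p) (F i + 1) :> R.
  rewrite bigA_distr; apply: eq_bigr => k _.
  rewrite -big_mkcond/= -exprVn -prodr_const.
  rewrite [RHS](bigID (mem t))/= [X in X * _]big1 ?mul1r; last first.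
    by move=> i /andP[_ it]; rewrite /F it.
  apply: eq_big => [i|i]; first by rewrite !inE andbC.
  by rewrite !inE => /andP[it _]; rewrite /F (negbTE it).
rewrite (bigID (mem t))/=; apply: ler_pM.
- by apply: prodr_ge0 => i _; rewrite addr_ge0// /F; case: ifP => // _; rewrite invr_ge0.
- by apply: prodr_ge0 => i _; rewrite addr_ge0// /F; case: ifP => // _; rewrite invr_ge0.
- rewrite -prodr_const le_eqVlt; apply/orP; left; apply/eqP.
  by apply: eq_bigr => i it; rewrite /F it; ring.
apply: (@le_trans _ _ (\prod_(i < p) expR p%:R^-1)); last first.
  rewrite prodr_const card_ord -expRM_natl ler_expR.
  by have [->|p0] := eqVneq (p%:R : R) 0; rewrite ?mul0r// divff.
rewrite [leRHS](bigID (mem t))/= -[leLHS]mul1r; apply: ler_pM => //.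
- by apply: prodr_ge0 => i _; rewrite addr_ge0// /F; case: ifP => // _; rewrite invr_ge0.
- rewrite [leLHS](_ : _ = \prod_(i in t) 1); last by rewrite big1.
  by apply: ler_prod => i _; rewrite ler01/= -expR0 ler_expR invr_ge0.
- apply: ler_prod => i it; rewrite /F (negbTE it) addr_ge0 ?invr_ge0//=.
  by rewrite addrC expR_ge1Dx.
Qed.

Section posterior_ratio.
Context (R : realType) (n p r : nat) (X : 'M[R]_(n, p)) (A : 'M[R]_p)
  (t : {set 'I_p}) (beta : 'cV[R]_p) (alpha1 alpha2 a1 a2 s e bm b2 c1 c2 q : R).
Hypotheses (n0 : (0 < n)%N) (alpha10 : 0 < alpha1) (alpha20 : 0 < alpha2)
  (a10 : 0 < a1) (a20 : 0 < a2) (s0 : 0 < s) (e0 : 0 < e) (e1 : e <= 1) (bm0 : 0 < bm)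
  (c10 : 0 < c1)
  (gram_lb : forall k : {set 'I_p}, (#|k| <= n)%N -> forall b,
     n%:R * e * sqn b <= sqn (submodel_mx X k *m b))
  (gram_ub : forall k : {set 'I_p}, (#|k| <= n)%N -> forall b,
     sqn (submodel_mx X k *m b) <= n%:R / e * sqn b)
  (principal_quad : forall (k : {set 'I_p}) b,
     a1 * sqn b <= (b^T *m principal_mx A k *m b) 0 0 <= a2 * sqn b)
  (principal_det : forall k : {set 'I_p}, 0 < \det (principal_mx A k))
  (beta_out : forall j, j \notin t -> beta j 0 = 0)
  (beta_in : forall j, j \in t -> bm <= `|beta j 0|)
  (beta_b2 : sqn beta <= b2) (tq : #|t|%:R <= q)
  (model_size : forall k : {set 'I_p}, #|k|%:R <= q -> (#|k| <= n)%N /\ (r * #|k|)%:R <= (n%:R / 2 + alpha1) / 2).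

Let N : R := n%:R / 2 + alpha1.
Hypothesis N2 : 2 <= N.

Definition base_ratio : R := Num.sqrt 2 * igamma1 (1 / 2) / (expR (- (1 / 2)) / 4).

Definition evidence_coef (k : {set 'I_p}) : R :=
  base_ratio *
  (model_factor r alpha1 a2 s b2 * e ^- (2 * r).+1 * hpow r (#|k|%:R / n%:R) / Num.sqrt n%:R) ^+ #|k| *
  (true_factor r t alpha2 a1 a2 s bm b2 * e^-1 * n%:R ^+ r.+1) ^+ #|t|.

Definition prior_ratio (k : {set 'I_p}) : R :=
  complexity_weight c1 c2 q k / complexity_weight c1 c2 q t.

Lemma complexity_weight_ge0 (k : {set 'I_p}) : 0 <= complexity_weight c1 c2 q k.
Proof.
rewrite /complexity_weight; case: ifP => // _.
by rewrite mulr_ge0 ?powR_ge0// invr_ge0 exprn_ge0// ltW.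
Qed.

Lemma complexity_weight_gt0 (k : {set 'I_p}) : #|k|%:R <= q -> 0 < complexity_weight c1 c2 q k.
Proof.
move=> kq; rewrite /complexity_weight kq mulr_gt0 ?invr_gt0 ?exprn_gt0//.
have [k0|k0] := posnP #|k|; first by rewrite k0 mulr0 oppr0 powRr0.
have kp : (#|k| <= p)%N by rewrite -[X in (_ <= X)%N]card_ord max_card.
by rewrite powR_gt0// ltr0n (leq_trans k0).
Qed.

Lemma base_ratio_gt0 : 0 < base_ratio.
Proof.
have : 0 < igamma1 (1 / 2 : R) by apply: igamma1_gt0; rewrite divr_gt0.
by move=> ?; rewrite /base_ratio; positivity.
Qed.

Lemma model_evidence_ge0 (k : {set 'I_p}) eta : (0 <= model_evidence r X A beta alpha1 alpha2 k eta)%E.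
Proof.
apply: integral_ge0 => tau; rewrite /= in_itv/= andbT => t0.
apply: integral_ge0 => v; rewrite /= in_itv/= andbT => v0.
apply: integral_Rn_ge0 => b; rewrite lee_fin.
by apply: (@joint_density_ge0 _ _ _ _ _ _ _ _ _ a1 a2).
Qed.

(** Finiteness has to be stated too: the posterior uses [fine], which would turn an infinite
    evidence into 0. *)
Lemma fine_model_evidence_le (k : {set 'I_p}) eta : #|k|%:R <= q -> good_noise X t s bm eta ->
  model_evidence r X A beta alpha1 alpha2 k eta \is a fin_num /\
  fine (model_evidence r X A beta alpha1 alpha2 k eta) <=
    evidence_base n alpha1 alpha2 * (Num.sqrt 2 * igamma1 (1 / 2)) *
    (model_factor r alpha1 a2 s b2 * e ^- (2 * r).+1 * hpow r (#|k|%:R / n%:R) / Num.sqrt n%:R) ^+ #|k| *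
    (scaled_residual t alpha2 a2 bm b2 eta / model_residual X beta alpha2 k eta) `^ (N + (r * #|k|)%:R) *
    scaled_residual t alpha2 a2 bm b2 eta `^ (- N).
Proof.
move=> kq gn; have [tn rt] := model_size tq; have [kn rk] := model_size kq.
have hk : (model_evidence r X A beta alpha1 alpha2 k eta <= (evidence_base n alpha1 alpha2 * (Num.sqrt 2 * igamma1 (1 / 2)) *
    (model_factor r alpha1 a2 s b2 * e ^- (2 * r).+1 * hpow r (#|k|%:R / n%:R) / Num.sqrt n%:R) ^+ #|k| *
    (scaled_residual t alpha2 a2 bm b2 eta / model_residual X beta alpha2 k eta) `^ (N + (r * #|k|)%:R) *
    scaled_residual t alpha2 a2 bm b2 eta `^ (- N))%:E)%E.
  by apply: (@model_evidence_le R n p r X A t beta alpha1 alpha2 a1 a2 s e bm b2).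
have fk : model_evidence r X A beta alpha1 alpha2 k eta \is a fin_num.
  by rewrite ge0_fin_numE ?model_evidence_ge0//; exact: le_lt_trans hk (ltry _).
by split => //; rewrite -lee_fin fineK.
Qed.

Lemma fine_true_evidence_ge eta : good_noise X t s bm eta ->
  evidence_base n alpha1 alpha2 * (expR (- (1 / 2)) / 4) *
    (true_factor r t alpha2 a1 a2 s bm b2 * e^-1 * n%:R ^+ r.+1) ^- #|t| *
    scaled_residual t alpha2 a2 bm b2 eta `^ (- N) <=
  fine (model_evidence r X A beta alpha1 alpha2 t eta).
Proof.
move=> gn; have [tn rt] := model_size tq; have [ft _] := fine_model_evidence_le tq gn.
rewrite -lee_fin fineK//.
by apply: (@true_evidence_ge R n p r X A t beta alpha1 alpha2 a1 a2 s e bm b2) => //; apply: le_trans N2; rewrite ler1n.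
Qed.

Lemma true_evidence_lb_gt0 (eta : 'cV[R]_n) :
  0 < evidence_base n alpha1 alpha2 * (expR (- (1 / 2)) / 4) *
    (true_factor r t alpha2 a1 a2 s bm b2 * e^-1 * n%:R ^+ r.+1) ^- #|t| *
    scaled_residual t alpha2 a2 bm b2 eta `^ (- N).
Proof.
have K0 := evidence_base_gt0 n0 alpha10 alpha20.
have S0 := scaled_residual_gt0 t bm b2 alpha20 a20 eta.
have T0 := true_factor_gt0 r t b2 alpha20 a10 a20 s0 bm0.
have nn0 : 0 < n%:R :> R by rewrite ltr0n.
by positivity.
Qed.

Lemma evidence_ratio_le (k : {set 'I_p}) eta : #|k|%:R <= q -> good_noise X t s bm eta ->
  fine (marginal r alpha1 alpha2 X A k (X *m beta + eta)) /
  fine (marginal r alpha1 alpha2 X A t (X *m beta + eta)) <=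
  evidence_coef k * (model_residual X beta alpha2 k eta / scaled_residual t alpha2 a2 bm b2 eta) `^
     (- (N + (r * #|k|)%:R)).
Proof.
move=> kq gn; have [tn rt] := model_size tq; have [kn rk] := model_size kq.
have K0 := evidence_base_gt0 n0 alpha10 alpha20.
have S0 := scaled_residual_gt0 t bm b2 alpha20 a20 eta.
have B0 := model_residual_gt0 X beta alpha20 k eta.
set S := scaled_residual _ _ _ _ _ _ in S0 *; set B := model_residual _ _ _ _ _ in B0 *.
have [_ hk] := fine_model_evidence_le kq gn.
have ht := fine_true_evidence_ge gn; have lb0 := true_evidence_lb_gt0 eta.
rewrite -/S -/B in hk; rewrite -/S in ht lb0.
set G := (_ ^- #|t|) in ht lb0.
have nn0 : 0 < n%:R :> R by rewrite ltr0n.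
have T0 := true_factor_gt0 r t b2 alpha20 a10 a20 s0 bm0.
have G0 : 0 < G by rewrite /G; positivity.
have SN : 0 < S `^ (- N) by rewrite powR_gt0.
have fk0 : 0 <= fine (model_evidence r X A beta alpha1 alpha2 k eta).
  exact/fine_ge0/model_evidence_ge0.
change (fine (model_evidence r X A beta alpha1 alpha2 k eta) /
  fine (model_evidence r X A beta alpha1 alpha2 t eta) <=
  evidence_coef k * (B / S) `^ (- (N + (r * #|k|)%:R))).
move: (fine (model_evidence r X A beta alpha1 alpha2 k eta))
  (fine (model_evidence r X A beta alpha1 alpha2 t eta)) hk ht fk0 => mk mt hk ht fk0.
apply: le_trans (ler_pM fk0 _ hk (_ : _ <= (evidence_base n alpha1 alpha2 * (expR (- (1 / 2)) / 4) * G * S `^ (- N))^-1)) _.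
- by rewrite invr_ge0 (le_trans (ltW lb0)).
- by rewrite lef_pV2 ?posrE// (lt_le_trans lb0).
have -> : (B / S) `^ (- (N + (r * #|k|)%:R)) = (S / B) `^ (N + (r * #|k|)%:R).
  rewrite -[S / B]invrK invf_div -[(B / S)^-1]powR_inv1 ?divr_ge0 ?ltW//.
  by rewrite -powRrM mulN1r.
rewrite /evidence_coef /base_ratio le_eqVlt; apply/orP; left; apply/eqP.
rewrite -[(true_factor _ _ _ _ _ _ _ _ * _ * _) ^+ _]invrK -/G.
have E0 : expR (- (1 / 2)) != 0 :> R by rewrite lt0r_neq0// expR_gt0.
have key (K i M U Sn E G' : R) : K != 0 -> Sn != 0 -> E != 0 -> G' != 0 ->
    K * i * M * U * Sn / (K * (E / 4) * G' * Sn) = i / (E / 4) * M * G'^-1 * U.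
  by move=> *; field; do ?[apply/andP; split].
by apply: key => //; rewrite lt0r_neq0.
Qed.

Lemma posterior_error_le eta : good_noise X t s bm eta ->
  `|posterior r alpha1 alpha2 c1 c2 q X A t (X *m beta + eta) - 1| <=
  \sum_(k : {set 'I_p} | (k != t) && (#|k|%:R <= q)) prior_ratio k * (evidence_coef k *
     (model_residual X beta alpha2 k eta / scaled_residual t alpha2 a2 bm b2 eta) `^
     (- (N + (r * #|k|)%:R))).
Proof.
move=> gn; rewrite /posterior.
set m := fun k : {set 'I_p} => fine (marginal r alpha1 alpha2 X A k (X *m beta + eta)).
set a := fun k : {set 'I_p} => model_prior c1 c2 q k * m k.
have W0 : 0 < \sum_(j : {set 'I_p}) complexity_weight c1 c2 q j.
  rewrite (bigD1 t)//= ltr_pwDl ?complexity_weight_gt0//.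
  by apply: sumr_ge0 => k _; exact: complexity_weight_ge0.
have m0 k : 0 <= m k by exact/fine_ge0/(@model_evidence_ge0 k eta).
have mt0 : 0 < m t by apply: lt_le_trans (true_evidence_lb_gt0 eta) (fine_true_evidence_ge gn).
have a0 k : 0 <= a k.
  by apply: mulr_ge0 (m0 k); apply: divr_ge0 (ltW W0); exact: complexity_weight_ge0.
have at0 : 0 < a t by rewrite !mulr_gt0 ?invr_gt0// complexity_weight_gt0.
apply: le_trans (normalized_weight_error a0 at0) _.
rewrite [leRHS]big_mkcondr/=; apply: ler_sum => k kt.
have -> : a k / a t = prior_ratio k * (m k / m t).
  rewrite /a /model_prior /prior_ratio; have := complexity_weight_gt0 tq.
  move/lt0r_neq0; move: (lt0r_neq0 W0) (lt0r_neq0 mt0).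
  move: (\sum_(j : {set _}) _) (complexity_weight _ _ _ k) (complexity_weight _ _ _ t) (m k) (m t) => *.
  by field; do ?[apply/andP; split].
case: ifP => kq; last by rewrite /prior_ratio /complexity_weight kq !mul0r.
rewrite ler_wpM2l ?evidence_ratio_le//.
by rewrite divr_ge0 ?complexity_weight_ge0.
Qed.

End posterior_ratio.

(** A factor that is at least 1 may be left unraised, so only the decaying factor [b] has to be
    followed through the power. *)
Lemma powR_factor_le (R : realType) (x a b g : R) : 0 <= x -> 1 <= a -> 0 <= b ->
  0 < g <= 1 -> x <= a * b -> x `^ g <= a * b `^ g.
Proof.
move=> x0 a1 b0 /andP[g0 g1] xab.
have a0 : 0 <= a by apply: le_trans a1.
apply: (@le_trans _ _ ((a * b) `^ g)).
  by apply: ge0_ler_powR; rewrite ?nnegrE ?(ltW g0)// mulr_ge0.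
rewrite powRM// ler_wpM2r ?powR_ge0//.
by rewrite -[leRHS]powRr1// ler_powR.
Qed.

(** * Bounds on the deterministic coefficients *)

Section coefficient_bounds.
Context (R : realType) (n p r : nat) (t : {set 'I_p})
  (alpha1 alpha2 a1 a2 s e bm b2 c1 c2 q : R).
Hypotheses (n0 : (0 < n)%N) (p0 : (0 < p)%N) (alpha10 : 0 < alpha1) (alpha20 : 0 < alpha2)
  (a10 : 0 < a1) (a20 : 0 < a2) (s0 : 0 < s) (e0 : 0 < e) (e1 : e <= 1) (bm0 : 0 < bm)
  (b20 : 0 <= b2) (c10 : 0 < c1) (c20 : 0 < c2) (tq : #|t|%:R <= q).

(** The maximum with 1 makes powers monotone in the exponent; [hpow r 2 ^+ #|t|] serves
    [evidence_coef_superset_le]. *)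
Definition size_rate : R :=
  Num.max 1 (model_factor r alpha1 a2 s b2) * hpow r 2 ^+ #|t| * e ^- (2 * r).+1.
Definition true_rate : R := Num.max 1 (true_factor r t alpha2 a1 a2 s bm b2) / e.
Definition base_bound : R := Num.max 1 (base_ratio R).

Let nn0 : 0 < n%:R :> R. Proof. by rewrite ltr0n. Qed.
Let nn1 : 1 <= n%:R :> R. Proof. by rewrite (ler_nat R 1 n). Qed.
Let pp1 : 1 <= p%:R :> R. Proof. by rewrite (ler_nat R 1 p). Qed.
Let pp0 : 0 < p%:R :> R. Proof. by rewrite ltr0n. Qed.
Let mf0 : 0 < model_factor r alpha1 a2 s b2. Proof.
have h : sqn (0 : 'cV[R]_p) <= b2 by rewrite /sqn big1// => i _; rewrite mxE expr0n.
exact: (model_factor_gt0 r s alpha10 a20 h).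
Qed.
Let tf0 : 0 < true_factor r t alpha2 a1 a2 s bm b2. Proof. exact: true_factor_gt0. Qed.

Let hpow21 : 1 <= hpow r 2 :> R.
Proof.
rewrite /hpow -[leLHS]mulr1; apply: ler_pM => //.
  by rewrite exprn_ege1// ler1n.
by rewrite -[leLHS]sqrtr1 ler_wsqrtr// ler1n.
Qed.

Lemma size_rate_ge1 : 1 <= size_rate.
Proof.
rewrite /size_rate -[leLHS]mulr1 ler_pM//; last by rewrite -exprVn exprn_ege1// invf_ge1.
by rewrite -[leLHS]mulr1 ler_pM// ?exprn_ege1// le_max lexx.
Qed.

Lemma true_rate_ge1 : 1 <= true_rate.
Proof.
by rewrite /true_rate -[leLHS]mulr1 ler_pM// ?invf_ge1// le_max lexx.
Qed.

Lemma base_bound_ge1 : 1 <= base_bound. Proof. by rewrite le_max lexx. Qed.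

Lemma size_fraction_le1 (k : {set 'I_p}) : (#|k| <= n)%N ->
  hpow r (#|k|%:R / n%:R) / Num.sqrt n%:R <= 1 :> R.
Proof.
move=> kn; rewrite ler_pdivrMr ?sqrtr_gt0// mul1r.
have h : #|k|%:R / n%:R <= 1 :> R by rewrite ler_pdivrMr// mul1r ler_nat.
apply: (@le_trans _ _ 1).
  apply: (@le_trans _ _ (hpow r 1)); last by rewrite /hpow expr1n sqrtr1 mulr1.
  by apply: ler_hpow => //; rewrite divr_ge0.
by rewrite -[leLHS]sqrtr1 ler_wsqrtr.
Qed.

Lemma evidence_coef_ge0 (k : {set 'I_p}) : 0 <= evidence_coef n r t alpha1 alpha2 a1 a2 s e bm b2 k.
Proof.
by have := base_ratio_gt0 R => ?; rewrite /evidence_coef; positivity.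
Qed.

(** A crude bound for models missing an index of [t]: the surviving power of [n] is left to the
    exponential signal factor. *)
Lemma evidence_coef_le (k : {set 'I_p}) : (#|k| <= n)%N ->
  evidence_coef n r t alpha1 alpha2 a1 a2 s e bm b2 k <=
  base_bound * size_rate ^+ #|k| * (true_rate * n%:R ^+ r.+1) ^+ #|t|.
Proof.
move=> kn; have br0 := base_ratio_gt0 R.
have sr0 : 0 <= size_rate by apply: le_trans size_rate_ge1.
have tr0 : 0 <= true_rate by apply: le_trans true_rate_ge1.
rewrite /evidence_coef; apply: ler_pM; [by positivity|by positivity| |].
- apply: ler_pM; [exact: ltW|by positivity|by rewrite le_max lexx orbT|].
  apply: lerXn2r; rewrite ?nnegrE; [by positivity|by []|].
  rewrite -mulrA -[leRHS]mulr1; apply: ler_pM; [by positivity|by positivity| |exact: size_fraction_le1].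
  rewrite /size_rate ler_wpM2r//; first by positivity.
  rewrite -[leLHS]mulr1 ler_pM ?exprn_ege1// ?(ltW mf0)//.
  by rewrite le_max lexx orbT.
- apply: lerXn2r; rewrite ?nnegrE; [by positivity|by positivity|].
  rewrite ler_wpM2r//.
  by rewrite ler_wpM2r ?invr_ge0 ?(ltW e0)// le_max lexx orbT.
Qed.

(** No exponential helps here, so the power of [n] from the evidence of [t] must cancel: [|t|] of
    the [|k|] factors, each [hpow r k / n ^ (r + 1)], do this, and every index outside [t] keeps
    [1 / sqrt n]. *)
Lemma evidence_coef_superset_le (k : {set 'I_p}) : (#|k| <= n)%N -> t \subset k ->
  evidence_coef n r t alpha1 alpha2 a1 a2 s e bm b2 k <=
  base_bound * size_rate ^+ #|k| * true_rate ^+ #|t| * (Num.sqrt n%:R) ^- #|k :\: t|.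
Proof.
move=> kn tk; have br0 := base_ratio_gt0 R.
have kE : #|k| = (#|t| + #|k :\: t|)%N by rewrite -(cardsID t k) (finset.setIidPr tk).
set j := #|k :\: t| in kE *.
have sr0 : 0 <= size_rate by apply: le_trans size_rate_ge1.
have tr0 : 0 <= true_rate by apply: le_trans true_rate_ge1.
set mf := model_factor r alpha1 a2 s b2; set tf := true_factor r t alpha2 a1 a2 s bm b2.
(* [hpow k <= hpow 2 ^ k] absorbs the [#|t|] excess factors *)
have hfrac : (hpow r (#|k|%:R / n%:R) / Num.sqrt n%:R) ^+ #|k| * (n%:R ^+ r.+1) ^+ #|t| <=
    (hpow r 2 ^+ #|t|) ^+ #|k| * (Num.sqrt n%:R) ^- j :> R.
  have h1 : hpow r (#|k|%:R / n%:R) / Num.sqrt n%:R = hpow r #|k|%:R / n%:R ^+ r.+1 :> R.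
    have -> : n%:R ^+ r.+1 = hpow r n%:R * Num.sqrt n%:R :> R.
      by rewrite exprSr /hpow -mulrA -expr2 sqr_sqrtr// ltW.
    have -> : hpow r (#|k|%:R / n%:R) = hpow r #|k|%:R / hpow r n%:R :> R.
      by rewrite hpowM// /hpow (sqrtrV (ltW nn0)) exprVn -invfM.
    by rewrite [in RHS]invfM mulrA.
  have m0 : 0 < n%:R ^+ r.+1 :> R by rewrite exprn_gt0.
  have H0 : 0 <= hpow r #|k|%:R :> R by positivity.
  have h2 : hpow r #|k|%:R ^+ #|t| <= (hpow r 2 ^+ #|t|) ^+ #|k| :> R.
    rewrite -exprM mulnC exprM; apply: lerXn2r; rewrite ?nnegrE//.
      by apply: exprn_ge0; apply: le_trans hpow21.
    have hp (m : nat) : hpow r (2 ^+ m) = hpow r 2 ^+ m :> R.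
      elim: m => [|m IH]; first by rewrite !expr0 /hpow expr1n sqrtr1 mulr1.
      by rewrite !exprS hpowM// IH.
    rewrite -hp; apply: ler_hpow => //.
    by rewrite -natrX ler_nat ltnW// ltn_expl.
  rewrite h1 [in X in _ ^+ X * _]kE exprD -mulrA mulrC -mulrA.
  have h3 : (hpow r #|k|%:R / n%:R ^+ r.+1) ^+ j <= (Num.sqrt n%:R) ^- j :> R.
    rewrite -[leRHS]exprVn; apply: lerXn2r; rewrite ?nnegrE; [by positivity|by positivity|].
    rewrite -h1 -[leRHS]mul1r ler_wpM2r ?invr_ge0 ?sqrtr_ge0//.
    apply: (@le_trans _ _ (hpow r 1)); last by rewrite /hpow expr1n sqrtr1 mulr1.
    by apply: ler_hpow; [rewrite divr_ge0|rewrite ler_pdivrMr// mul1r ler_nat].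
  rewrite mulrC; apply: le_trans (ler_pM _ _ h2 h3); [|by positivity|by positivity].
  rewrite le_eqVlt; apply/orP; left; apply/eqP.
  rewrite [(_ / _) ^+ #|t|]exprMn exprVn.
  have := expf_neq0 #|t| (lt0r_neq0 m0).
  by move: (_ ^+ #|t|) (_ ^+ j) (_ ^+ #|t|) => *; field.
have -> : evidence_coef n r t alpha1 alpha2 a1 a2 s e bm b2 k =
   base_ratio R * (mf * e ^- (2 * r).+1) ^+ #|k| * (tf / e) ^+ #|t| *
   ((hpow r (#|k|%:R / n%:R) / Num.sqrt n%:R) ^+ #|k| * (n%:R ^+ r.+1) ^+ #|t|).
  rewrite /evidence_coef -/mf -/tf -[X in (X)^+ #|k|](_ : mf * e ^- (2 * r).+1 * (hpow r (#|k|%:R / n%:R) / Num.sqrt n%:R) = _); last by rewrite !mulrA.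
  rewrite [(mf * _ * (_ / _)) ^+ _]exprMn [(tf / e * _) ^+ _]exprMn.
  by move: (_ ^+ #|k|) (_ ^+ #|k|) (_ ^+ #|t|) (_ ^+ #|t|) => *; ring.
apply: (@le_trans _ _ (base_bound * (Num.max 1 mf * e ^- (2 * r).+1) ^+ #|k| * true_rate ^+ #|t| *
    ((hpow r 2 ^+ #|t|) ^+ #|k| * (Num.sqrt n%:R) ^- j))); last first.
  have -> : size_rate = Num.max 1 mf * e ^- (2 * r).+1 * hpow r 2 ^+ #|t| by rewrite /size_rate mulrAC.
  rewrite [leRHS](_ : _ = base_bound * (Num.max 1 mf * e ^- (2 * r).+1) ^+ #|k| * true_rate ^+ #|t| *
    ((hpow r 2 ^+ #|t|) ^+ #|k| * (Num.sqrt n%:R) ^- j))//.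
  rewrite [(_ * hpow r 2 ^+ #|t|) ^+ _]exprMn.
  have key (B a h' T' S' : R) : B * (a * h') * T' * S' = B * a * T' * (h' * S') by ring.
  exact: key.
have max0 (x : R) : 0 <= Num.max 1 x by rewrite le_max ler01.
apply: ler_pM; [by positivity|by positivity| |exact: hfrac].
apply: ler_pM; [by positivity|by positivity| |].
  apply: ler_pM; [exact: ltW|by positivity|by rewrite le_max lexx orbT|].
  apply: lerXn2r; rewrite ?nnegrE; [by positivity|by rewrite mulr_ge0//; positivity|].
  by rewrite ler_wpM2r ?le_max ?lexx ?orbT//; positivity.
apply: lerXn2r; rewrite ?nnegrE; [by positivity|by []|].
by rewrite ler_wpM2r ?invr_ge0 ?(ltW e0)// le_max lexx orbT.
Qed.

Let cm : R := Num.max 1 c1^-1.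
Let cM : R := Num.max 1 c1.

Let cm1 : 1 <= cm. Proof. by rewrite le_max lexx. Qed.
Let cM1 : 1 <= cM. Proof. by rewrite le_max lexx. Qed.

Let c1cm : c1^-1 <= cm. Proof. by rewrite le_max lexx orbT. Qed.
Let c1cM : c1 <= cM. Proof. by rewrite le_max lexx orbT. Qed.
Let cm0 : 0 <= cm. Proof. exact: le_trans cm1. Qed.
Let cM0 : 0 <= cM. Proof. exact: le_trans cM1. Qed.

Let pw (m : nat) : p%:R `^ (- (c2 * m%:R)) = (p%:R `^ (- c2)) ^+ m :> R.
Proof. by rewrite -powR_mulrn ?powR_ge0// -powRrM mulNr. Qed.

Let pc0 : 0 < p%:R `^ (- c2) :> R. Proof. by rewrite powR_gt0. Qed.

Lemma prior_ratioE (k : {set 'I_p}) : #|k|%:R <= q ->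
  prior_ratio t c1 c2 q k =
  c1^-1 ^+ #|k| * c1 ^+ #|t| * (p%:R `^ (- c2)) ^+ #|k| * (p%:R `^ c2) ^+ #|t|.
Proof.
move=> kq; rewrite /prior_ratio /complexity_weight kq tq !pw.
have -> : p%:R `^ c2 = (p%:R `^ (- c2))^-1 :> R by rewrite powRN invrK.
rewrite !exprVn.
have := expf_neq0 #|t| (lt0r_neq0 c10); have := expf_neq0 #|t| (lt0r_neq0 pc0).
have := expf_neq0 #|k| (lt0r_neq0 c10).
have key (a b u v : R) : a != 0 -> v != 0 -> b != 0 -> a^-1 * u / (b^-1 * v) = a^-1 * b * u / v.
  by move=> *; field; do ?[apply/andP; split].
exact: key.
Qed.

(** Only the indices outside [t] are credited, so the prior cost of all of [t] survives as
    [p ^ (c2 |t|)], again left to the exponential. *)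
Lemma prior_ratio_le (k : {set 'I_p}) : #|k|%:R <= q ->
  prior_ratio t c1 c2 q k <= cm ^+ #|k| * (cM * p%:R `^ c2) ^+ #|t| * (p%:R `^ (- c2)) ^+ #|k :\: t|.
Proof.
move=> kq; rewrite prior_ratioE// exprMn.
have jk : (#|k :\: t| <= #|k|)%N by rewrite subset_leq_card// subsetDl.
rewrite [leRHS](_ : _ = cm ^+ #|k| * cM ^+ #|t| * (p%:R `^ (- c2)) ^+ #|k :\: t| * (p%:R `^ c2) ^+ #|t|); last first.
  by move: (_ ^+ _) (_ ^+ _) (_ ^+ _) (_ ^+ _) => *; ring.
apply: ler_wpM2r; first by positivity.
apply: ler_pM; [by positivity|by positivity| |].
  apply: ler_pM; [by positivity|by positivity| |].
    by apply: lerXn2r => //; rewrite nnegrE// invr_ge0 ltW.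
  by apply: lerXn2r => //; rewrite nnegrE// ltW.
apply: ler_wiXn2l => //.
by rewrite -[leRHS](powRr0 p%:R) ler_powR// oppr_le0 ltW.
Qed.

Lemma prior_ratio_superset_le (k : {set 'I_p}) : #|k|%:R <= q -> t \subset k ->
  prior_ratio t c1 c2 q k <= cm ^+ #|k| * (p%:R `^ (- c2)) ^+ #|k :\: t|.
Proof.
move=> kq tk; rewrite prior_ratioE//.
have kE : #|k| = (#|t| + #|k :\: t|)%N by rewrite -(cardsID t k) (finset.setIidPr tk).
rewrite kE; set j := #|k :\: t|; set m := #|t|.
have -> : c1^-1 ^+ (m + j) * c1 ^+ m * (p%:R `^ (- c2)) ^+ (m + j) * (p%:R `^ c2) ^+ m =
   c1^-1 ^+ j * (p%:R `^ (- c2)) ^+ j.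
  have -> : p%:R `^ c2 = (p%:R `^ (- c2))^-1 :> R by rewrite powRN invrK.
  rewrite !exprD !exprVn.
  have := expf_neq0 m (lt0r_neq0 c10); have := expf_neq0 j (lt0r_neq0 c10).
  have := expf_neq0 m (lt0r_neq0 pc0).
  have key (a b v w : R) : a != 0 -> b != 0 -> w != 0 ->
      b^-1 * a^-1 * b * (w * v) / w = a^-1 * v.
    by move=> *; field; do ?[apply/andP; split].
  by move=> *; apply: key.
apply: ler_wpM2r; first by positivity.
apply: (@le_trans _ _ (cm ^+ j)).
  by apply: lerXn2r => //; rewrite nnegrE// invr_ge0 ltW.
by apply: ler_weXn2l => //; rewrite leq_addl.
Qed.

End coefficient_bounds.

Lemma powR_exprn (R : realType) (x g : R) (j : nat) : 0 <= x -> (x ^+ j) `^ g = (x `^ g) ^+ j.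
Proof. by move=> x0; rewrite -powR_mulrn// -powRrM mulrC powRrM powR_mulrn ?powR_ge0. Qed.

(** * Probability bound at a fixed sample size *)

Section finite_sample.
Context (R : realType) d (T : measurableType d) (P : probability T R) (n p r : nat)
  (X : 'M[R]_(n, p)) (A : 'M[R]_p) (t : {set 'I_p}) (beta : 'cV[R]_p)
  (eps : 'I_n -> {RV P >-> R}) (alpha1 alpha2 a1 a2 s e bm b2 c1 c2 q de : R) (K : nat).
Hypotheses (n0 : (0 < n)%N) (alpha10 : 0 < alpha1) (alpha20 : 0 < alpha2)
  (a10 : 0 < a1) (a20 : 0 < a2) (s0 : 0 < s) (e0 : 0 < e) (e1 : e <= 1) (bm0 : 0 < bm)
  (c10 : 0 < c1) (c20 : 0 < c2) (de0 : 0 < de) (de8 : de <= 1 / 8) (c2de : 1 <= c2 * (1 - 4 * de))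
  (gram_lb : forall k : {set 'I_p}, (#|k| <= n)%N -> forall b,
     n%:R * e * sqn b <= sqn (submodel_mx X k *m b))
  (gram_ub : forall k : {set 'I_p}, (#|k| <= n)%N -> forall b,
     sqn (submodel_mx X k *m b) <= n%:R / e * sqn b)
  (principal_quad : forall (k : {set 'I_p}) b,
     a1 * sqn b <= (b^T *m principal_mx A k *m b) 0 0 <= a2 * sqn b)
  (principal_det : forall k : {set 'I_p}, 0 < \det (principal_mx A k))
  (beta_out : forall j, j \notin t -> beta j 0 = 0)
  (beta_in : forall j, j \in t -> bm <= `|beta j 0|)
  (beta_b2 : sqn beta <= b2) (tq : #|t|%:R <= q)
  (eps_normal : forall (i : 'I_n) (B : set R), measurable B ->
     distribution P (eps i) B = normal_prob 0 s B)
  (eps_indep : mutually_independent eps)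
  (size_small : forall k : {set 'I_p}, #|k|%:R <= q -> alpha1 + r.+1%:R * #|k|%:R <= de * n%:R)
  (size_K : forall k : {set 'I_p}, #|k|%:R <= q -> (#|k| <= K)%N)
  (N2 : 2 <= n%:R / 2 + alpha1).

Let ga : R := 1 - 4 * de.
Let coef k := prior_ratio t c1 c2 q k * evidence_coef n r t alpha1 alpha2 a1 a2 s e bm b2 k.
Let G : R := (e * Num.sqrt de)^-1.
Let cm : R := Num.max 1 c1^-1.
Let cM : R := Num.max 1 c1.
Let sr := size_rate r t alpha1 a2 s e b2.
Let tr := true_rate r t alpha2 a1 a2 s e bm b2.
Let ch := chernoff_const t alpha2 a2 s bm b2 de.
Let E16 : R := expR (- (signal_rate s bm de / 16 * (e * n%:R))).

(** Cost of one index of a model: prior constant, evidence bound, and condition number from the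
    Chernoff bound. *)
Definition growth_rate : R := cm * sr * G.
Definition superset_bound : R :=
  ch * base_bound R * tr ^+ #|t| * growth_rate ^+ #|t|.+1 / Num.sqrt (Num.sqrt n%:R).
Definition missing_bound : R :=
  ch * base_bound R * (cM * p%:R `^ c2 * (tr * n%:R ^+ r.+1)) ^+ #|t| * growth_rate ^+ K * E16.

Hypothesis growth_small : growth_rate <= Num.sqrt (Num.sqrt n%:R).

Let nn0 : 0 < n%:R :> R. Proof. by rewrite ltr0n. Qed.
Let nn1 : 1 <= n%:R :> R. Proof. by rewrite (ler_nat R 1 n). Qed.
Let b20 : 0 <= b2. Proof. exact: le_trans (sqn_ge0 _) beta_b2. Qed.
Let sr1 : 1 <= sr. Proof. exact: size_rate_ge1. Qed.
Let tr1 : 1 <= tr. Proof. exact: true_rate_ge1. Qed.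
Let bb1 : 1 <= base_bound R. Proof. exact: base_bound_ge1. Qed.
Let cm1 : 1 <= cm. Proof. by rewrite le_max lexx. Qed.
Let cM1 : 1 <= cM. Proof. by rewrite le_max lexx. Qed.
Let ch0 : 0 < ch. Proof. exact: chernoff_const_gt0. Qed.
Let ga0 : 0 < ga <= 1. Proof. by apply/andP; split; rewrite /ga; move: de0 de8; lra. Qed.
Let G1 : 1 <= G.
Proof.
rewrite /G invf_ge1; last by positivity.
rewrite -[leRHS]mulr1; apply: ler_pM; rewrite ?sqrtr_ge0 ?(ltW e0)//.
by rewrite -sqrtr1 ler_wsqrtr//; move: de8; lra.
Qed.
Let gr1 : 1 <= growth_rate.
Proof. by rewrite /growth_rate -[leLHS]mulr1 ler_pM// -[leLHS]mulr1 ler_pM. Qed.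

Lemma model_card_small (k : {set 'I_p}) : #|k|%:R <= q -> (2 * #|k| <= n)%N.
Proof.
move=> /size_small h; rewrite -(ler_nat R) natrM.
have key (k' r' n' : R) : 0 <= k' -> 0 <= r' -> 0 <= n' -> alpha1 + (r' + 1) * k' <= de * n' -> 2 * k' <= n'.
  move=> k0 r0 n'0 h'; have := mulr_ge0 r0 k0; have := ler_wpM2r n'0 de8; move: alpha10; lra.
by apply: (key _ r%:R) => //; rewrite natr1.
Qed.

Lemma model_card_le (k : {set 'I_p}) : #|k|%:R <= q -> (#|k| <= n)%N.
Proof. by move=> /model_card_small; apply: leq_trans; rewrite leq_pmull. Qed.

Lemma model_card_moment (k : {set 'I_p}) : #|k|%:R <= q ->
  (#|k| <= n)%N /\ (r * #|k|)%:R <= (n%:R / 2 + alpha1) / 2.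
Proof.
move=> kq; split; first exact: model_card_le.
have := size_small kq; rewrite natrM -natr1 => h.
have key (k' r' n' : R) : 0 <= k' -> 0 <= r' -> 0 <= n' -> alpha1 + (r' + 1) * k' <= de * n' -> r' * k' <= (n' / 2 + alpha1) / 2.
  by move=> k0 r0 n'0 h'; have := mulr_ge0 r0 k0; have := ler_wpM2r n'0 de8; move: alpha10; lra.
exact: key.
Qed.

Lemma model_cardU_le (k : {set 'I_p}) : #|k|%:R <= q -> (#|k :|: t| <= n)%N.
Proof.
move=> kq; have h1 := model_card_small kq; have h2 := model_card_small tq.
apply: (@leq_trans (#|k| + #|t|)); first by rewrite cardsU leq_subr.
by rewrite -(@leq_pmul2l 2)// mulnDr (leq_trans (leq_add h1 h2))// mul2n addnn.
Qed.

Lemma coef_ge0 k : 0 <= coef k.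
Proof.
by rewrite mulr_ge0 ?evidence_coef_ge0// divr_ge0 ?complexity_weight_ge0.
Qed.

Let neq_model_gt0 (k : {set 'I_p}) : k != t -> (0 < p)%N.
Proof.
move=> kt; rewrite lt0n; apply: contra kt => /eqP p0.
by apply/eqP/setP => i; have := ltn_ord i; rewrite [X in (_ < X)%N]p0.
Qed.

Let pow_p : (0 < p)%N -> (p%:R `^ (- c2)) `^ ga <= p%:R^-1 :> R.
Proof.
move=> p0; have pp1 : 1 <= p%:R :> R by rewrite (ler_nat R 1 p).
rewrite -powRrM -powR_inv1//.
by rewrite ler_powR// mulNr lerN2.
Qed.

(** Raising to the power [ga >= 1 / 2] turns [1 / sqrt n] into at most [n ^ (-1/4)], the double
    root, and [p ^ (- c2)] into at most [1 / p], per index outside [t]. *)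
Lemma superset_term_le (k : {set 'I_p}) : #|k|%:R <= q -> t \subset k -> k != t ->
  coef k `^ ga * (ch * (e * Num.sqrt de) ^- #|k|) <= superset_bound * p%:R ^- #|k :\: t|.
Proof.
move=> kq tk kt; have kn := model_card_le kq; have p0 := neq_model_gt0 kt.
have pp0 : 0 < p%:R :> R by rewrite ltr0n.
have kE : #|k| = (#|t| + #|k :\: t|)%N by rewrite -(cardsID t k) (finset.setIidPr tk).
have j0 : (0 < #|k :\: t|)%N.
  rewrite card_gt0; apply: contra kt; rewrite finset.setD_eq0 => h.
  by rewrite finset.eqEsubset h tk.
set j := #|k :\: t| in kE j0 *.
have sn0 : 0 < Num.sqrt n%:R :> R by rewrite sqrtr_gt0.
have ssn0 : 0 < Num.sqrt (Num.sqrt n%:R) :> R by rewrite sqrtr_gt0.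
have h1 := prior_ratio_superset_le c2 p0 c10 tq kq tk; rewrite -/cm -/j in h1.
have h2 := evidence_coef_superset_le r n0 alpha10 alpha20 a10 a20 s0 e0 e1 bm0 b20 kn tk.
rewrite -/sr -/tr -/j in h2.
have h : coef k <= base_bound R * (cm * sr) ^+ #|k| * tr ^+ #|t| * (p%:R `^ (- c2) / Num.sqrt n%:R) ^+ j.
  apply: le_trans (ler_pM _ _ h1 h2) _.
  - by rewrite divr_ge0 ?complexity_weight_ge0.
  - exact: evidence_coef_ge0.
  rewrite [(cm * sr) ^+ _]exprMn [(p%:R `^ _ / _) ^+ _]exprMn [(Num.sqrt n%:R)^-1 ^+ _]exprVn.
  rewrite le_eqVlt; apply/orP; left; apply/eqP.
  have key (a b' c u v w : R) : a * b' * (c * u * v * w) = c * (a * u) * v * (b' * w) by ring.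
  exact: key.
have a1' : 1 <= base_bound R * (cm * sr) ^+ #|k| * tr ^+ #|t|.
  by rewrite -[leLHS]mulr1 ler_pM ?exprn_ege1// -[leLHS]mulr1 ler_pM ?exprn_ege1// -[leLHS]mulr1 ler_pM.
have b0 : 0 <= (p%:R `^ (- c2) / Num.sqrt n%:R) ^+ j.
  by rewrite exprn_ge0// divr_ge0 ?powR_ge0// ltW.
have hp := powR_factor_le (coef_ge0 k) a1' b0 ga0 h.
have hb : ((p%:R `^ (- c2) / Num.sqrt n%:R) ^+ j) `^ ga <= (p%:R^-1 / Num.sqrt (Num.sqrt n%:R)) ^+ j :> R.
  rewrite powR_exprn; last by positivity.
  apply: lerXn2r; rewrite ?nnegrE ?powR_ge0//.
  rewrite powRM ?powR_ge0 ?invr_ge0 ?(ltW sn0)//; apply: ler_pM; rewrite ?powR_ge0 ?pow_p//.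
  rewrite -powR_inv1 ?(ltW sn0)// -powRrM mulN1r.
  have -> : (Num.sqrt (Num.sqrt n%:R))^-1 = Num.sqrt n%:R `^ (- (1 / 2)) :> R.
    by rewrite powRN div1r powR12_sqrt// ltW.
  apply: ler_powR; first by rewrite -[leLHS]sqrtr1 ler_wsqrtr.
  by rewrite lerN2 /ga; move: de8; lra.
have hG : (e * Num.sqrt de) ^- #|k| = G ^+ #|k| by rewrite /G exprVn.
rewrite hG; set bd := base_bound R * (cm * sr) ^+ #|k| * tr ^+ #|t| in a1' hp.
have bd0 : 0 <= bd by exact: le_trans a1'.
have hp2 := le_trans hp (ler_wpM2l bd0 hb).
have Gk0 : 0 <= G ^+ #|k| by rewrite exprn_ge0// (le_trans _ G1).
apply: (@le_trans _ _ (bd * (p%:R^-1 / Num.sqrt (Num.sqrt n%:R)) ^+ j * (ch * G ^+ #|k|))).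
  by rewrite ler_wpM2r// mulr_ge0// ltW.
(* The base is at most 1 by [growth_small] and [j >= 1]; keeping a single factor makes the bound
   uniform in [k]. *)
have hj : (growth_rate / Num.sqrt (Num.sqrt n%:R)) ^+ j <= growth_rate / Num.sqrt (Num.sqrt n%:R).
  apply: ler_iXnr => //.
    by rewrite divr_ge0 ?(le_trans _ gr1)// ltW.
  by rewrite ler_pdivrMr// mul1r.
have gr0 : 0 <= growth_rate by exact: le_trans gr1.
have tr0 : 0 <= tr by exact: le_trans tr1.
have bb0 : 0 <= base_bound R by exact: le_trans bb1.
have Y0 : 0 <= ch * base_bound R * tr ^+ #|t| * growth_rate ^+ #|t| * p%:R ^- j by positivity.
have := ler_wpM2l Y0 hj.
have -> : superset_bound * p%:R ^- j = ch * base_bound R * tr ^+ #|t| * growth_rate ^+ #|t| * p%:R ^- j * (growth_rate / Num.sqrt (Num.sqrt n%:R)).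
  rewrite /superset_bound [growth_rate ^+ _]exprSr.
  by move: (growth_rate ^+ _) (p%:R ^- j) (tr ^+ _) (Num.sqrt (Num.sqrt _))^-1 => *; ring.
apply: le_trans; rewrite le_eqVlt; apply/orP; left; apply/eqP.
rewrite /bd [(p%:R^-1 / _) ^+ j]exprMn [(growth_rate / _) ^+ j]exprMn exprVn.
have -> : (cm * sr) ^+ #|k| = growth_rate ^+ #|t| * growth_rate ^+ j / G ^+ #|k|.
  rewrite -exprD -kE /growth_rate [(cm * sr * G) ^+ _]exprMn mulfK//.
  by rewrite expf_neq0// lt0r_neq0// (lt_le_trans _ G1).
have Gk : G ^+ #|k| != 0 by rewrite expf_neq0// lt0r_neq0// (lt_le_trans _ G1).
have key (b' u v g T' P' S' C : R) : g != 0 -> b' * (u * v / g) * T' * (P' * S') * (C * g) = C * b' * T' * u * P' * (v * S').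
  by move=> *; field.
exact: key.
Qed.

Lemma missing_term_le (k : {set 'I_p}) : #|k|%:R <= q -> k != t ->
  coef k `^ ga * (ch * (e * Num.sqrt de) ^- #|k| * E16) <= missing_bound * p%:R ^- #|k :\: t|.
Proof.
move=> kq kt; have kn := model_card_le kq; have kK := size_K kq; have p0 := neq_model_gt0 kt.
have pp0 : 0 < p%:R :> R by rewrite ltr0n.
have pp1 : 1 <= p%:R :> R by rewrite (ler_nat R 1 p).
have h1 := prior_ratio_le p0 c10 c20 tq kq; rewrite -/cm -/cM in h1.
have h2 := evidence_coef_le r t n0 alpha10 alpha20 a10 a20 s0 e0 e1 bm0 b20 kn.
rewrite -/sr -/tr in h2; set j := #|k :\: t| in h1 *.
have pc1 : 1 <= p%:R `^ c2 :> R by rewrite -[leLHS](powRr0 p%:R) ler_powR// ltW.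
have Q1 : 1 <= cM * p%:R `^ c2 * (tr * n%:R ^+ r.+1).
  by rewrite -[leLHS]mulr1 ler_pM// -[leLHS]mulr1 ler_pM// exprn_ege1.
set Q := cM * _ * _ in Q1.
have h : coef k <= base_bound R * (cm * sr) ^+ #|k| * Q ^+ #|t| * (p%:R `^ (- c2)) ^+ j.
  apply: le_trans (ler_pM _ _ h1 h2) _.
  - by rewrite divr_ge0 ?complexity_weight_ge0.
  - exact: evidence_coef_ge0.
  rewrite /Q [(cm * sr) ^+ _]exprMn [(cM * _ * _) ^+ _]exprMn.
  rewrite le_eqVlt; apply/orP; left; apply/eqP.
  have key (a b' c u v w : R) : a * b' * c * (u * v * w) = u * (a * v) * (b' * w) * c by ring.
  exact: key.
set bd := base_bound R * _ * _ in h.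
have a1' : 1 <= bd.
  by rewrite /bd -[leLHS]mulr1 ler_pM ?exprn_ege1// -[leLHS]mulr1 ler_pM ?exprn_ege1// -[leLHS]mulr1 ler_pM.
have b0 : 0 <= (p%:R `^ (- c2)) ^+ j :> R by rewrite exprn_ge0// powR_ge0.
have hp := powR_factor_le (coef_ge0 k) a1' b0 ga0 h.
have hb : ((p%:R `^ (- c2)) ^+ j) `^ ga <= p%:R ^- j :> R.
  rewrite powR_exprn ?powR_ge0//.
  by rewrite -exprVn; apply: lerXn2r; rewrite ?nnegrE ?powR_ge0 ?invr_ge0 ?pow_p.
have bd0 : 0 <= bd by exact: le_trans a1'.
have hp2 := le_trans hp (ler_wpM2l bd0 hb).
have G0 : 0 < G by apply: lt_le_trans G1.
have E0 : 0 <= E16 by exact: expR_ge0.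
have hG : (e * Num.sqrt de) ^- #|k| = G ^+ #|k| by rewrite /G exprVn.
rewrite hG; apply: (@le_trans _ _ (bd * p%:R ^- j * (ch * G ^+ #|k| * E16))).
  by rewrite ler_wpM2r// mulr_ge0// mulr_ge0 ?exprn_ge0 ?(ltW G0) ?(ltW ch0).
have gr0 : 0 <= growth_rate by exact: le_trans gr1.
have hK : growth_rate ^+ #|k| <= growth_rate ^+ K by exact: ler_weXn2l.
have bb0 : 0 <= base_bound R by exact: le_trans bb1.
have Q0 : 0 <= Q by exact: le_trans Q1.
have Y0 : 0 <= ch * base_bound R * Q ^+ #|t| * E16 * p%:R ^- j by positivity.
have := ler_wpM2l Y0 hK.
have key (a b' c u v w x y : R) : a * b' * u * w * y * v = a * b' * u * v * w * y by ring.
rewrite [leRHS](key _ _ 1 _ _ _ 1 _) -/Q.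
apply: le_trans; rewrite le_eqVlt; apply/orP; left; apply/eqP.
rewrite /bd /growth_rate [(cm * sr * G) ^+ _]exprMn.
have key2 (b' u T' P' C g E' : R) : b' * u * T' * P' * (C * g * E') = C * b' * T' * E' * P' * (u * g) by ring.
exact: key2.
Qed.

Let gr0 : 0 <= growth_rate. Proof. exact: le_trans gr1. Qed.
Let tr0 : 0 <= tr. Proof. exact: le_trans tr1. Qed.
Let bb0 : 0 <= base_bound R. Proof. exact: le_trans bb1. Qed.
Let cM0 : 0 <= cM. Proof. exact: le_trans cM1. Qed.

Lemma superset_bound_ge0 : 0 <= superset_bound.
Proof. by rewrite /superset_bound; positivity. Qed.

Lemma missing_bound_ge0 : 0 <= missing_bound.
Proof. by rewrite /missing_bound /E16; positivity. Qed.

Lemma posterior_consistent_prob (et : R) : 0 < et ->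
  (P [set w | et <= `|posterior r alpha1 alpha2 c1 c2 q X A t (X *m beta + noise eps w) - 1|]%R <=
  ((Num.sqrt 2 * expR (- 1)) ^+ n + (expR (1 / 8) / Num.sqrt 2) ^+ n +
   (e * Num.sqrt de) ^- #|t| * E16 +
   (superset_bound + missing_bound) * (2 ^+ #|t| * expR 1) / et `^ ga)%:E)%E.
Proof.
move=> et0.
set D := [set w | _].
pose D1 := [set w | 4 * s ^+ 2 * n%:R < sqn (noise eps w)].
pose D2 := [set w | sqn (noise eps w) < s ^+ 2 * n%:R / 4].
pose D3 := [set w | sqn (noise eps w) <= 4 * s ^+ 2 * n%:R /\
      bm ^+ 2 / 4 < sqn (lsq (submodel_mx X t) *m noise eps w)].
pose V k w := residual_quotient X t beta eps alpha2 a2 bm b2 k w.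
pose mo (k : {set 'I_p}) := moment_order n r alpha1 de k.
(* Zero weights extend the sum to all models, the range of [sum_subset_weights]. *)
pose B k := if (k != t) && (#|k|%:R <= q) then coef k `^ ga else 0.
pose F w := \sum_(k : {set 'I_p}) B k * V k w `^ (- mo k).
pose D4 := [set w | et `^ ga <= F w].
have mn := measurable_col_noise eps.
have msq : measurable_fun setT (fun w => sqn (noise eps w)) by exact: measurable_sqn.
have mlsq : measurable_fun setT (fun w => sqn (lsq (submodel_mx X t) *m noise eps w)).
  by apply: measurable_sqn; exact: measurable_col_mulmx.
have mV k : measurable_fun setT (fun w => V k w `^ (- mo k)).
  by apply: (measurableT_comp (f := fun x : R => x `^ _) (measurable_powR _)); exact: measurable_residual_quotient.
have B0 k : 0 <= B k by rewrite /B; case: ifP => // _; exact: powR_ge0.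
have F0 w : 0 <= F w by apply: sumr_ge0 => k _; rewrite mulr_ge0 ?powR_ge0.
have mF : measurable_fun setT F.
  by apply: measurable_sum => k; apply: measurable_funM.
have mD1 : measurable D1 by exact: measurable_lt_set.
have mD2 : measurable D2 by exact: measurable_lt_set.
have mD3 : measurable D3.
  rewrite (_ : D3 = [set w | sqn (noise eps w) <= 4 * s ^+ 2 * n%:R] `&`
    [set w | bm ^+ 2 / 4 < sqn (lsq (submodel_mx X t) *m noise eps w)])//.
  by apply: measurableI; [exact: measurable_le_set|exact: measurable_lt_set].
have mD4 : measurable D4 by exact: measurable_le_set.
have mD : measurable D.
  apply: measurable_le_set => //; apply: measurableT_comp => //; apply: measurable_funB => //.
  by apply: measurable_posterior => //; apply: measurable_colD => //; exact: measurable_col_cst.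
have DD : D `<=` D1 `|` D2 `|` D3 `|` D4.
  move=> w Dw; case: (ltP (4 * s ^+ 2 * n%:R) (sqn (noise eps w))) => [h|h1]; first by do 3 left.
  case: (ltP (sqn (noise eps w)) (s ^+ 2 * n%:R / 4)) => [h|h2]; first by do 2 left; right.
  case: (ltP (bm ^+ 2 / 4) (sqn (lsq (submodel_mx X t) *m noise eps w))) => [h|h3].
    by left; right.
  right; rewrite /D4/=.
  have gn : good_noise X t s bm (noise eps w) by split.
  have hp := posterior_error_le c2 n0 alpha10 alpha20 a10 a20 s0 e0 e1 bm0 c10 gram_lb gram_ub
    principal_quad principal_det beta_out beta_in beta_b2 tq model_card_moment N2 gn.
  have := le_trans Dw hp; rewrite -/(V _ w).
  have /andP[ga0' _] := ga0.
  (* Raising to the power [ga] before taking expectations lowers the exponents of the quotients to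
     [moment_order]. *)
  move=> h; apply: (@le_trans _ _ ((\sum_(k : {set 'I_p} | (k != t) && (#|k|%:R <= q))
     prior_ratio t c1 c2 q k * (evidence_coef n r t alpha1 alpha2 a1 a2 s e bm b2 k *
     V k w `^ (- (n%:R / 2 + alpha1 + (r * #|k|)%:R)))) `^ ga)).
    by apply: ge0_ler_powR; rewrite ?nnegrE ?(ltW ga0') ?(ltW et0) ?(le_trans (ltW et0))//; exact: h.
  apply: le_trans (powR_le_sum _ ga0 _) _.
    move=> k; apply: mulr_ge0; first by rewrite divr_ge0 ?complexity_weight_ge0.
    by rewrite mulr_ge0 ?powR_ge0 ?evidence_coef_ge0.
  rewrite /F big_mkcond/=; apply: ler_sum => k _; rewrite /B.
  case: ifP => _; last by rewrite mul0r.
  rewrite mulrA powRM ?powR_ge0 ?coef_ge0// -/(coef k) -powRrM.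
  by rewrite /mo /moment_order mulNr [X in - X]mulrC.
have hI k : (\int[P]_w (B k * V k w `^ (- mo k))%:E <= ((superset_bound + missing_bound) * p%:R ^- #|k :\: t|)%:E)%E.
  under eq_integral do rewrite EFinM.
  rewrite ge0_integralZl_EFin//; last 2 first.
  - by move=> w _; rewrite lee_fin powR_ge0.
  - by apply/measurable_EFinP.
  have pj0 : 0 <= p%:R ^- #|k :\: t| :> R by rewrite invr_ge0 exprn_ge0.
  rewrite /B; case: ifP => [/andP[kt kq]|_]; last first.
    by rewrite mul0e lee_fin mulr_ge0// addr_ge0 ?superset_bound_ge0 ?missing_bound_ge0.
  (* A model containing [t] is charged to [superset_bound], any other to [missing_bound]. *)
  rewrite mulrDl; case: (boolP (t \subset k)) => [tk|/subsetPn[j jt jk]].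
    apply: (@le_trans _ _ (coef k `^ ga * (ch * (e * Num.sqrt de) ^- #|k|))%:E).
      rewrite EFinM lee_wpmul2l ?lee_fin ?powR_ge0//.
      by apply: residual_moment_le => //; [exact: model_card_le|exact: size_small].
    rewrite lee_fin; apply: le_trans (superset_term_le kq tk kt) _.
    by rewrite lerDl mulr_ge0 ?missing_bound_ge0.
  apply: (@le_trans _ _ (coef k `^ ga * (ch * (e * Num.sqrt de) ^- #|k| * E16))%:E).
    rewrite EFinM lee_wpmul2l ?lee_fin ?powR_ge0//.
    by eapply residual_moment_missing_le; eauto; exact: model_cardU_le.
  rewrite lee_fin; apply: le_trans (missing_term_le kq kt) _.
  by rewrite lerDr mulr_ge0 ?superset_bound_ge0.
have hF : (\int[P]_w (F w)%:E <= ((superset_bound + missing_bound) * (2 ^+ #|t| * expR 1))%:E)%E.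
  under eq_integral do rewrite -sumEFin.
  rewrite ge0_integral_sum//; last 2 first.
  - by move=> k; apply/measurable_EFinP; apply: measurable_funM.
  - by move=> k w _; rewrite lee_fin mulr_ge0 ?powR_ge0.
  apply: (@le_trans _ _ (\sum_(k : {set 'I_p}) ((superset_bound + missing_bound) * p%:R ^- #|k :\: t|)%:E)%E).
    by apply: lee_sum => k _; exact: hI.
  rewrite sumEFin lee_fin -mulr_sumr; apply: ler_wpM2l; last exact: sum_subset_weights.
  by rewrite addr_ge0 ?superset_bound_ge0 ?missing_bound_ge0.
apply: (@le_trans _ _ (P (D1 `|` D2 `|` D3 `|` D4))).
  by apply: le_measure; rewrite ?inE//; do ?apply: measurableU.
apply: le_trans (measureU2 _ _ _) _ => //; first by do ?apply: measurableU.
rewrite !EFinD; apply: leeD; last first.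
  by apply: (@markov_le _ _ _ P F) => //; rewrite powR_gt0.
apply: le_trans (measureU2 _ _ _) _ => //; first by apply: measurableU.
apply: leeD; last first.
  exact: (lsq_error_prob n0 alpha10 s0 e0 e1 bm0 de0 de8 gram_lb gram_ub eps_normal eps_indep
    (model_card_le tq) (size_small tq)).
apply: le_trans (measureU2 _ _ _) _ => //.
by apply: leeD; [exact: noise_large_prob|exact: noise_small_prob].
Qed.

End finite_sample.

(** * Asymptotics *)

Section growth.
Context (R : realType).

Lemma near_le_pow (C a : R) : 0 < a -> \forall n \near \oo, C <= n%:R `^ a.
Proof.
move=> a0; pose x := (Num.max 1 C) `^ a^-1.
near=> n.
have xn : x <= n%:R by near: n; exact: nbhs_infty_ger.
apply: (@le_trans _ _ (Num.max 1 C)); first by rewrite le_max lexx orbT.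
have m0 : 0 <= Num.max 1 C by rewrite le_max ler01.
apply: (@le_trans _ _ (x `^ a)).
  by rewrite /x -powRrM mulVf ?gt_eqF// powRr1.
by apply: ge0_ler_powR; rewrite ?nnegrE ?powR_ge0// ltW.
Unshelve. all: by end_near. Qed.

Lemma near_pow_le_pow (C a b : R) : a < b -> \forall n \near \oo, C * n%:R `^ a <= n%:R `^ b.
Proof.
move=> ab; near=> n.
have n0 : n%:R != 0 :> R by rewrite pnatr_eq0 -lt0n; near: n; exact: nbhs_infty_gt.
have -> : n%:R `^ b = n%:R `^ (b - a) * n%:R `^ a :> R.
  by rewrite -powRD ?subrK//; apply/implyP.
rewrite ler_wpM2r ?powR_ge0//.
by near: n; apply: near_le_pow; rewrite subr_gt0.
Unshelve. all: by end_near. Qed.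

Lemma near_ln_le_pow (a : R) : 0 < a -> \forall n \near \oo, ln n%:R <= n%:R `^ a :> R.
Proof.
move=> a0; have h0 : 0 < a / 2 by rewrite divr_gt0.
near=> n.
have n0 : 0 < n%:R :> R by rewrite ltr0n; near: n; exact: nbhs_infty_gt.
apply: (@le_trans _ _ ((a / 2)^-1 * n%:R `^ (a / 2))).
  rewrite -ler_pdivrMl ?invr_gt0// invrK -ln_powR ltW// ln_sublinear//.
  by rewrite powR_gt0.
by near: n; apply: near_pow_le_pow; rewrite ltr_pdivrMr// ltr_pMr// ltr1n.
Unshelve. all: by end_near. Qed.

Lemma bigO_pow_near (f : nat -> R) (a b : R) :
  f =O_\oo (fun n => n%:R `^ a) -> a < b -> \forall n \near \oo, `|f n| <= n%:R `^ b.
Proof.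
move=> /eqO_exP[C C0 hC] ab; near=> n.
have h1 : `|f n| <= C * `|n%:R `^ a| by near: n; exact: hC.
apply: (le_trans h1); rewrite ger0_norm ?powR_ge0//.
by near: n; exact: near_pow_le_pow.
Unshelve. all: by end_near. Qed.

Lemma bigO_ln_near (f : nat -> R) (g b : R) : 0 < g <= 1 ->
  f =O_\oo (fun n => ln n%:R `^ g) -> 0 < b -> \forall n \near \oo, `|f n| <= n%:R `^ b.
Proof.
move=> /andP[g0 g1] /eqO_exP[C C0 hC] b0.
have b20 : 0 < b / 2 by rewrite divr_gt0.
near=> n.
have h1 : `|f n| <= C * `|ln n%:R `^ g| by near: n; exact: hC.
apply: (le_trans h1); rewrite ger0_norm ?powR_ge0//.
apply: (@le_trans _ _ (C * n%:R `^ (b / 2))); last first.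
  by near: n; apply: near_pow_le_pow; rewrite ltr_pdivrMr// ltr_pMr// ltr1n.
rewrite ler_wpM2l ?(ltW C0)//.
have n1 : 1 <= n%:R :> R by near: n; exact: nbhs_infty_ger.
have l0 : 0 <= ln n%:R :> R by exact: ln_ge0.
have x1 : 1 <= n%:R `^ (b / 2) :> R by rewrite -[leLHS](powRr0 n%:R) ler_powR// ltW.
have hl : ln n%:R <= n%:R `^ (b / 2) :> R by near: n; exact: near_ln_le_pow.
case: (leP (ln n%:R) (1 : R)) => h.
  apply: le_trans x1; apply: (@le_trans _ _ (1 `^ g)); last by rewrite powR1.
  by apply: ge0_ler_powR; rewrite ?nnegrE// ltW.
apply: le_trans hl; rewrite -[leRHS]powRr1//; apply: ler_powR => //; exact: ltW.
Unshelve. all: by end_near. Qed.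

Lemma cvg_powRN_nat (a : R) : 0 < a -> (fun n : nat => n%:R `^ (- a) : R) @ \oo --> (0 : R).
Proof.
move=> a0; apply/cvgrPdist_le => /= x x0; near=> n.
rewrite sub0r normrN ger0_norm ?powR_ge0//.
have h : x^-1 <= n%:R `^ a by near: n; exact: near_le_pow.
rewrite powRN -[leRHS]invrK lef_pV2 ?posrE ?invr_gt0//.
by apply: lt_le_trans h; rewrite invr_gt0.
Unshelve. all: by end_near. Qed.

Lemma sqrt2_expRN1_lt1 : `|Num.sqrt 2 * expR (- 1)| < 1 :> R.
Proof.
rewrite ger0_norm ?mulr_ge0 ?sqrtr_ge0 ?expR_ge0// expRN ltr_pdivrMr ?expR_gt0// mul1r.
apply: (@lt_le_trans _ _ 2); last by apply: le_trans (expR_ge1Dx 1); lra.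
rewrite -[ltRHS]ger0_norm// -sqrtr_sqr ltr_sqrt ?exprn_gt0//.
by rewrite expr2; lra.
Qed.

Lemma expR18_sqrt2_lt1 : `|expR (1 / 8) / Num.sqrt 2| < 1 :> R.
Proof.
rewrite ger0_norm ?divr_ge0 ?sqrtr_ge0 ?expR_ge0// ltr_pdivrMr ?sqrtr_gt0// [ltRHS]mul1r.
have h : expR (1 / 8) <= 8 / 7 :> R.
  rewrite -[leLHS]invrK -expRN -[leRHS]invrK lef_pV2 ?posrE ?invr_gt0 ?divr_gt0 ?expR_gt0//.
  by apply: le_trans (expR_ge1Dx _); lra.
apply: (le_lt_trans h); rewrite -[ltLHS]ger0_norm ?divr_ge0// -sqrtr_sqr ltr_sqrt//.
by rewrite expr2; lra.
Qed.

End growth.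

(** Constants built from the size of the true model are thereby the same for all positive [n]. *)
Lemma card_model_of (p0 p : nat) (t : {fset nat}) : (p0 <= p)%N ->
  (forall j, j \in t -> (j < p0)%N) -> #|model_of p t| = #|model_of p0 t|.
Proof.
move=> p0p tp0.
have cE m : #|model_of m t| = (\sum_(0 <= i < m | i \in t) 1)%N.
  by rewrite big_mkord -sum1_card; apply: eq_bigl => i; rewrite inE.
rewrite !cE (big_cat_nat (leq0n p0) p0p)/= [X in (_ + X)%N](_ : _ = 0%N) ?addn0//.
rewrite big_nat_cond big1// => j /andP[/andP[h _] /tp0].
by rewrite ltnNge h.
Qed.

Lemma sqn_col_nat (R : realType) (p0 p : nat) (beta : nat -> R) : (p0 <= p)%N ->
  (forall j, (p0 <= j)%N -> beta j = 0) ->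
  sqn (\col_(i < p) beta i) = \sum_(0 <= j < p0) beta j ^+ 2.
Proof.
move=> p0p b0; rewrite /sqn; under eq_bigr do rewrite mxE.
rewrite -(big_mkord xpredT (fun j => beta j ^+ 2)) (big_cat_nat (leq0n p0) p0p)/=.
rewrite [X in _ + X]big_nat_cond [X in _ + X]big1 ?addr0// => j /andP[/andP[h _] _].
by rewrite b0// expr0n.
Qed.

Lemma exists_signal_bound (R : realType) (beta : nat -> R) (m : nat) :
  exists2 bm : R, 0 < bm & forall j, (j < m)%N -> beta j != 0 -> bm <= `|beta j|.
Proof.
elim: m => [|m [bm bm0 h]]; first by exists 1.
have [b0|b0] := eqVneq (beta m) 0.
  by exists bm => // j; rewrite ltnS leq_eqVlt => /orP[/eqP->|/h//]; rewrite b0 eqxx.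
exists (Num.min bm `|beta m|); first by rewrite lt_min bm0 normr_gt0.
move=> j; rewrite ltnS leq_eqVlt => /orP[/eqP->|jm] bj; first by rewrite ge_min lexx orbT.
by rewrite ge_min h.
Qed.

(** The eigenvalue assumption covers nonempty models; for the empty one the coefficient vector is
    0. *)
Lemma gram_bounds_all (R : realType) (n p : nat) (X : 'M[R]_(n, p)) (e : R) : (0 < n)%N -> 0 < e ->
  (forall k : {set 'I_p}, k != finset.set0 ->
     [/\ e <= lambda_min X k, lambda_min X k <= lambda_max X k & lambda_max X k <= e^-1]) ->
  forall k : {set 'I_p}, (#|k| <= n)%N -> forall b,
  n%:R * e * sqn b <= sqn (submodel_mx X k *m b) <= n%:R / e * sqn b.
Proof.
move=> n0 e0 hl k kn b; have [k0|k0] := eqVneq k finset.set0; last first.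
  by have [h1 _ h2] := hl _ k0; exact: gram_bounds.
have k00 : #|k| = 0%N by rewrite k0 cards0.
have -> : b = 0 by apply/colP => i; have := ltn_ord i; rewrite [X in (_ < X)%N]k00.
by rewrite mulmx0 /sqn !big1 ?mulr0 ?lexx// => i _; rewrite mxE expr0n.
Qed.

(** * The finite-sample bounds as powers of the sample size *)

Section regime.
Context (R : realType) (n p r : nat) (t : {set 'I_p})
  (alpha1 alpha2 a1 a2 s e bm b2 c1 c2 de x y z : R) (K : nat).
Hypotheses (n0 : (0 < n)%N) (e0 : 0 < e) (e1 : e <= 1)
  (bm0 : 0 < bm) (s0 : 0 < s) (c20 : 0 < c2) (de0 : 0 < de) (de8 : de <= 1 / 8).

Let tr := true_rate r t alpha2 a1 a2 s e bm b2.
Let gr := growth_rate r t alpha1 a2 s e b2 c1 de.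
Let ch := chernoff_const t alpha2 a2 s bm b2 de.
Let rate := signal_rate s bm de.
Let lc := Num.max 1 c1.

Let nn1 : 1 <= n%:R :> R. Proof. by rewrite (ler_nat R 1 n). Qed.
Let nn0 : 0 < n%:R :> R. Proof. by rewrite ltr0n. Qed.
Let tr1 : 1 <= tr. Proof. exact: true_rate_ge1. Qed.
Let sr1 : 1 <= size_rate r t alpha1 a2 s e b2. Proof. exact: size_rate_ge1. Qed.
Let G1 : 1 <= (e * Num.sqrt de)^-1.
Proof.
rewrite invf_ge1; last by positivity.
rewrite -[leRHS]mulr1; apply: ler_pM; rewrite ?sqrtr_ge0 ?(ltW e0)//.
by rewrite -sqrtr1 ler_wsqrtr//; move: de8; lra.
Qed.
Let Ggr : (e * Num.sqrt de)^-1 <= gr.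
Proof.
rewrite /gr /growth_rate ler_peMl ?(le_trans _ G1)//.
by rewrite -[leLHS]mulr1 ler_pM// le_max lexx.
Qed.
Let gr1 : 1 <= gr. Proof. exact: le_trans Ggr. Qed.

Hypotheses (gr_x : gr <= n%:R `^ x) (tr_x : tr <= n%:R `^ x) (lc_n : lc <= n%:R) (x1 : x <= 1).

(** The rates enter with total exponent [2 |t| + 1], that is at most [n ^ (1 / 8)], against
    [n ^ (-1/4)]. *)
Lemma superset_bound_le : x * (2 * #|t| + 1)%:R <= 1 / 8 ->
  superset_bound n r t alpha1 alpha2 a1 a2 s e bm b2 c1 de <= ch * base_bound R * n%:R `^ (- (1 / 8)).
Proof.
move=> xt; rewrite /superset_bound -/tr -/gr -/ch.
have ch0 : 0 < ch by exact: chernoff_const_gt0.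
have bb0 : 0 < base_bound R by rewrite lt_max ltr01.
have tr0 : 0 <= tr by exact: le_trans tr1.
have gr0 : 0 <= gr by exact: le_trans gr1.
rewrite -!mulrA; do 2 rewrite ler_wpM2l ?(ltW ch0) ?(ltW bb0)//.
apply: (@le_trans _ _ ((n%:R `^ x) ^+ #|t| * ((n%:R `^ x) ^+ #|t|.+1 / Num.sqrt (Num.sqrt n%:R)))).
  apply: ler_pM; [by positivity|by positivity| |].
    by apply: lerXn2r; rewrite ?nnegrE ?powR_ge0.
  by rewrite ler_wpM2r ?invr_ge0 ?sqrtr_ge0//; apply: lerXn2r; rewrite ?nnegrE ?powR_ge0.
have -> : Num.sqrt (Num.sqrt n%:R) = n%:R `^ (1 / 4) :> R.
  rewrite -!powR12_sqrt ?powR_ge0 ?(ltW nn0)// -powRrM; congr (_ `^ _).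
  by field.
rewrite mulrA -exprD -powR_mulrn ?powR_ge0// -powRrM -powRN -powRD; last first.
  by apply/implyP => _; exact: lt0r_neq0.
apply: ler_powR => //.
have -> : (#|t| + #|t|.+1)%N = (2 * #|t| + 1)%N by rewrite addnS mul2n -addnn addn1.
by move: (x * _) xt => u; lra.
Qed.

Let ln_n : 0 <= ln n%:R :> R. Proof. exact: ln_ge0. Qed.

Lemma pow_expR (u : R) (k : nat) : 1 <= u -> u ^+ k = expR (k%:R * ln u).
Proof. by move=> u1; rewrite expRM_natl lnK// posrE (lt_le_trans _ u1). Qed.

Let ln_le_n (u : R) : 1 <= u -> u <= n%:R `^ x -> ln u <= ln n%:R.
Proof.
move=> u1 un; rewrite ler_ln ?posrE ?(lt_le_trans _ u1)//.
by apply: (le_trans un); rewrite -[leRHS]powRr1 ?ler_powR ?(ltW nn0).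
Qed.

(* [y] bounds both [log n] and [log p], [z] is a lower bound for [e n] *)
Hypotheses (lny : ln n%:R <= y) (lnpy : ln p%:R <= y) (Kny : K%:R * ln n%:R <= y)
  (zen : z <= e * n%:R)
  (yz : (#|t|%:R * (r%:R + 3 + c2) + 1) * y + ln n%:R <= rate / 16 * z).

Let y0 : 0 <= y. Proof. exact: le_trans lny. Qed.

(** The separate [ln n] in [yz] is what remains as [1 / n]. *)
Let expR_signal_le (u : R) : u <= (#|t|%:R * (r%:R + 3 + c2) + 1) * y ->
  expR u * expR (- (rate / 16 * (e * n%:R))) <= n%:R^-1.
Proof.
move=> uy; rewrite -expRD -[leRHS]invrK invrK -[n%:R in leRHS]lnK ?posrE// -expRN ler_expR.
have r0 : 0 < rate by exact: signal_rate_gt0.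
have : rate / 16 * z <= rate / 16 * (e * n%:R) by rewrite ler_wpM2l// divr_ge0// ltW.
by move: (rate / 16 * (e * n%:R)) (rate / 16 * z) yz uy => A B; lra.
Qed.

Lemma lsq_error_bound_le :
  (e * Num.sqrt de) ^- #|t| * expR (- (rate / 16 * (e * n%:R))) <= n%:R^-1.
Proof.
rewrite -exprVn (pow_expR _ G1); apply: expR_signal_le.
have h : ln (e * Num.sqrt de)^-1 <= y.
  by apply: le_trans lny; apply: ln_le_n => //; exact: le_trans gr_x.
have key (T' B' c Y u : R) : 0 <= T' -> 0 <= B' -> 0 <= c -> 0 <= Y -> u <= Y ->
    T' * u <= (T' * (B' + 3 + c) + 1) * Y.
  move=> T0 B0 c0 Y0 uY; have := ler_wpM2l T0 uY.
  have := mulr_ge0 (mulr_ge0 T0 B0) Y0; have := mulr_ge0 (mulr_ge0 T0 c0) Y0.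
  have := mulr_ge0 T0 Y0; nra.
by apply: key => //; exact: ltW.
Qed.

(** Everything is compared in logarithms, in units of [y]: per index of [t], one unit for the prior
    constant, one for [tr], [r + 1] for the power of [n] and [c2] for that of [p], in total
    [r + 3 + c2]; one more unit covers [growth_rate ^+ K]. *)
Lemma missing_bound_le :
  missing_bound n r t alpha1 alpha2 a1 a2 s e bm b2 c1 c2 de K <= ch * base_bound R * n%:R^-1.
Proof.
rewrite /missing_bound -/tr -/gr -/ch -/rate -/lc.
have ch0 : 0 < ch by exact: chernoff_const_gt0.
have bb0 : 0 < base_bound R by rewrite lt_max ltr01.
have lc1 : 1 <= lc by rewrite le_max lexx.
have lc0 : 0 < lc by exact: lt_le_trans lc1.
have tr0 : 0 < tr by exact: lt_le_trans tr1.
set Q := lc * _ * _.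
have hQ : Q ^+ #|t| <= expR (#|t|%:R * ((r%:R + 3 + c2) * y)).
  have [t0|t0] := posnP #|t|; first by rewrite t0 expr0 mul0r expR0.
  have p0 : (0 < p)%N.
    by apply: (leq_trans t0); rewrite -[X in (_ <= X)%N]card_ord max_card.
  have pp0 : 0 < p%:R :> R by rewrite ltr0n.
  have pc1 : 1 <= p%:R `^ c2 :> R.
    by rewrite -[leLHS](powRr0 p%:R) ler_powR ?(ltW c20)// (ler_nat R 1 p).
  have np1 : 1 <= n%:R ^+ r.+1 :> R by exact: exprn_ege1.
  have Q1 : 1 <= Q by rewrite -[leLHS]mulr1 ler_pM// -[leLHS]mulr1 ler_pM.
  rewrite (pow_expR _ Q1) ler_expR ler_wpM2l//.
  have -> : ln Q = ln lc + c2 * ln p%:R + (ln tr + r.+1%:R * ln n%:R).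
    rewrite /Q lnM ?posrE; [|by positivity|by positivity].
    rewrite [ln (lc * _)]lnM ?posrE; [|by []|by positivity].
    rewrite [ln (tr * _)]lnM ?posrE; [|by []|by positivity].
    by rewrite ln_powR lnXn// mulr_natl.
  have h1 : ln lc <= y.
    by apply: le_trans lny; rewrite ler_ln ?posrE ?(lt_le_trans _ lc1).
  have h2 : ln tr <= y by apply: le_trans lny; exact: ln_le_n.
  rewrite -natr1; have := ler_wpM2l (ltW c20) lnpy; have := ler_wpM2l (ler0n R r) lny.
  have key (u v w o A' C Y : R) : u <= Y -> v <= Y -> w <= Y -> A' * w <= A' * Y -> C * o <= C * Y ->
      u + C * o + (v + (A' + 1) * w) <= (A' + 3 + C) * Y by lra.
  exact: key.
have h3 : K%:R * ln gr <= y.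
  by apply: le_trans Kny; rewrite ler_wpM2l//; exact: ln_le_n.
rewrite (pow_expR _ gr1) -[_ * expR (- _)]mulrA -[_ * Q ^+ _ * _]mulrA.
apply: ler_wpM2l; first by rewrite mulr_ge0 ?ltW.
apply: le_trans (ler_wpM2r _ hQ) _; first by rewrite mulr_ge0 ?expR_ge0.
rewrite [leLHS]mulrA -expRD; apply: expR_signal_le.
have key (u T' B' Y : R) : u <= Y -> T' * (B' * Y) + u <= (T' * B' + 1) * Y by lra.
exact: key.
Qed.

End regime.

Theorem theorem5p2 (R : realType)
  (* design matrices and prior scale matrices *)
  (p : nat -> nat)
  (X : forall n : nat, 'M[R]_(n, p n))
  (A : forall n : nat, 'M[R]_(p n))
  (* true parameters *)
  (t : {fset nat}) (beta0 : nat -> R) (sigma0 : R)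
  (* noise *)
  (d : measure_display) (T : measurableType d) (P : probability T R)
  (eps : forall n : nat, 'I_n -> {RV P >-> R})
  (* hyperparameters *)
  (r : nat) (alpha1 alpha2 c1 c2 : R) (q : nat -> R)
  (* constants of the assumptions *)
  (epsn : nat -> R) (xi a1 a2 kappa : R)
  (p_incr : {homo p : m n / (m <= n)%N})
  (t_sub : forall n j : nat, (0 < n)%N -> j \in t -> (j < p n)%N)
  (beta0_supp : forall j : nat, (beta0 j != 0) = (j \in t))
  (sigma0_gt0 : 0 < sigma0)
  (eps_normal : forall (n : nat) (i : 'I_n) (B : set R), measurable B ->
     distribution P (eps n i) B = normal_prob 0 sigma0 B)
  (eps_indep : forall n : nat, mutually_independent (eps n))
  (r_gt0 : (0 < r)%N)
  (alpha1_gt0 : 0 < alpha1) (alpha2_gt0 : 0 < alpha2)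
  (c1_gt0 : 0 < c1) (c2_gt0 : 0 < c2)
  (A_sym : forall n : nat, (0 < n)%N -> (A n)^T = A n)
  (* (1) *)
  (epsn_lt1 : forall n : nat, (0 < n)%N -> 0 < epsn n < 1)
  (lambda_bounds : forall (n : nat) (k : {set 'I_(p n)}), (0 < n)%N ->
     k != finset.set0 ->
     [/\ epsn n <= lambda_min (X n) k,
         lambda_min (X n) k <= lambda_max (X n) k &
         lambda_max (X n) k <= (epsn n)^-1])
  (epsn_bigO : (fun n : nat => ((epsn n)^-1)%R) =O_\oo
               (fun n : nat => ln n%:R `^ (1 / 8)))
  (* (2); that models larger than q n have prior mass 0 is built into the
     complexity prior *)
  (q_bigO : q =O_\oo (fun n : nat => n%:R `^ xi))
  (xi_lt1 : xi < 1)
  (t_le_q : forall n : nat, (0 < n)%N -> #|model_of (p n) t|%:R <= q n)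
  (* (3) *)
  (a1_gt0 : 0 < a1) (a1_lt_a2 : a1 < a2)
  (A_eigen : forall (n : nat) (a : R), (0 < n)%N -> eigenvalue (A n) a ->
     a1 < a < a2)
  (* (4) *)
  (kappa_gt0 : 0 < kappa) (kappa_lt1 : kappa < 1)
  (logp_bigO : (fun n : nat => ln (p n)%:R : R) =O_\oo
               (fun n : nat => n%:R `^ kappa))
  (* (5) *)
  (c2_gt1 : 1 < c2) :
  cvg_in_probability P
    (fun (n : nat) (w : T) =>
       posterior r alpha1 alpha2 c1 c2 (q n) (X n) (A n) (model_of (p n) t)
         (X n *m (\col_i beta0 i) + \col_i eps n i w))
    1.
Proof.
(* Sample size 1 is the reference: [t] lies below [p 1], so [tt], [b2] and [bm] can be fixed once
   for all [n]. *)
have p1n n : (0 < n)%N -> (p 1 <= p n)%N by move=> n0; exact: p_incr.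
pose t1 := model_of (p 1) t; pose tt := #|t1|.
have tE n : (0 < n)%N -> #|model_of (p n) t| = tt.
  by move=> n0; apply: card_model_of => [|j]; [exact: p1n|exact: t_sub].
have beta_out j : (p 1 <= j)%N -> beta0 j = 0.
  move=> pj; apply/eqP; apply: contraTT pj; rewrite beta0_supp -ltnNge.
  exact: t_sub.
pose b2 : R := \sum_(0 <= j < p 1) beta0 j ^+ 2.
have b2E n : (0 < n)%N -> sqn (\col_(i < p n) beta0 i) = b2.
  by move=> n0; apply: sqn_col_nat => //; exact: p1n.
have b20 : 0 <= b2 by apply: sumr_ge0 => j _; exact: sqr_ge0.
have [bm bm0 hbm] := exists_signal_bound beta0 (p 1).
have a20 : 0 < a2 by exact: lt_trans a1_lt_a2.
(* The second entry solves [c2 (1 - 4 de) = 1] and is positive because [c2 > 1]; the cap serves the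
   Chernoff and moment bounds. *)
pose de : R := Num.min (1 / 8) ((1 - c2^-1) / 4).
have c2V : 0 < 1 - c2^-1 by rewrite subr_gt0 invf_lt1.
have de0 : 0 < de by rewrite lt_min !divr_gt0.
have de8 : de <= 1 / 8 by rewrite ge_min lexx.
have c2de : 1 <= c2 * (1 - 4 * de).
  have h : de <= (1 - c2^-1) / 4 by rewrite ge_min lexx orbT.
  rewrite -ler_pdivrMl// mulr1; move: h; move: (c2^-1) => u; lra.
(* An exponent below 1 that eventually dominates both [q n] and [ln (p n)], constants included. *)
pose zeta : R := (1 + Num.max xi kappa) / 2.
have [zx zk z1] : [/\ xi < zeta, kappa < zeta & zeta < 1].
  have h1 : Num.max xi kappa < 1 by rewrite gt_max xi_lt1.
  have h2 : xi <= Num.max xi kappa by rewrite le_max lexx.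
  have h3 : kappa <= Num.max xi kappa by rewrite le_max lexx orbT.
  by rewrite /zeta; move: (Num.max xi kappa) h1 h2 h3 => u h1 h2 h3; split; lra.
have z0 : 0 < zeta by exact: lt_trans zk.
(* In the bound for the supersets of t the rates, which are at most n^x, occur with
   total exponent 2 tt + 1, against n^(-1/4). *)
pose x : R := (8 * (2 * tt + 1)%:R)^-1.
have x0 : 0 < x by rewrite invr_gt0 mulr_gt0// ltr0n addn1.
have xt : x * (2 * tt + 1)%:R <= 1 / 8.
  by rewrite /x invfM mulfVK ?div1r// pnatr_eq0 addn1.
have x8 : x <= 1 / 8.
  apply: le_trans xt; rewrite -[leLHS]mulr1 ler_wpM2l ?(ltW x0)//.
  by rewrite (ler_nat R 1) addn1.
(* [n ^ eta] will bound [1 / epsn n] and [ln n]. [growth_rate] contains [2 r + 2] factors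
   [1 / epsn n], hence the first entry; the second gives [zeta + eta < 1 - eta], by which the
   exponential wins. *)
pose eta : R := Num.min (x / (2 * (2 * r).+2%:R)) ((1 - zeta) / 4).
have r2 : 0 < (2 * r).+2%:R :> R by rewrite ltr0n.
have eta0 : 0 < eta by rewrite lt_min !divr_gt0 ?mulr_gt0// subr_gt0.
have etax : (2 * r).+2%:R * eta < x.
  have h : eta <= x / (2 * (2 * r).+2%:R) by rewrite ge_min lexx.
  have := ler_wpM2l (ltW r2) h.
  have -> : (2 * r).+2%:R * (x / (2 * (2 * r).+2%:R)) = x / 2.
    by field; rewrite gt_eqF.
  by move: x0; lra.
have etax1 : eta < x.
  by apply: le_lt_trans etax; rewrite ler_peMl ?(ltW eta0)// (ler_nat R 1).
have zee : zeta + eta < 1 - eta.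
  have : eta <= (1 - zeta) / 4 by rewrite ge_min lexx orbT.
  by move: z1; lra.
have x4 : x <= 1 / 4 by move: x8; lra.
have x1 : x <= 1 by move: x8; lra.
(* [growth_rate] without its powers of [1 / epsn n]. *)
pose g0 : R := Num.max 1 c1^-1 * (Num.max 1 (model_factor r alpha1 a2 sigma0 b2) * hpow r 2 ^+ tt)
  / Num.sqrt de.
pose tf : R := Num.max 1 (true_factor r t1 alpha2 a1 a2 sigma0 bm b2).
pose rate : R := signal_rate sigma0 bm de.
have rate0 : 0 < rate by exact: signal_rate_gt0.
pose D : R := tt%:R * (r%:R + 3 + c2) + 1.
have D0 : 0 <= D.
  by rewrite addr_ge0// mulr_ge0// !addr_ge0// ltW.
have g00 : 0 <= g0.
  rewrite divr_ge0 ?sqrtr_ge0// mulr_ge0 ?le_max ?ler01// mulr_ge0 ?le_max ?ler01//.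
  by rewrite exprn_ge0// ltW// hpow_gt0.
have tf0 : 0 <= tf by rewrite le_max ler01.
pose cb : R := chernoff_const t1 alpha2 a2 sigma0 bm b2 de * base_bound R.
move=> et et0.
pose CC : R := 2 ^+ tt * expR 1 / et `^ (1 - 4 * de).
(* Majorant of the finite-sample bound: too large noise, too small noise, bad least squares
   estimate, and the Markov term. *)
pose f (n : nat) : R := (Num.sqrt 2 * expR (- 1)) ^+ n + (expR (1 / 8) / Num.sqrt 2) ^+ n +
  n%:R `^ (- 1) + (cb * n%:R `^ (- (1 / 8)) + cb * n%:R `^ (- 1)) * CC.
have f0 : f @ \oo --> (0 : R).
  rewrite (_ : (0 : R) = 0 + 0 + 0 + (cb * 0 + cb * 0) * CC); last by rewrite !(mulr0, addr0, mul0r).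
  apply: cvgD; last by apply: cvgMl; apply: cvgD; apply: cvgMr; exact: cvg_powRN_nat.
  apply: cvgD; last exact: cvg_powRN_nat.
  by apply: cvgD; apply: cvg_expr; [exact: sqrt2_expRN1_lt1|exact: expR18_sqrt2_lt1].
apply: (@squeeze_cvge _ _ _ _ (fun=> 0%E) _ (fun n => (f n)%:E)); last 2 first.
- exact: cvg_cst.
- by apply: cvg_EFin => //; exact: nearW.
near=> n; rewrite measure_ge0/=.
have n0 : (0 < n)%N by near: n; exact: nbhs_infty_gt.
have n4 : 4 <= n%:R :> R by near: n; exact: nbhs_infty_ger.
have lc_n : Num.max 1 c1 <= n%:R by near: n; exact: nbhs_infty_ger.
have nq : `|q n| <= n%:R `^ zeta by near: n; exact: (bigO_pow_near q_bigO zx).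
have nlp : `|ln (p n)%:R| <= n%:R `^ zeta by near: n; exact: (bigO_pow_near logp_bigO zk).
have neps : `|(epsn n)^-1| <= n%:R `^ eta.
  by near: n; apply: bigO_ln_near epsn_bigO eta0; rewrite divr_gt0//= ler_pdivrMr// mul1r ler1n.
have nln : ln n%:R <= n%:R `^ eta :> R by near: n; exact: near_ln_le_pow.
have ng : g0 * n%:R `^ ((2 * r).+2%:R * eta) <= n%:R `^ x by near: n; exact: near_pow_le_pow.
have ntf : tf * n%:R `^ eta <= n%:R `^ x by near: n; exact: near_pow_le_pow.
have nsize : (alpha1 + r.+1%:R) / de * n%:R `^ zeta <= n%:R `^ 1.
  by near: n; exact: near_pow_le_pow.
have nyz : (D + 1) * 16 / rate * n%:R `^ (zeta + eta) <= n%:R `^ (1 - eta).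
  by near: n; apply: near_pow_le_pow; exact: zee.
set k0 := model_of (p n) t.
have k0E : #|k0| = tt by exact: tE.
have nn0 : 0 < n%:R :> R by rewrite ltr0n.
have nn1 : 1 <= n%:R :> R by rewrite (ler_nat R 1 n).
have /andP[e0 e1] := epsn_lt1 n n0.
have e1' := ltW e1.
have npow (a b : R) : a <= b -> n%:R `^ a <= n%:R `^ b by exact: ler_powR.
have einv : (epsn n)^-1 <= n%:R `^ eta by exact: le_trans (ler_norm _) neps.
have gb := gram_bounds_all n0 e0 (fun k => @lambda_bounds n k n0).
have glb (k : {set 'I_(p n)}) : (#|k| <= n)%N -> forall b, n%:R * epsn n * sqn b <= sqn (submodel_mx (X n) k *m b).
  by move=> kn b; have /andP[] := gb k kn b.
have gub (k : {set 'I_(p n)}) : (#|k| <= n)%N -> forall b, sqn (submodel_mx (X n) k *m b) <= n%:R / epsn n * sqn b.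
  by move=> kn b; have /andP[] := gb k kn b.
have hquad k := principal_bounds (A_sym n n0) (fun a => @A_eigen n a n0) (k := k).
have hdet k := principal_det_gt0 k (A_sym n n0) a1_gt0 (fun a => @A_eigen n a n0).
have bout (j : 'I_(p n)) : j \notin k0 -> (\col_(i < p n) beta0 i) j 0 = 0.
  by rewrite inE mxE -beta0_supp negbK => /eqP.
have bin (j : 'I_(p n)) : j \in k0 -> bm <= `|(\col_(i < p n) beta0 i) j 0|.
  rewrite inE mxE => jt; apply: hbm; last by rewrite beta0_supp.
  exact: t_sub.
have bb2 : sqn (\col_(i < p n) beta0 i) <= b2 by rewrite b2E.
have tq := t_le_q n n0.
have qn : q n <= n%:R `^ zeta by exact: le_trans (ler_norm _) nq.
have q0 : 0 <= q n by exact: le_trans tq.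
have nz1 : 1 <= n%:R `^ zeta by rewrite -[leLHS](powRr0 n%:R) npow// ltW.
have hsize (k : {set 'I_(p n)}) : #|k|%:R <= q n -> alpha1 + r.+1%:R * #|k|%:R <= de * n%:R.
  move=> kq; have kz := le_trans kq qn.
  apply: (@le_trans _ _ (de * ((alpha1 + r.+1%:R) / de * n%:R `^ zeta))); last first.
    by rewrite ler_wpM2l ?(ltW de0)// -[leRHS]powRr1.
  rewrite mulrA [de * _]mulrC divfK ?gt_eqF// mulrDl; apply: lerD; last by rewrite ler_wpM2l.
  by rewrite ler_peMr// ltW.
pose K := Num.truncn (q n).
have hK (k : {set 'I_(p n)}) : #|k|%:R <= q n -> (#|k| <= K)%N by rewrite /K truncn_ge_nat.
have N2 : 2 <= n%:R / 2 + alpha1 by rewrite -[leLHS]addr0 lerD ?(ltW alpha1_gt0)// ler_pdivlMr// -natrM.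
have grx : growth_rate r k0 alpha1 a2 sigma0 (epsn n) b2 c1 de <= n%:R `^ x.
  apply: le_trans ng; rewrite /growth_rate /size_rate k0E.
  have -> : n%:R `^ ((2 * r).+2%:R * eta) = (n%:R `^ eta) ^+ (2 * r).+2.
    by rewrite mulrC powRrM powR_mulrn ?powR_ge0.
  apply: (@le_trans _ _ (g0 * (epsn n)^-1 ^+ (2 * r).+2)); last first.
    by rewrite ler_wpM2l// lerXn2r ?nnegrE ?powR_ge0 ?invr_ge0 ?(ltW e0).
  rewrite le_eqVlt; apply/orP; left; apply/eqP.
  rewrite /g0 invfM [_^-1 ^+ (2 * r).+2]exprS exprVn.
  have key (a b c d' u v : R) : a * (b * c * d') * (u * v) = a * (b * c) * v * (u * d') by ring.
  exact: key.
have trx : true_rate r k0 alpha2 a1 a2 sigma0 (epsn n) bm b2 <= n%:R `^ x.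
  apply: le_trans ntf; rewrite /true_rate.
  have -> : true_factor r k0 alpha2 a1 a2 sigma0 bm b2 = true_factor r t1 alpha2 a1 a2 sigma0 bm b2.
    by rewrite /true_factor /residual_shift k0E.
  by rewrite ler_wpM2l.
have gs : growth_rate r k0 alpha1 a2 sigma0 (epsn n) b2 c1 de <= Num.sqrt (Num.sqrt n%:R).
  apply: (le_trans grx).
  have -> : Num.sqrt (Num.sqrt n%:R) = n%:R `^ (1 / 4) :> R.
    rewrite -!powR12_sqrt ?powR_ge0 ?(ltW nn0)// -powRrM; congr (_ `^ _).
    by field.
  exact: npow.
apply: le_trans (posterior_consistent_prob n0 alpha1_gt0 alpha2_gt0 a1_gt0 a20 sigma0_gt0 e0 e1'
  bm0 c1_gt0 c2_gt0 de0 de8 c2de glb gub hquad hdet bout bin bb2 tq (@eps_normal n) (@eps_indep n)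
  hsize hK N2 gs et0) _.
(* [y] is the product of the bounds [n ^ zeta] on the model size and [n ^ eta] on [ln n]; [z] bounds
   [epsn n * n] from below because [1 / epsn n <= n ^ eta]. *)
pose y : R := n%:R `^ (zeta + eta); pose z : R := n%:R `^ (1 - eta).
have yE : y = n%:R `^ zeta * n%:R `^ eta by rewrite /y powRD//; apply/implyP => _; exact: lt0r_neq0.
have lny : ln n%:R <= y by apply: (le_trans nln); rewrite npow// lerDr ltW.
have lnpy : ln (p n)%:R <= y.
  by apply: (le_trans (le_trans (ler_norm _) nlp)); rewrite npow// lerDl ltW.
have Kny : K%:R * ln n%:R <= y.
  rewrite yE; apply: ler_pM => //; first exact: ln_ge0.
  by apply: le_trans qn; rewrite /K truncn_le.
have zen : z <= epsn n * n%:R.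
  rewrite /z powRD ?powRr1 ?(ltW nn0)//; last by apply/implyP => _; exact: lt0r_neq0.
  rewrite mulrC ler_wpM2r ?(ltW nn0)// powRN -[leRHS]invrK lef_pV2 ?posrE ?invr_gt0//.
  by rewrite powR_gt0.
have yz : (#|k0|%:R * (r%:R + 3 + c2) + 1) * y + ln n%:R <= rate / 16 * z.
  rewrite k0E -/D; apply: (@le_trans _ _ ((D + 1) * y)).
    by rewrite [leRHS]mulrDl mul1r lerD2l (le_trans nln)// npow// lerDr ltW.
  have r16 : 0 < rate / 16 by rewrite divr_gt0.
  have := ler_wpM2l (ltW r16) nyz; rewrite -/y -/z; apply: le_trans.
  rewrite le_eqVlt; apply/orP; left; apply/eqP.
  by field; rewrite gt_eqF.
have xk : x * (2 * #|k0| + 1)%:R <= 1 / 8 by rewrite k0E.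
have chE : chernoff_const k0 alpha2 a2 sigma0 bm b2 de * base_bound R = cb.
  by rewrite /cb /chernoff_const /residual_shift k0E.
have h1 := superset_bound_le n0 e0 e1' de0 de8 grx trx xk.
have h2 := missing_bound_le n0 e0 e1' bm0 sigma0_gt0 c2_gt0 de0 de8 grx trx lc_n x1 lny lnpy Kny zen yz.
have h3 := lsq_error_bound_le n0 e0 e1' bm0 sigma0_gt0 c2_gt0 de0 de8 grx x1 lny zen yz.
rewrite chE in h1; rewrite chE in h2.
have nV : n%:R `^ (- 1) = n%:R^-1 :> R by rewrite powR_inv1.
rewrite lee_fin /f nV; apply: lerD; first by rewrite lerD2l.
rewrite -mulrA k0E -/CC; apply: ler_wpM2r; last exact: lerD.
by rewrite /CC divr_ge0 ?powR_ge0// mulr_ge0 ?expR_ge0// exprn_ge0.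
Unshelve. all: by end_near. Qed.
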